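(* For every integer $n\ge 1$ and all constants $M>0$, $C>0$ there is a constant $C_1>0$, depending only on $n$, $M$ and $C$, with the following property. Let $\lambda>1$ be arbitrary and let $\omega(t)$, $t\in[-1,0]$, be a solution of the Calabi flow in $\lambda\mathcal H_{T^n}$ on $X=\mathbb C^n/(\mathbb Z^n+i\mathbb Z^n)$, with initial metric $\omega(-1)\in\lambda\mathcal H_{T^n}$. Suppose that: (1) $|Rm(t,x)|\le 1$ for all $(t,x)\in[-1,0]\times X$; (2) $\int_X |Rm(0,x)|^n\,\omega(0)^n< C$; (3) the Legendre transform $u(0,\cdot)$ of the Kähler potential of $\omega(0)$ satisfies the $M$-condition on $\lambda P=[-\frac{\lambda}{2},\frac{\lambda}{2}]^n$; (4) $x\in X$ is a point with $|Rm(0,x)|=1$. Then the injectivity radius at $x$ of the Riemannian metric of $\omega(0)$ is at least $C_1$.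
   Context: Setting. $X=\mathbb C^n/(\mathbb Z^n+i\mathbb Z^n)$ with coordinates $z=\xi+i\eta$, $\xi,\eta\in\mathbb R^n$ periodic; $T^n$ acts by translation in $\eta$. Let $\omega_0=\sum_\alpha d\xi_\alpha\wedge d\eta_\alpha$ be the flat metric. $\mathcal H_{T^n}$ is the set of smooth $\mathbb Z^n$-periodic functions $\phi(\xi)$ on $\mathbb R^n$ (equivalently, smooth $T^n$-invariant functions on $X$) such that $v(\xi)=\frac12|\xi|^2+\phi(\xi)$ has positive definite real Hessian; the corresponding $T^n$-invariant Kähler metric $\omega_\phi$ in the class $[\omega_0]$ is $\omega_\phi=\sum_{i,j} v_{ij}\,d\xi_i\wedge d\eta_j$, with local Kähler potential $v$ and Riemannian metric $\sum v_{ij}(d\xi_i d\xi_j+d\eta_i d\eta_j)$. Its scalar curvature is $S=-\sum_{i,j}v^{i\bar j}(\log\det(v_{a\bar b}))_{i\bar j}$. Rescaling. For $\lambda>0$, $\lambda\mathcal H_{T^n}$ denotes the set of rescaled metrics $\lambda\omega_\phi$, $\phi\in\mathcal H_{T^n}$, with local Kähler potential $\lambda v$. Legendre transform. For a metric with (convex) potential $v$ on $\mathbb R^n$, put $x=\nabla v(\xi)$ and define $u(x)=x\cdot\xi-v(\xi)$ on $\mathbb R^n$. For a metric in $\mathcal H_{T^n}$ the function $u(x)-\frac12|x|^2$ is periodic with fundamental domain $P=[-\frac12,\frac12]^n$. For the metric $\lambda\omega_\phi$ the Legendre transform is $\lambda u(x/\lambda)$, with fundamental domain $\lambda P$. Calabi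 flow. A smooth family of metrics with potentials $v(t,\xi)$ solving $\partial_t v=S-\underline S$ (here the average scalar curvature $\underline S$ is $0$); in terms of Legendre transforms, $\partial_t u=\sum_{i,j}\frac{\partial^2u^{ij}}{\partial x_i\partial x_j}$, where $(u^{ij})=(u_{ij})^{-1}$. Curvature norm. $|Rm|^2=\sum_{i,j,k,l}u^{ij}{}_{kl}\,u^{kl}{}_{ij}$, where $u^{ij}{}_{kl}=\partial^2u^{ij}/\partial x_k\partial x_l$. $M$-condition. Let $Q\subset\mathbb R^n$ be a cube and $u$ a smooth function on it. For a line segment $\overline{p_0p_3}\subset Q$, let $p_1,p_2$ be the points dividing it into three segments $\overline{p_0p_1},\overline{p_1p_2},\overline{p_2p_3}$ of equal length, and $\nu$ the unit vector parallel to $p_3-p_0$. $u$ satisfies the $M$-condition on $Q$ if $|\nabla_\nu u(p_1)-\nabla_\nu u(p_2)|<M$ for every such segment. *)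

(* Defs.v *)
From HB Require Import structures.
From mathcomp Require Import all_boot all_order all_algebra.
From mathcomp Require Import all_classical all_reals all_analysis.

Set Implicit Arguments.
Unset Strict Implicit.
Unset Printing Implicit Defensive.

Import Order.TTheory GRing.Theory Num.Theory.
Import numFieldNormedType.Exports.

Local Open Scope classical_set_scope.
Local Open Scope ring_scope.

Section Calculus.
Context {R : realType}.

(* For finite-dimensional V, existence and continuity of all iterated
   directional derivatives up to order k on the open set U is the usual C^k. *)
Fixpoint Ck {V W : normedModType R} (k : nat) (U : set V) (f : V -> W) : Prop :=
  (forall x, U x -> {for x, continuous f}) /\
  if k is k'.+1 then
    forall v, (forall x, U x -> derivable f x v) /\ Ck k' U ('D_v f)
  else True.

(* Smoothness on an arbitrary set (e.g. up to the boundary of a closed set)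
   is smoothness on some open neighbourhood of it. *)
Definition smooth_on {V W : normedModType R} (A : set V) (f : V -> W) : Prop :=
  exists U : set V, [/\ open U, A `<=` U & forall k, Ck k U f].

Definition partial {m} (i : 'I_m) (f : 'rV[R]_m -> R) (x : 'rV[R]_m) : R :=
  'D_(delta_mx 0 i) f x.

Definition grad {m} (f : 'rV[R]_m -> R) (x : 'rV[R]_m) : 'rV[R]_m :=
  \row_i partial i f x.

Definition hess {m} (f : 'rV[R]_m -> R) (x : 'rV[R]_m) : 'M[R]_m :=
  \matrix_(i, j) partial i (partial j f) x.

Definition dotp {m} (x y : 'rV[R]_m) : R := \sum_i x 0 i * y 0 i.

(* The library norm on 'rV is the sup norm. *)
Definition enorm {m} (x : 'rV[R]_m) : R := Num.sqrt (dotp x x).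

Definition quadf {m} (A : 'M[R]_m) (w : 'rV[R]_m) : R := (w *m A *m w^T) 0 0.

Definition posdefmx {m} (A : 'M[R]_m) : Prop :=
  forall w : 'rV[R]_m, w != 0 -> 0 < quadf A w.

(* Equality in R^m / Z^m. Points of the torus are represented by vectors,
   functions on it by functions respecting this relation. *)
Definition lattice_eq {m} (p q : 'rV[R]_m) : Prop :=
  forall i, p 0 i - q 0 i \is a Num.int.

Definition periodic {m} {T : Type} (f : 'rV[R]_m -> T) : Prop :=
  forall p q, lattice_eq p q -> f p = f q.

(* Iterated Lebesgue integral over [0,1]^m, a fundamental domain of Z^m. *)
Fixpoint torus_integral {m : nat} : ('rV[R]_m -> R) -> \bar R :=
  match m with
  | 0 => fun f => (f 0)%:E
  | k.+1 => fun f : 'rV[R]_(1 + k) -> R =>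
      (\int[lebesgue_measure]_(t in `[0%R, 1%R])
        torus_integral (fun y : 'rV[R]_k => f (row_mx (t%:M : 'M[R]_1) y)))%E
  end.

End Calculus.

(* A Riemannian metric on the torus R^m / Z^m is given by its (periodic)
   Gram matrix G in the coordinate frame. *)
Section Riemannian.
Context {R : realType} {m : nat}.
Implicit Types (G : 'rV[R]_m -> 'M[R]_m) (p w : 'rV[R]_m).

(* christoffel G p k i j is \Gamma^k_{ij}. *)
Definition christoffel G p (k i j : 'I_m) : R :=
  2^-1 * \sum_l invmx (G p) k l *
    (partial i (fun q => G q j l) p + partial j (fun q => G q i l) p
     - partial l (fun q => G q i j) p).

Definition geodesic G (gamma : R -> 'rV[R]_m) : Prop :=
  smooth_on setT gamma /\
  forall t k, derive1 (derive1 gamma) t 0 k =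
    - \sum_i \sum_j christoffel G (gamma t) k i j
                    * derive1 gamma t 0 i * derive1 gamma t 0 j.

(* Lift of the exponential map to R^m: the time-one value of the geodesic
   issuing from p with velocity w; metrics on the torus are complete, so this
   geodesic is defined on the whole real line. *)
Definition exp_map G p w : 'rV[R]_m :=
  get [set gamma | [/\ geodesic G gamma, gamma 0 = p & derive1 gamma 0 = w]] 1.

(* Composed with the projection R^m -> R^m / Z^m, h maps U diffeomorphically
   onto an open subset of the torus. V is the preimage of that subset in R^m
   and g the inverse diffeomorphism, pulled back to V. *)
Definition torus_diffeo_onto_image (U : set 'rV[R]_m)
    (h : 'rV[R]_m -> 'rV[R]_m) : Prop :=
  let V := [set q | exists2 w, U w & lattice_eq q (h w)] in
  [/\ open V, smooth_on U h &
      exists2 g : 'rV[R]_m -> 'rV[R]_m, smooth_on V g &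
        forall w q, U w -> lattice_eq q (h w) -> g q = w].

Definition tangent_ball G p (r : R) : set 'rV[R]_m :=
  [set w | quadf (G p) w < r ^+ 2].

Definition injectivity_radius G p : \bar R :=
  ereal_sup [set r%:E | r in
    [set r : R | 0 < r /\
       torus_diffeo_onto_image (tangent_ball G p r) (exp_map G p)]].

End Riemannian.

(* A point xi + i eta of X = C^n / (Z^n + i Z^n) is represented by the vector
   row_mx xi eta : 'rV_(n + n), up to lattice_eq. A T^n-invariant metric is
   given by its potential v, a function of xi only. *)
Section TorusKahler.
Context {R : realType} {n : nat}.
Implicit Types (phi v u : 'rV[R]_n -> R) (xi x : 'rV[R]_n).

Definition calH phi : Prop :=
  [/\ smooth_on setT phi, periodic phi &
      forall xi, posdefmx (hess (fun y => dotp y y / 2 + phi y) xi)].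

Definition scaled_calH (lambda : R) v : Prop :=
  exists2 phi, calH phi &
    v = (fun xi => lambda * (dotp xi xi / 2 + phi xi)).

Definition riem_metric v (p : 'rV[R]_(n + n)) : 'M[R]_(n + n) :=
  block_mx (hess v (lsubmx p)) 0 0 (hess v (lsubmx p)).

(* omega^n = n! det(v_ij) dxi_1 /\ deta_1 /\ ... /\ dxi_n /\ deta_n
   for omega = \sum v_ij dxi_i /\ deta_j. *)
Definition volume_density v (p : 'rV[R]_(n + n)) : R :=
  n`!%:R * \det (hess v (lsubmx p)).

(* The complex Hessian f_{i \bar j} of a function of xi = Re z alone:
   d/dz_i and d/d\bar z_j both act as (1/2) d/dxi. *)
Definition complex_hess (f : 'rV[R]_n -> R) xi : 'M[R]_n := 4^-1 *: hess f xi.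

Definition scalar_curvature v xi : R :=
  - \sum_i \sum_j invmx (complex_hess v xi) i j *
      complex_hess (fun y => ln (\det (complex_hess v y))) xi i j.

(* The average scalar curvature is 0 on X, so the flow reads dv/dt = S. *)
Definition calabi_flow (lambda a b : R) (v : R -> 'rV[R]_n -> R) : Prop :=
  [/\ smooth_on [set q : R * 'rV[R]_n | a <= q.1 <= b] (fun q => v q.1 q.2),
      forall t, a <= t <= b -> scaled_calH lambda (v t) &
      forall t xi, a <= t <= b ->
        derive1 (fun s => v s xi) t = scalar_curvature (v t) xi].

(* u(x) = x . xi - v(xi) for the xi (unique when v is strictly convex and
   grad v is onto, as for v in scaled_calH) with x = grad v (xi). *)
Definition legendre v x : R :=
  let xi := get [set xi | grad v xi = x] in dotp x xi - v xi.

(* inv_hess_deriv u i j k l x is u^{ij}_{kl}(x). *)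
Definition inv_hess_deriv u (i j k l : 'I_n) x : R :=
  partial k (partial l (fun y => invmx (hess u y) i j)) x.

Definition Rm_sqr u x : R :=
  \sum_i \sum_j \sum_k \sum_l
    inv_hess_deriv u i j k l x * inv_hess_deriv u k l i j x.

Definition Rm_norm v (p : 'rV[R]_(n + n)) : R :=
  Num.sqrt (Rm_sqr (legendre v) (grad v (lsubmx p))).

Definition cube (lambda : R) : set 'rV[R]_n :=
  [set x | forall i, - (lambda / 2) <= x 0 i <= lambda / 2].

Definition M_condition (M : R) (Q : set 'rV[R]_n) u : Prop :=
  forall p0 p3 : 'rV[R]_n, p0 != p3 ->
    (forall s : R, 0 <= s <= 1 -> Q (p0 + s *: (p3 - p0))) ->
    let p1 := p0 + 3^-1 *: (p3 - p0) in
    let p2 := p0 + (2 / 3) *: (p3 - p0) in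
    let nu := (enorm (p3 - p0))^-1 *: (p3 - p0) in
    `|'D_nu u p1 - 'D_nu u p2| < M.

End TorusKahler.

(* Main.v *)
(* Let [K] be the Hessian of the potential [v] of the final metric and [psi] the
   inverse of [grad v], so that [K (psi x)] is the inverse Hessian of the Legendre
   transform at [x]. In a frame orthonormal for [K], [|Rm| <= 1] and the
   Cauchy-Schwarz inequality bound the second derivative of [w K w^T] along the
   [x]-line of direction [nu] by [(w K w^T) (nu K^-1 nu^T)]. It follows that
   [q = (nu K^-1 nu^T)^-1] satisfies [q'' <= 1], so that [sqrt q] is Lipschitz.
   As [psi] shifts by a lattice vector along a line of length [lambda > 1], [q]
   is bounded from below for the coordinate directions, hence so is [K]. The same
   inequality and a Wronskian comparison bound the third, then the fourth,
   derivatives of [v] relatively to [K]. The metric thus has first and second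
   derivatives bounded relatively to itself; on a ball of uniform radius
   [exp w - w] is then a contraction of factor 1/2, so [exp] is an injective
   immersion, and the lower bound on [K] keeps its image inside a fundamental
   domain of the torus. *)

From HB Require Import structures.
From mathcomp Require Import all_boot all_order all_algebra.
From mathcomp Require Import all_classical all_reals all_analysis.
From mathcomp Require Import ring lra mxtens.
Require Import Defs.

Set Implicit Arguments.
Unset Strict Implicit.
Unset Printing Implicit Defensive.

Import Order.TTheory GRing.Theory Num.Theory.
Import numFieldNormedType.Exports.

Local Open Scope classical_set_scope.
Local Open Scope ring_scope.

(** * Differentiability *)

Section Differentiability.
Context {R : realType}.
Implicit Types V W : normedModType R.

(** The eigenvalues of [K] have no upper bound independent of [lambda], so an estimate in a fixed
    Euclidean norm would lose uniformity. Every derivative is therefore measured relatively to [K],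
    and geodesics are compared in the norm of the metric at the base point, with constants 3 for the
    first and 10 for the second derivatives of the metric. Along an [x]-line the right-hand side of
    the curvature inequality contains the unknown factor [nu K^-1 nu^T]. The inequality closes up
    because [q] is the minimum of [w K w^T] under [w . nu = 1]: for the minimising [w] the two
    factors are inverse to each other, which leaves the scalar inequality [q'' <= 1]. A lower bound
    on [q] near a point then makes the factor bounded on a definite interval, and a linear
    second-order inequality on that interval controls first derivatives. The exponential map of the
    statement is chosen among geodesics defined for all times and its inverse has to be smooth, so
    completeness of the geodesic flow, smooth dependence on initial data and the inverse function
    theorem are part of the proof. *)

Lemma differentiable_eps V W (f : V -> W) (L : {linear V -> W}) (x : V) :
  continuous L ->
  (forall e, 0 < e -> \forall h \near 0, `|f (h + x) - f x - L h| <= e * `|h|) ->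
  differentiable f x /\ 'd f x = L :> (V -> W).
Proof.
move=> cL H.
have E : f \o shift x = cst (f x) + L +o_ 0 id.
  apply/eqaddoP => e e0 /=.
  near=> h; rewrite /= /cst /=.
  rewrite -[X in `|X|]/(f (h + x) - (f x + L h)).
  rewrite opprD addrA.
  near: h; exact: H.
have dE := diff_unique cL E.
split=> //; apply/diff_locallyP; rewrite dE; split => //.
Unshelve. all: by end_near. Qed.

Lemma differentiable_epsE V W (f : V -> W) (x : V) : differentiable f x ->
  forall e, 0 < e -> \forall h \near 0, `|f (h + x) - f x - 'd f x h| <= e * `|h|.
Proof.
move=> /diff_locallyP[_ /eqaddoP H] e e0.
near=> h.
rewrite -addrA -opprD; near: h; exact: H.
Unshelve. all: by end_near. Qed.

Lemma near_eq_differentiable V W (f g : V -> W) (x : V) :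
  (\near x, f x = g x) -> differentiable f x -> differentiable g x.
Proof.
move=> fg df; have fgx := nbhs_singleton fg.
have [] // := @differentiable_eps V W g ('d f x) x (diff_continuous df).
move=> e e0; near=> h.
have -> : g (h + x) = f (h + x).
  apply/esym; near: h; have := fg; rewrite (near_shift 0 x (fun z => f z = g z)) /= subr0; exact.
rewrite -fgx; near: h; exact: differentiable_epsE.
Unshelve. all: by end_near. Qed.

Lemma is_derive_line V W (f : V -> W) (x v : V) (t : R) :
  derivable f (x + t *: v) v ->
  is_derive t 1 (fun s : R => f (x + s *: v)) ('D_v f (x + t *: v)).
Proof.
move=> df.
have E : (fun h : R => h^-1 *: (((fun s : R => f (x + s *: v)) \o shift t) (h *: 1) - f (x + t *: v)))
  = (fun h : R => h^-1 *: ((f \o shift (x + t *: v)) (h *: v) - f (x + t *: v))).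
  apply/funext => h /=; congr (_ *: (f _ - _)).
  by rewrite [h *: 1]mulr1 scalerDl addrCA.
split; first by rewrite /derivable E.
by rewrite /derive E.
Qed.

Lemma is_derive_comp1 V W (f : V -> W) (g : R -> V) (g' : V) (t : R) :
  differentiable f (g t) -> is_derive t 1 g g' ->
  is_derive t 1 (fun s => f (g s)) ('D_g' f (g t)).
Proof.
move=> df [dg <-].
have dg' : differentiable g t by apply/derivable1_diffP.
split.
  by apply/derivable1_diffP; apply: differentiable_comp.
rewrite !deriveE //; last exact: differentiable_comp.
by rewrite diff_comp.
Qed.

Lemma is_derive_comp V V' W (f : V' -> W) (g : V -> V') (x v : V) :
  differentiable f (g x) -> derivable g x v ->
  is_derive x v (fun s => f (g s)) ('D_('D_v g x) f (g x)).
Proof.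
move=> df dg.
have D : is_derive (0 : R) (1 : R) (fun h : R => g (x + h *: v)) ('D_v g x).
  have := @is_derive_line _ _ g x v 0.
  by rewrite scale0r addr0; apply.
have df' : differentiable f (g (x + 0 *: v)) by rewrite scale0r addr0.
have D2 := is_derive_comp1 df' D.
have E : (fun h : R => h^-1 *: (((fun s : R => f (g (x + s *: v))) \o shift (0 : R)) (h *: (1 : R)) - f (g (x + (0 : R) *: v))))
  = (fun h : R => h^-1 *: (((fun s => f (g s)) \o shift x) (h *: v) - f (g x))).
  apply/funext => h /=; rewrite scale0r addr0.
  by rewrite [h *: 1]mulr1 addr0 (addrC x).
case: D2 => D21 D22; split.
  by move: D21; rewrite /derivable E.
by move: D22; rewrite /derive E scale0r addr0.
Qed.

Lemma differentiable_mxP V m n (f : V -> 'M[R]_(m, n)) x :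
  differentiable f x <-> forall i j, differentiable (fun y => f y i j) x.
Proof.
split=> [df i j|df].
  by apply: (@differentiable_comp _ _ _ _ f (fun N : 'M[R]_(m, n) => N i j : R)) => //; exact: differentiable_coord.
rewrite (_ : f = \sum_(i < m) \sum_(j < n) (fun y => f y i j *: delta_mx i j)).
  apply: differentiable_sum => i; apply: differentiable_sum => j.
  exact: differentiableZl.
apply/funext => y; rewrite fct_sumE {1}(matrix_sum_delta (f y)).
by apply: eq_bigr => i _; rewrite fct_sumE.
Qed.

Lemma continuous_mxP V m n (f : V -> 'M[R]_(m, n)) x :
  {for x, continuous f} <-> forall i j, {for x, continuous (fun y => f y i j)}.
Proof.
split=> [cf i j|cf].
  exact: (@continuous_comp _ _ _ f (fun N : 'M[R]_(m, n) => N i j : R) x cf (@coord_continuous _ _ _ _ _ _)).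
rewrite (_ : f = \sum_(i < m) \sum_(j < n) (fun y => f y i j *: delta_mx i j)).
  elim/big_ind : _ => [||i _]; [exact: cst_continuous|by move=> *; exact: continuousD|].
  elim/big_ind : _ => [||j _]; [exact: cst_continuous|by move=> *; exact: continuousD|].
  by apply: continuousZl; exact: cf.
apply/funext => y; rewrite fct_sumE {1}(matrix_sum_delta (f y)).
by apply: eq_bigr => i _; rewrite fct_sumE.
Qed.

Lemma derive_sum_coord m W (f : 'rV[R]_m -> W) x v : differentiable f x ->
  'D_v f x = \sum_j v 0 j *: 'D_(delta_mx 0 j) f x.
Proof.
move=> df; rewrite deriveE // {1}(row_sum_delta v) linear_sum.
by apply: eq_bigr => j _; rewrite linearZ /= deriveE.
Qed.

End Differentiability.

(** * Smooth maps *)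

Section Smooth.
Context {R : realType}.
Implicit Types V W : normedModType R.

(* Unlike [Ck], [sm] asks for Frechet differentiability at every order, which
   makes it stable under composition by a direct induction. *)
Fixpoint sm {V W : normedModType R} (k : nat) (U : set V) (f : V -> W) : Prop :=
  if k is k'.+1 then
    (forall x, U x -> differentiable f x) /\ forall v, sm k' U ('D_v f)
  else forall x, U x -> {for x, continuous f}.

Lemma smS V W k (U : set V) (f : V -> W) : sm k.+1 U f <->
  (forall x, U x -> differentiable f x) /\ forall v, sm k U ('D_v f).
Proof. by []. Qed.

Definition smooth {V W : normedModType R} (U : set V) (f : V -> W) : Prop :=
  forall k, sm k U f.

Lemma sm_continuous V W k (U : set V) (f : V -> W) x :
  sm k U f -> U x -> {for x, continuous f}.
Proof.
case: k => [|k /= [d _] Ux]; first exact.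
exact/differentiable_continuous/d.
Qed.

Lemma sm_Ck V W k (U : set V) (f : V -> W) : sm k U f -> Ck k U f.
Proof.
elim: k f => [|k IH] f sf; first by [].
split; first by move=> x; exact: sm_continuous sf.
move/smS: sf => [d D] v; split; last exact: IH.
by move=> x Ux; exact/diff_derivable/d.
Qed.

Lemma sm_lower V W k (U : set V) (f : V -> W) : sm k.+1 U f -> sm k U f.
Proof.
elim: k f => [|k IH] f [d D]; first by move=> x Ux; exact/differentiable_continuous/d.
by split=> // v; apply/IH/D.
Qed.

Lemma sm_sub V W k (U U' : set V) (f : V -> W) : U' `<=` U -> sm k U f -> sm k U' f.
Proof.
move=> UU'; elim: k f => [|k IH] f /=; first by move=> H x /UU'/H.
by move=> [d D]; split=> [x /UU'/d//|v]; exact/IH/D.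
Qed.

(** [sm] is a condition at each point of the set, with derivatives taken in the ambient space; this
    is why the sets [B] need not be open. *)
Lemma sm_local V W k (U : set V) (f : V -> W) :
  (forall x, U x -> exists2 B : set V, B x & sm k B f) -> sm k U f.
Proof.
elim: k f => [|k IH] f H /=; first by move=> x /H [B Bx cO]; exact: cO.
split=> [x /H [B Bx [d _]]|v]; first exact: d.
by apply: IH => x /H [B Bx /smS[_ D]]; exists B.
Qed.

Lemma sm_ext V W k (U : set V) (f g : V -> W) : open U ->
  (forall x, U x -> f x = g x) -> sm k U f -> sm k U g.
Proof.
move=> oU; elim: k f g => [|k IH] f g fg.
  move=> cf x Ux; rewrite /prop_for /continuous_at -(fg x Ux).
  apply: cvg_trans (cf x Ux); apply: near_eq_cvg.
  by near do (apply: fg); exact: open_nbhs_nbhs.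
have nfg x : U x -> \near x, f x = g x.
  by move=> Ux; near do (apply: fg); exact: open_nbhs_nbhs.
move=> [d D]; split=> [x Ux|v].
  exact: near_eq_differentiable (nfg x Ux) (d x Ux).
apply: IH (D v) => x Ux; exact: near_eq_derive (nfg x Ux).
Unshelve. all: by end_near. Qed.

Lemma sm_eq V W k (U : set V) (f g : V -> W) : f =1 g -> sm k U f -> sm k U g.
Proof. by move=> /funext ->. Qed.

Lemma sm_cst V W k (U : set V) (a : W) : sm k U (fun=> a : W).
Proof.
elim: k a => [|k IH] a /=; first by move=> x _; exact: cst_continuous.
split=> [x _|v]; first exact: differentiable_cst.
by apply: sm_eq (IH 0) => x; rewrite derive_cst.
Qed.

Section Closure.
Variables (V : normedModType R) (U : set V).
Hypothesis oU : open U.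

Lemma smD W k (f g : V -> W) : sm k U f -> sm k U g -> sm k U (fun x => f x + g x).
Proof.
elim: k f g => [|k IH] f g.
  by move=> cf cg x Ux; apply: continuousD; [exact: cf|exact: cg].
move=> /smS/smS[df Df] /smS[dg Dg]; split=> [x Ux|v].
  by apply: differentiableD; [exact: df|exact: dg].
apply: sm_ext (IH _ _ (Df v) (Dg v)) => // x Ux.
by rewrite deriveD //; apply: diff_derivable; [exact: df|exact: dg].
Qed.

Lemma smN W k (f : V -> W) : sm k U f -> sm k U (fun x => - f x).
Proof.
elim: k f => [|k IH] f; first by move=> cf x Ux; exact/continuousN/cf.
move=> /smS[df Df]; split=> [x Ux|v]; first exact/differentiableN/df.
apply: sm_ext (IH _ (Df v)) => // x Ux.
by rewrite deriveN //; apply: diff_derivable; exact: df.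
Qed.

Lemma smB W k (f g : V -> W) : sm k U f -> sm k U g -> sm k U (fun x => f x - g x).
Proof. by move=> sf sg; apply: smD => //; exact: smN. Qed.

Lemma smM k (f g : V -> R) : sm k U f -> sm k U g -> sm k U (fun x => f x * g x).
Proof.
elim: k f g => [|k IH] f g.
  by move=> cf cg x Ux; apply: continuousM; [exact: cf|exact: cg].
move=> sf sg; have [df Df] := (smS _ _ _).1 sf; have [dg Dg] := (smS _ _ _).1 sg; split=> [x Ux|v].
  by apply: differentiableM; [exact: df|exact: dg].
have S := smD (IH _ _ (sm_lower sf) (Dg v)) (IH _ _ (sm_lower sg) (Df v)).
apply: sm_ext S => // x Ux.
by rewrite deriveM //; apply: diff_derivable; [exact: df|exact: dg].
Qed.

Lemma sm_sum W k (I : Type) (r : seq I) (P : pred I) (F : I -> V -> W) :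
  (forall i, P i -> sm k U (F i)) -> sm k U (fun x => \sum_(i <- r | P i) F i x).
Proof.
move=> H; elim: r => [|i r IH].
  by apply: sm_eq (sm_cst k U 0) => x; rewrite big_nil.
case: (boolP (P i)) => Pi.
  apply: sm_eq (smD (H i Pi) IH) => x; by rewrite big_cons Pi.
by apply: sm_eq IH => x; rewrite big_cons (negbTE Pi).
Qed.

Lemma sm_prod k (I : Type) (r : seq I) (P : pred I) (F : I -> V -> R) :
  (forall i, P i -> sm k U (F i)) -> sm k U (fun x => \prod_(i <- r | P i) F i x).
Proof.
move=> H; elim: r => [|i r IH].
  by apply: sm_eq (sm_cst k U (1 : R)) => x; rewrite big_nil.
case: (boolP (P i)) => Pi.
  apply: sm_eq (smM (H i Pi) IH) => x; by rewrite big_cons Pi.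
by apply: sm_eq IH => x; rewrite big_cons (negbTE Pi).
Qed.

Lemma smV k (f : V -> R) : (forall x, U x -> f x != 0) -> sm k U f ->
  sm k U (fun x => (f x)^-1).
Proof.
move=> f0; elim: k => [|k IH] sf.
  by move=> x Ux; apply: continuousV; [exact: f0|exact: sf].
have [df Df] := (smS _ _ _).1 sf; split=> [x Ux|v].
  by apply: differentiableV; [exact: df|exact: f0].
have Si := IH (sm_lower sf).
have S := smN (smM (smM Si Si) (Df v)).
apply: sm_ext S => // x Ux.
rewrite deriveV ?f0//; last by apply: diff_derivable; exact: df.
by rewrite [RHS]/GRing.scale /= mulNr -exprVn expr2.
Qed.

Lemma sm_mxP k m n (f : V -> 'M[R]_(m, n)) :
  sm k U f <-> forall i j, sm k U (fun x => f x i j).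
Proof.
split.
  elim: k f => [|k IH] f.
    by move=> cf i j x /cf /continuous_mxP; exact.
  move=> /smS[df Df] i j; split=> [x /df /differentiable_mxP|v]; first exact.
  apply: sm_ext (IH _ (Df v) i j) => // x Ux.
  by rewrite derive_mx ?mxE//; apply/diff_derivable/df.
elim: k f => [|k IH] f H.
  by move=> x Ux; apply/continuous_mxP => i j; exact: H.
have df x : U x -> differentiable f x.
  by move=> Ux; apply/differentiable_mxP => i j; case: (H i j) => d _; exact: d.
split=> // v; apply: IH => i j; have [d D] := (smS _ _ _).1 (H i j).
apply: sm_ext (D v) => // x Ux.
by rewrite derive_mx ?mxE//; apply/diff_derivable/df.
Qed.

(** With a finite-dimensional middle space the chain rule is a finite sum of products of scalar
    functions, so that the induction hypothesis and [smM] apply to the derivative. *)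
Lemma sm_comp k m (U' : set 'rV[R]_m) (f : 'rV[R]_m -> R) (g : V -> 'rV[R]_m) :
  open U' -> (forall x, U x -> U' (g x)) ->
  sm k U' f -> sm k U g -> sm k U (fun x => f (g x)).
Proof.
move=> oU' gU; elim: k f => [|k IH] f.
  by move=> cf cg x Ux; apply: continuous_comp; [exact: cg|exact/cf/gU].
move=> /smS[df Df] sg; have [dg Dg] := (smS _ _ _).1 sg; split=> [x Ux|v].
  by apply: differentiable_comp; [exact: dg|exact/df/gU].
have S : sm k U (fun x => \sum_(j < m) ('D_v g x) 0 j * 'D_(delta_mx 0 j) f (g x)).
  apply: sm_sum => // j _; apply: smM => //.
      have S0 := (@sm_mxP k _ _ ('D_v g)).1 (Dg v) 0 j; exact S0.
  exact: (IH _ (Df _) (sm_lower sg)).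
apply: sm_ext S => // x Ux.
have [_ ->] := is_derive_comp (df _ (gU _ Ux)) (@diff_derivable _ _ _ g x v (dg x Ux)).
by rewrite derive_sum_coord //; exact/df/gU.
Qed.

Lemma sm_det k n (A : V -> 'M[R]_n) : (forall i j, sm k U (fun x => A x i j)) ->
  sm k U (fun x => \det (A x)).
Proof.
move=> H; apply: sm_sum => s _; apply: smM; first exact: sm_cst.
by apply: sm_prod => i _; exact: H.
Qed.

Lemma sm_invmx k n (A : V -> 'M[R]_n) : (forall i j, sm k U (fun x => A x i j)) ->
  (forall x, U x -> A x \in unitmx) ->
  forall i j, sm k U (fun x => invmx (A x) i j).
Proof.
move=> H uA i j.
have S : sm k U (fun x => (\det (A x))^-1 * ((-1) ^+ (j + i) * \det (row' j (col' i (A x))))).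
  apply: smM; first apply: smV.
  - by move=> x /uA; rewrite unitmxE unitfE.
  - exact: sm_det.
  apply: smM; first exact: sm_cst.
  apply: sm_det => a b; apply: sm_eq (H (lift j a) (lift i b)) => x.
  by rewrite !mxE.
apply: sm_ext S => // x Ux.
by rewrite /invmx uA // !mxE.
Qed.

End Closure.

Lemma sm_coord k m n (U : set 'M[R]_(m, n)) i j : sm k U (fun x => x i j).
Proof.
case: k => [|k]; first by move=> x _; exact: coord_continuous.
split=> [x _|v]; first exact: differentiable_coord.
apply: sm_eq (sm_cst k U (v i j)) => x.
have d : derivable (fun x : 'M[R]_(m, n) => x) x v by exact: derivable_id.
by have := derive_id x v; rewrite (derive_mx d) => /matrixP/(_ i j); rewrite mxE.
Qed.

End Smooth.

(** * Mean value inequalities *)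

Section MeanValue.
Context {R : realType}.

Lemma is_derive_continuous (V : normedModType R) (f : R -> V) t df :
  is_derive t (1 : R) f df -> {for t, continuous f}.
Proof. by move=> [d _]; apply/differentiable_continuous/derivable1_diffP. Qed.

Lemma continuous_within_itv (f : R -> R) (a b : R) :
  (forall t, a <= t <= b -> {for t, continuous f}) -> {within `[a, b], continuous f}.
Proof.
move=> cf; apply/continuous_in_subspaceT => x; rewrite inE /= in_itv /=; exact: cf.
Qed.

Lemma MVT01 (f df : R -> R) (a b : R) : a <= b ->
  (forall t, a <= t <= b -> is_derive t (1 : R) f (df t)) ->
  exists2 c, a <= c <= b & f b - f a = df c * (b - a).
Proof.
move=> ab H; have [||c] := @MVT_segment _ f df a b ab.
- by move=> x; rewrite in_itv /= => /andP[/ltW ax /ltW xb]; apply: H; rewrite ax.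
- by apply: continuous_within_itv => t /H; exact: is_derive_continuous.
- by rewrite in_itv /=; exists c.
Qed.

Lemma MVTsym (f df : R -> R) (s : R) :
  (forall t, `|t| <= `|s| -> is_derive t (1 : R) f (df t)) ->
  exists2 c, `|c| <= `|s| & f s - f 0 = df c * s.
Proof.
move=> H; case: (leP 0 s) => s0.
  have [|c /andP[c0 cs] E] := @MVT01 f df 0 s s0.
    by move=> t /andP[t0 ts]; apply: H; rewrite !ger0_norm.
  by exists c; rewrite ?E ?subr0// !ger0_norm.
have [|c /andP[c0 cs] E] := @MVT01 f df s 0 (ltW s0).
  by move=> t /andP[t0 ts]; apply: H; rewrite ler0_norm // ltr0_norm // lerN2.
exists c; first by rewrite ler0_norm // ltr0_norm // lerN2.
by rewrite -opprB E sub0r mulrN opprK.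
Qed.

Lemma ge0_derive_le (f df : R -> R) (a b : R) : a <= b ->
  (forall t, a <= t <= b -> is_derive t (1 : R) f (df t)) ->
  (forall t, a <= t <= b -> 0 <= df t) -> f a <= f b.
Proof.
move=> ab H H0; have [c cab E] := MVT01 ab H.
by rewrite -subr_ge0 E mulr_ge0 ?H0 // subr_ge0.
Qed.

Lemma le0_derive_ge (f df : R -> R) (a b : R) : a <= b ->
  (forall t, a <= t <= b -> is_derive t (1 : R) f (df t)) ->
  (forall t, a <= t <= b -> df t <= 0) -> f b <= f a.
Proof.
move=> ab H H0; have [c cab E] := MVT01 ab H.
by rewrite -subr_le0 E mulr_le0_ge0 ?H0 // subr_ge0.
Qed.

Lemma derive0_eq (f : R -> R) (a b : R) : a <= b ->
  (forall t, a <= t <= b -> is_derive t (1 : R) f 0) -> f b = f a.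
Proof.
move=> ab H; have [c cab E] := @MVT01 f (fun=> 0) a b ab H.
by apply/eqP; rewrite -subr_eq0 E mul0r.
Qed.

End MeanValue.

(** * Differentiability from continuous partial derivatives *)

Section C1Differentiable.
Context {R : realType} {m : nat}.
Implicit Types f : 'rV[R]_m -> R.

Lemma norm_coord_le (x : 'rV[R]_m) j : `|x 0 j| <= `|x|.
Proof.
by rewrite [leRHS]/Num.Def.normr /= mx_normrE; apply: (le_bigmax _ (fun ij : 'I_1 * 'I_m => `|x ij.1 ij.2|) (0, j)).
Qed.

Lemma norm_rV_le (x : 'rV[R]_m) (e : R) : 0 <= e -> (forall j, `|x 0 j| <= e) -> `|x| <= e.
Proof.
move=> e0 H; rewrite [leLHS]/Num.Def.normr /= mx_normrE; apply: bigmax_le => // -[i j] _.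
by rewrite (ord1 i) /=.
Qed.

Lemma C1_differentiable f (U : set 'rV[R]_m) (x : 'rV[R]_m) : open U -> U x ->
  (forall y j, U y -> derivable f y (delta_mx 0 j)) ->
  (forall j, {for x, continuous ('D_(delta_mx 0 j) f)}) ->
  differentiable f x.
Proof.
move=> oU Ux df cf.
pose L (h : 'rV[R]_m) := \sum_j h 0 j * 'D_(delta_mx 0 j) f x.
have linL : linear L.
  move=> a u v; rewrite /L scaler_sumr -big_split /=; apply: eq_bigr => j _.
  by rewrite !mxE mulrDl -mulrA.
pose LM := GRing.isLinear.Build _ _ _ _ _ linL.
pose LL : {linear 'rV[R]_m -> R} := HB.pack L LM.
have cL : continuous LL.
  suff H : sm 0 setT L by move=> y; exact: (H y).
  apply: sm_sum => [|j _]; first exact: openT.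
  by apply: smM; [exact: openT|exact: sm_coord|exact: sm_cst].
suff [] : differentiable f x /\ 'd f x = LL :> ('rV[R]_m -> R) by [].
apply: (differentiable_eps cL) => e e0.
have [e' e'0 e'e] : exists2 e' : R, 0 < e' & m%:R * e' <= e.
  exists (e / (m.+1)%:R); first by rewrite divr_gt0.
  by rewrite mulrCA ler_piMr ?(ltW e0)// ler_pdivrMr ?ltr0n// mul1r ler_nat.
have [d d0 Hd] : exists2 d : R, 0 < d & forall y, `|y - x| < d ->
    U y /\ forall j, `|'D_(delta_mx 0 j) f y - 'D_(delta_mx 0 j) f x| <= e'.
  have : \forall y \near x, U y /\ forall j, `|'D_(delta_mx 0 j) f y - 'D_(delta_mx 0 j) f x| <= e'.
    near=> y; split; first by near: y; exact: open_nbhs_nbhs.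
    move=> j; rewrite distrC; move: j; near: y; apply: filter_forall => j.
    have /cvgrPdist_le := cf j; exact.
  move=> /nbhs_ballP[d /= d0 Hd]; exists d => // y yd; apply: Hd.
  by rewrite -ball_normE /= distrC.
near=> h.
have hd : `|h| < d.
  by near: h; apply/nbhs_ballP; exists d => // z; rewrite -ball_normE /= sub0r normrN.
(* Induction on the number [k] of leading coordinates of the increment that may be non-zero; [g1]
   below is [g] with the last of them erased. *)
suff H k : (k <= m)%N -> forall h : 'rV[R]_m, `|h| < d -> (forall j : 'I_m, (k <= j)%N -> h 0 j = 0) ->
    `|f (h + x) - f x - L h| <= k%:R * e' * `|h|.
  apply: (le_trans (H m (leqnn m) h hd _)); first by move=> j; rewrite leqNgt ltn_ord.
  by rewrite ler_wpM2r.
elim: k => [_|k IH km] {hd} g gd g0.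
  have -> : g = 0 by apply/rowP => j; rewrite g0 ?mxE.
  by rewrite add0r subrr [L _](_ : _ = 0) ?subr0 ?normr0 ?mulr0 // /L big1 // => j _; rewrite mxE mul0r.
pose K := Ordinal km.
pose g1 : 'rV[R]_m := \row_j (if j == K then 0 else g 0 j).
have hE s : g1 + s *: delta_mx 0 K = \row_j (if j == K then s else g 0 j).
  by apply/rowP => j; rewrite !mxE eqxx /=; case: eqP => _ /=; rewrite ?mulr1 ?mulr0 ?add0r ?addr0.
have nh s : `|s| <= `|g| -> `|g1 + s *: delta_mx 0 K| <= `|g|.
  move=> sh; rewrite hE; apply: norm_rV_le => // j; rewrite mxE; case: eqP => // _; exact: norm_coord_le.
have nh' : `|g1| <= `|g| by have := nh 0; rewrite normr0 scale0r addr0; exact.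
have hh : g1 + g 0 K *: delta_mx 0 K = g.
  by rewrite hE; apply/rowP => j; rewrite mxE; case: eqP => // ->.
have IH' := IH (ltnW km) g1 (le_lt_trans nh' gd) _.
have {}IH' : `|f (g1 + x) - f x - L g1| <= k%:R * e' * `|g|.
  apply: le_trans (IH' _) _; last by rewrite ler_wpM2l // mulr_ge0 // ltW.
  move=> j kj; rewrite mxE; case: eqP => // /eqP jK; apply: g0.
  by rewrite ltn_neqAle kj andbT; apply: contra jK => /eqP E; apply/eqP/val_inj.
have [c ch E] : exists2 c, `|c| <= `|g 0 K| & f (g + x) - f (g1 + x) =
    'D_(delta_mx 0 K) f (g1 + x + c *: delta_mx 0 K) * g 0 K.
  have [|c cK] := @MVTsym R (fun s => f (g1 + x + s *: delta_mx 0 K))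
     (fun s => 'D_(delta_mx 0 K) f (g1 + x + s *: delta_mx 0 K)) (g 0 K).
    move=> t tK; apply: is_derive_line; apply: df.
    apply: (Hd _ _).1; rewrite addrAC addrK.
    by apply: le_lt_trans gd; apply: nh; apply: le_trans tK _; exact: norm_coord_le.
  by rewrite scale0r addr0 addrAC hh => E; exists c.
have LE : L g = L g1 + g 0 K * 'D_(delta_mx 0 K) f x.
  rewrite -{1}hh (addrC g1) linL addrC; congr (_ + _); congr (_ * _).
  rewrite /L (bigD1 K) //= mxE !eqxx mul1r big1 ?addr0 // => j jK.
  by rewrite mxE eqxx /= (negbTE jK) mul0r.
have -> : f (g + x) - f x - L g = (f (g1 + x) - f x - L g1) +
   ('D_(delta_mx 0 K) f (g1 + x + c *: delta_mx 0 K) - 'D_(delta_mx 0 K) f x) * g 0 K.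
  by rewrite mulrBl -E LE; ring.
apply: le_trans (ler_normD _ _) _.
have Ek : k.+1%:R = k%:R + 1 :> R by rewrite natr1.
rewrite Ek (mulrDl k%:R) mul1r (mulrDl (k%:R * e')) lerD // normrM.
apply: ler_pM => //; last exact: norm_coord_le.
apply: (Hd _ _).2; rewrite addrAC addrK.
by apply: le_lt_trans gd; apply: nh; apply: le_trans ch _; exact: norm_coord_le.
Unshelve. all: by end_near. Qed.

(** One order is lost because differentiability at order [k] is deduced from the continuity of the
    derivatives of the next order. *)
Lemma Ck_sm k (U : set 'rV[R]_m) f : open U -> Ck k.+1 U f -> sm k U f.
Proof.
move=> oU; elim: k f => [|k IH] f; first by move=> [].
move=> [_ H]; split=> [x Ux|v]; last by apply: IH; case: (H v).
apply: (C1_differentiable oU Ux) => [y j Uy|j].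
  by have [d _] := H (delta_mx 0 j); exact: d.
by have [_ [c _]] := H (delta_mx 0 j); exact: c.
Qed.

End C1Differentiable.

(** * Symmetry of second derivatives *)

Section Schwarz.
Context {R : realType} {V : normedModType R}.
Implicit Types (f : V -> R) (U : set V).

(** The mean value theorem is used in direction [u] on the difference in [v], then in direction [v];
    both intermediate points lie within [|t| * N] of [x]. *)
Let second_difference f U x u v e : open U -> U x -> sm 2 U f -> 0 < e ->
  exists2 d : R, 0 < d & forall t : R, `|t| < d ->
   exists2 w : R, `|w - 'D_v ('D_u f) x| <= e &
     f (x + t *: u + t *: v) - f (x + t *: u) - f (x + t *: v) + f x = w * t * t.
Proof.
move=> oU Ux /smS[df Df] e0; have [Ddf cDf] := (smS _ _ _).1 (Df u).
have cD : {for x, continuous ('D_v ('D_u f))} by exact: cDf.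
have : \forall y \near x, U y /\ `|'D_v ('D_u f) y - 'D_v ('D_u f) x| <= e.
  near=> y; split; first by near: y; exact: open_nbhs_nbhs.
  by rewrite distrC; near: y; have /cvgrPdist_le := cD; exact.
move=> /nbhs_ballP[d /= d0 Hd].
pose N := `|u| + `|v| + 1.
have N0 : 0 < N by rewrite /N ltr_wpDl // addr_ge0.
exists (d / N); first by rewrite divr_gt0.
move=> t td.
have Ht a b : `|a| <= `|t| -> `|b| <= `|t| ->
   U (x + a *: u + b *: v) /\ `|'D_v ('D_u f) (x + a *: u + b *: v) - 'D_v ('D_u f) x| <= e.
  move=> at' bt; apply: Hd; rewrite -ball_normE /= -addrA opprD addrA subrr sub0r normrN.
  apply: le_lt_trans (ler_normD _ _) _; rewrite !normrZ.
  apply: (@le_lt_trans _ _ (`|t| * (`|u| + `|v|))).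
    by rewrite mulrDr lerD // ler_wpM2r.
  apply: le_lt_trans (_ : `|t| * N < d); last by rewrite -ltr_pdivlMr.
  by rewrite ler_wpM2l // /N lerDl.
have H0 : `|0 : R| <= `|t| by rewrite normr0.
have [|s st E1] := @MVTsym R (fun s => f (x + s *: u + t *: v) - f (x + s *: u))
   (fun s => 'D_u f (x + s *: u + t *: v) - 'D_u f (x + s *: u)) t.
  move=> s st; have [U1 _] := Ht s t st (lexx _); have [] := Ht s 0 st H0; rewrite scale0r addr0 => U2 _.
  apply: is_deriveB; last by apply: is_derive_line; apply/diff_derivable/df.
  have := @is_derive_line R V _ f (x + t *: v) u s.
  rewrite (_ : (fun s0 => _) = (fun s0 => f (x + s0 *: u + t *: v))); last by apply/funext => z; rewrite addrAC.
  rewrite addrAC; apply; exact/diff_derivable/df.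
have [|r rt E2] := @MVTsym R (fun r => 'D_u f (x + s *: u + r *: v))
    (fun r => 'D_v ('D_u f) (x + s *: u + r *: v)) t.
  move=> r rt; apply: is_derive_line; apply/diff_derivable/Ddf; exact: (Ht s r st rt).1.
exists ('D_v ('D_u f) (x + s *: u + r *: v)); first exact: (Ht s r st rt).2.
rewrite -E2 scale0r addr0 -E1 !scale0r !addr0; ring.
Unshelve. all: by end_near. Qed.

(** The second difference is symmetric in [u] and [v], so its quotient by [t ^+ 2] approximates both
    mixed derivatives. *)
Lemma schwarz f U x u v : open U -> U x -> sm 2 U f -> 'D_v ('D_u f) x = 'D_u ('D_v f) x.
Proof.
move=> oU Ux sf; apply/eqP; rewrite -subr_eq0 -normr_le0; apply/ler_addgt0Pl => e e0.
have e20 : 0 < e / 2 by rewrite divr_gt0.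
have [d1 d10 H1] := second_difference u v oU Ux sf e20.
have [d2 d20 H2] := second_difference v u oU Ux sf e20.
pose t := Num.min d1 d2 / 2.
have m1 : Num.min d1 d2 <= d1 by rewrite ge_min lexx.
have m2 : Num.min d1 d2 <= d2 by rewrite ge_min lexx orbT.
have m0 : 0 < Num.min d1 d2 by rewrite lt_min d10.
have t0 : 0 < t by rewrite /t divr_gt0.
have tm : `|t| < Num.min d1 d2 by rewrite gtr0_norm // /t ltr_pdivrMr // ltr_pMr // ltr1n.
have [w1 W1 E1] := H1 t (lt_le_trans tm (m1 : _ <= d1)).
have [w2 W2 E2] := H2 t (lt_le_trans tm (m2 : _ <= d2)).
have ww : w1 = w2.
  have : w1 * t * t = w2 * t * t by rewrite -E1 -E2 (addrAC x (t *: v)); ring.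
  by move/(mulIf (lt0r_neq0 t0))/(mulIf (lt0r_neq0 t0)).
move: ('D_v ('D_u f) x) ('D_u ('D_v f) x) W1 W2 => a b W1 W2.
have -> : a - b = (w2 - b) - (w1 - a) by rewrite ww; ring.
rewrite addr0 (splitr e).
by apply: le_trans (ler_normB _ _) _; rewrite lerD.
Qed.

End Schwarz.

(** * Ordinary differential equations *)

Section Antiderivative.
Context {R : realType}.
Local Notation mu := (@lebesgue_measure R).

(** The integral starts at [- a] rather than 0, so that one formula is differentiable on both sides
    of 0; subtracting [I 0] restores the normalisation. *)
Let antideriv_ball (f : R -> R) (a : R) : continuous f -> 0 < a ->
  exists2 F : R -> R, F 0 = 0 & forall t, `|t| < a -> is_derive t (1 : R) F (f t).
Proof.
move=> cf a0; pose I x := \int[mu]_(t in `[-a, x]) f t.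
exists (fun x => I x - I 0); first by rewrite subrr.
move=> t ta.
have [dI DI] : derivable I t 1 /\ derive1 I t = f t.
  apply: (@continuous_FTC1_closed _ f (- a) t a).
  - by apply: le_lt_trans ta; exact: ler_norm.
  - apply: continuous_compact_integrable; first exact: segment_compact.
    exact: continuous_subspaceT.
  - by move: ta; rewrite ltr_norml => /andP[].
  - exact: cf.
have H : is_derive t (1 : R) I (f t) := DeriveDef dI (etrans (esym (derive1E I t)) DI).
have := is_deriveB H (is_derive_cst (I 0) t (1 : R)).
by rewrite subr0.
Qed.

Lemma is_derive_ball_eq (f g df : R -> R) (a : R) :
  (forall t, `|t| <= `|a| -> is_derive t (1 : R) f (df t)) ->
  (forall t, `|t| <= `|a| -> is_derive t (1 : R) g (df t)) -> f 0 = g 0 -> f a = g a.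
Proof.
move=> Hf Hg fg0.
have [|c _] := @MVTsym R (fun t => f t - g t) (fun=> 0) a.
  by move=> t ta; have := is_deriveB (Hf t ta) (Hg t ta); rewrite subrr.
by rewrite mul0r fg0 subrr subr0 => /eqP; rewrite subr_eq0 => /eqP.
Qed.

(** Antiderivatives on balls that vanish at 0 agree on their common domain; at [t] the one of radius
    [|t| + 1] is used, which leaves room around [t]. *)
Lemma antiderivative (f : R -> R) : continuous f ->
  exists2 F : R -> R, F 0 = 0 & forall t, is_derive t (1 : R) F (f t).
Proof.
move=> cf.
have B (a : R) : exists F : R -> R, 0 < a ->
    F 0 = 0 /\ forall t, `|t| < a -> is_derive t (1 : R) F (f t).
  case: (ltP 0 a) => a0; last by exists (fun=> 0).
  by have [F F0 HF] := antideriv_ball cf a0; exists F.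
have [G HG] := choice B.
pose F t := G (`|t| + 1) t.
have p1 (t : R) : 0 < `|t| + 1 by rewrite ltr_wpDl.
have FE t a : `|t| < a -> F t = G a t.
  move=> ta; have a0 : 0 < a by exact: le_lt_trans ta.
  rewrite /F; apply: (@is_derive_ball_eq (G (`|t| + 1)) (G a) f t) => [s st|s st|].
  - by apply: (HG _ (p1 t)).2; apply: le_lt_trans st _; rewrite ltrDl.
  - by apply: (HG _ a0).2; apply: le_lt_trans st _.
  - by rewrite (HG _ (p1 t)).1 (HG _ a0).1.
exists F => [|t]; first by rewrite (FE 0 1) ?normr0 // (HG 1 ltr01).1.
have a0 : 0 < `|t| + 1 by [].
apply: (@near_eq_is_derive _ _ _ (G (`|t| + 1))); last first.
  by apply: (HG _ a0).2; rewrite ltrDl.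
near=> s; apply/esym/FE; near: s.
apply/nbhs_ballP; exists 1 => //= s; rewrite -ball_normE /= => ts.
rewrite -(subrK t s); apply: le_lt_trans (ler_normD _ _) _.
by rewrite addrC ltrD2l distrC.
Unshelve. all: by end_near. Qed.

Lemma is_derive_mxP m n (x : R -> 'M[R]_(m, n)) (t : R) v :
  is_derive t (1 : R) x v <-> forall i j, is_derive t (1 : R) (fun s => x s i j) (v i j).
Proof.
split=> [[d E] i j|H].
  split; first by move/derivable_mxP: d.
  by rewrite -E (derive_mx d) mxE.
have d : derivable x t 1 by apply/derivable_mxP => i j; case: (H i j).
split=> //; rewrite (derive_mx d); apply/matrixP => i j; rewrite mxE.
by case: (H i j).
Qed.

Lemma antiderivative_rV N (f : R -> 'rV[R]_N) : continuous f ->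
  exists2 F : R -> 'rV[R]_N, F 0 = 0 & forall t, is_derive t (1 : R) F (f t).
Proof.
move=> cf.
have B (j : 'I_N) : exists F : R -> R, F 0 = 0 /\ forall t, is_derive t (1 : R) F (f t 0 j).
  have [|F F0 HF] := @antiderivative (fun t => f t 0 j); last by exists F.
  by move=> t; have /continuous_mxP := cf t; exact.
have [G HG] := choice B.
exists (fun t => \row_j G j t); first by apply/rowP => j; rewrite !mxE (HG j).1.
move=> t; apply/is_derive_mxP => i j; rewrite (ord1 i).
rewrite (_ : (fun s => _) = G j); last by apply/funext => s; rewrite mxE.
exact: (HG j).2.
Qed.

Lemma is_derive_opp_arg (V : normedModType R) (f : R -> V) (t : R) (v : V) :
  is_derive (- t) (1 : R) f v -> is_derive t (1 : R) (fun s => f (- s)) (- v).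
Proof.
move=> H; have dN : is_derive t (1 : R) (fun s : R => - s) (- 1).
  by apply: is_deriveN.
have df : differentiable f (- t) by apply/derivable1_diffP; case: H.
have := is_derive_comp1 df dN.
rewrite deriveE // linearN /= -deriveE //; by case: H => _ ->.
Qed.

(** The library norm on row vectors is the sup norm, so a scalar comparison for each coordinate is
    enough; negative times are reduced to positive ones by reflection. *)
Lemma norm_le_growth N (y y' : R -> 'rV[R]_N) (g g' : R -> R) :
  y 0 = 0 -> (forall t, is_derive t (1 : R) y (y' t)) ->
  (forall t, is_derive t (1 : R) g (g' t)) ->
  (forall t, `|y' t| <= g' `|t|) -> forall t, `|y t| <= g `|t| - g 0.
Proof.
move=> y0 dy dg H.
have g'0 t : 0 <= t -> 0 <= g' t.
  by move=> t0; have := H t; rewrite (ger0_norm t0); apply: le_trans.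
have pos t (z z' : R -> R) : 0 <= t -> z 0 = 0 -> (forall s, is_derive s (1 : R) z (z' s)) ->
   (forall s, 0 <= s -> z' s <= g' s) -> z t <= g t - g 0.
  move=> t0 z0 dz Hz.
  have := @ge0_derive_le R (fun s => g s - z s) (fun s => g' s - z' s) 0 t t0.
  rewrite z0 subr0 lerBrDl -lerBrDr => -> //.
  by move=> s /andP[s0 _]; rewrite subr_ge0 Hz.
have pos' t (z z' : R -> R) : 0 <= t -> z 0 = 0 -> (forall s, is_derive s (1 : R) z (z' s)) ->
   (forall s, 0 <= s -> `|z' s| <= g' s) -> `|z t| <= g t - g 0.
  move=> t0 z0 dz Hz; rewrite ler_norml; apply/andP; split.
    rewrite lerNl; apply: (pos t (fun s => - z s) (fun s => - z' s)) => //.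
    - by rewrite z0 oppr0.
    - by move=> s s0; apply: le_trans (Hz s s0); rewrite -normrN ler_norm.
  by apply: (pos t z z') => // s s0; apply: le_trans (Hz s s0); rewrite ler_norm.
move=> t; apply: norm_rV_le => [|j].
  rewrite subr_ge0; apply: (@ge0_derive_le R g g') => //.
  by move=> s /andP[s0 _]; exact: g'0.
have dyj s : is_derive s (1 : R) (fun s => y s 0 j) (y' s 0 j).
  by have /is_derive_mxP := dy s; exact.
case: (leP 0 t) => t0.
  rewrite (ger0_norm t0); apply: (pos' t (fun s => y s 0 j) (fun s => y' s 0 j)) => //; first by rewrite y0 mxE.
  by move=> s s0; apply: le_trans (norm_coord_le _ _) _; rewrite -{2}(ger0_norm s0).
rewrite (ltr0_norm t0).
have := pos' (- t) (fun s => y (- s) 0 j) (fun s => - y' (- s) 0 j).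
rewrite opprK; apply.
- by rewrite oppr_ge0 ltW.
- by rewrite oppr0 y0 mxE.
- by move=> s; exact: (@is_derive_opp_arg _ (fun s => y s 0 j)).
- move=> s s0; rewrite normrN; apply: le_trans (norm_coord_le _ _) _.
  by apply: le_trans (H _) _; rewrite normrN ger0_norm.
Qed.

Lemma norm_le_of_cvg (V : normedModType R) (u : nat -> V) (l x : V) (e : R) :
  u @ \oo --> l -> (\forall n \near \oo, `|u n - x| <= e) -> `|l - x| <= e.
Proof.
move=> ul H.
have c : `|u n - x| @[n --> \oo] --> `|l - x|.
  by apply: cvg_norm; apply: cvgB => //; exact: cvg_cst.
rewrite -(cvg_lim (@Rhausdorff R) c); apply: limr_le => //; exact: cvgP c.
Qed.

Lemma geometric_limit (u : nat -> R) (C : R) :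
  (forall n, `|u n.+1 - u n| <= C * 2^-1 ^+ n) ->
  exists l : R, forall n, `|l - u n| <= 2 * C * 2^-1 ^+ n.
Proof.
move=> H.
(* The factor [1 - 2^-1 ^+ k] is kept because the bound without it does not pass through the
   induction on [k]. *)
have tail n k : `|u (n + k)%N - u n| <= 2 * C * 2^-1 ^+ n * (1 - 2^-1 ^+ k).
  elim: k => [|k IH]; first by rewrite addn0 subrr normr0 expr0 subrr mulr0.
  rewrite addnS -(subrKA (u (n + k)%N)); apply: le_trans (ler_normD _ _) _.
  apply: le_trans (lerD (H _) IH) _.
  rewrite exprD exprSr le_eqVlt; apply/orP; left; apply/eqP.
  by field.
have C0 : 0 <= C by have := H 0%N; rewrite expr0 mulr1; apply: le_trans.
have tail' n k : `|u (n + k)%N - u n| <= 2 * C * 2^-1 ^+ n.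
  have C2 : 0 <= 2 * C * 2^-1 ^+ n by rewrite !mulr_ge0 // exprn_ge0.
  by apply: le_trans (tail n k) _; apply: ler_piMr => //; rewrite gerBl exprn_ge0.
have cu : cvgn u.
  apply/cauchy_cvgP/cauchy_exP => e e0.
  have : (2 * C * 2^-1 ^+ n : R) @[n --> \oo] --> 0.
    by apply: (@cvg_geometric R); rewrite ger0_norm // invf_lt1 ?ltr1n.
  move=> /cvgr0Pnorm_lt /(_ e e0) [n _ /(_ n (leqnn n))] Hn.
  exists (u n); exists n => // k /= nk; rewrite -ball_normE /= distrC -(subnKC nk).
  by apply: le_lt_trans (tail' n _) _; apply: le_lt_trans Hn; exact: ler_norm.
exists (limn u) => n; apply: (norm_le_of_cvg cu).
by exists n => // k /= nk; rewrite -(subnKC nk).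
Qed.

Lemma geometric_limit_rV N (u : nat -> 'rV[R]_N) (C : R) :
  (forall n, `|u n.+1 - u n| <= C * 2^-1 ^+ n) ->
  exists l : 'rV[R]_N, forall n, `|l - u n| <= 2 * C * 2^-1 ^+ n.
Proof.
move=> H.
have C0 : 0 <= C by have := H 0%N; rewrite expr0 mulr1; apply: le_trans.
have CJ (j : 'I_N) : exists l : R, forall n, `|l - u n 0 j| <= 2 * C * 2^-1 ^+ n.
  apply: (@geometric_limit (fun n => u n 0 j)) => n.
  by apply: le_trans (H n); have := norm_coord_le (u n.+1 - u n) j; rewrite !mxE.
have [l Hl] := choice CJ.
exists (\row_j l j) => n; apply: norm_rV_le => [|j]; last by rewrite !mxE.
by rewrite !mulr_ge0 ?exprn_ge0.
Qed.

End Antiderivative.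

(** * Global solutions and Gronwall inequalities *)

Section Picard.
Context {R : realType} {N : nat}.
Local Notation E := 'rV[R]_N.

Lemma is_derive_comp_R (f g : R -> R) (t df dg : R) :
  is_derive (g t) (1 : R) f df -> is_derive t (1 : R) g dg ->
  is_derive t (1 : R) (fun s => f (g s)) (df * dg).
Proof.
move=> [d1 e1] H2; have df' : differentiable f (g t) by apply/derivable1_diffP.
apply: is_derive_eq; first exact: is_derive_comp1 df' H2.
by rewrite deriveE // (diff1E df') derive1E e1 [LHS]mulrC.
Qed.

Lemma geometric_small (C e : R) : 0 < e -> exists n, C * 2^-1 ^+ n <= e.
Proof.
move=> e0.
have : (C * 2^-1 ^+ n : R) @[n --> \oo] --> 0.
  by apply: (@cvg_geometric R); rewrite ger0_norm // invf_lt1 ?ltr1n.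
move=> /cvgr0Pnorm_lt /(_ e e0) [n _ /(_ n (leqnn n))] Hn.
by exists n; apply/ltW/le_lt_trans/Hn; exact: ler_norm.
Qed.

(** Distances between paths are measured against an exponential weight [g |t|]. The Picard operator
    then contracts by 1/2 on the whole line at once, and no continuation of local solutions is
    needed. *)
Lemma picard (f : R -> E -> E) (L : R -> R) (a : E) :
  continuous L -> (forall t x y, `|f t x - f t y| <= L t * `|x - y|) ->
  (forall x : R -> E, continuous x -> continuous (fun t => f t (x t))) ->
  exists2 x : R -> E, x 0 = a & forall t, is_derive t (1 : R) x (f t (x t)).
Proof.
move=> cL Lf cf.
(* The logarithmic derivative of the weight. It is even, to serve both time directions; the
   coefficient 2 of [L] gives the contraction factor 1/2, and the terms in [f t a] make the first
   Picard step smaller than the weight. *)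
pose m t := 2 * (`|L t| + `|L (- t)|) + (`|f t a| + `|f (- t) a|).
have cN : continuous (fun t : R => - t) by move=> t; apply: continuousN.
have cfa : continuous (fun t => f t a) by apply: (cf (fun=> a)) => t; exact: cst_continuous.
have cm : continuous m.
  move=> t; have n1 : {for t, continuous (fun t => `|L t|)} by apply: continuous_comp; [exact: cL|exact: norm_continuous].
  have n2 : {for t, continuous (fun t => `|L (- t)|)}.
    by apply: (@continuous_comp _ _ _ (fun t : R => - t) (fun t => `|L t|)); [exact: cN|apply: continuous_comp; [exact: cL|exact: norm_continuous]].
  have n3 : {for t, continuous (fun t => `|f t a|)} by apply: continuous_comp; [exact: cfa|exact: norm_continuous].
  have n4 : {for t, continuous (fun t => `|f (- t) a|)}.
    by apply: (@continuous_comp _ _ _ (fun t : R => - t) (fun t => `|f t a|)); [exact: cN|apply: continuous_comp; [exact: cfa|exact: norm_continuous]].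
  apply: (@continuousD _ _ _ (fun t => 2 * (`|L t| + `|L (- t)|)) (fun t => `|f t a| + `|f (- t) a|)); last exact: (@continuousD _ _ _ (fun t => `|f t a|)).
  by apply: (@continuousM _ _ (fun=> 2) (fun t => `|L t| + `|L (- t)|)); [exact: cst_continuous|exact: (@continuousD _ _ _ (fun t => `|L t|))].
have [M M0 dM] := antiderivative cm.
pose g t := expR (M t).
have dg t : is_derive t (1 : R) g (g t * m t).
  by apply: (@is_derive_comp_R (@expR R) M).
have m0 t : 0 <= m t by rewrite /m addr_ge0 ?mulr_ge0 ?addr_ge0.
have mN t : m `|t| = m t.
  rewrite /m; case: (leP 0 t) => t0; first by rewrite (ger0_norm t0).
  by rewrite (ltr0_norm t0) opprK (addrC `|L _|) (addrC `|f (- t) a|).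
have g00 : g 0 = 1 by rewrite /g M0 expR0.
have gpos t : 0 < g t by exact: expR_gt0.
have gle s t : s <= t -> g s <= g t.
  move=> st; apply: (@ge0_derive_le R g (fun t => g t * m t)) => // u _.
  by rewrite mulr_ge0 // ltW.
have g1 (t : R) : 1 <= g `|t| by rewrite -g00 gle.
have gf t : `|f t a| <= g `|t| * m `|t|.
  rewrite mN; apply: (@le_trans _ _ (m t)).
    by rewrite /m addrCA lerDl addr_ge0 // mulr_ge0 // addr_ge0.
  by rewrite ler_peMl.
have gL t : 0 <= L t -> L t * g `|t| <= 2^-1 * (g `|t| * m `|t|).
  move=> Lt; rewrite mN mulrCA mulrC ler_pM2l //.
  rewrite mulrC ler_pdivlMr // mulrC /m ger0_norm // mulrDr -addrA lerDl.
  by rewrite addr_ge0 ?mulr_ge0 ?addr_ge0.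
(* Makes antidifferentiation a function on all paths; for a discontinuous path the value is
   arbitrary. *)
have CI (x : R -> E) : exists F : R -> E, continuous x ->
    F 0 = 0 /\ forall t, is_derive t (1 : R) F (x t).
  have [cx|ncx] := pselect (continuous x); last by exists x.
  by have [F F0 dF] := antiderivative_rV cx; exists F.
have [I HI] := choice CI.
pose T x t := a + I (fun s => f s (x s)) t.
have TP x : continuous x -> T x 0 = a /\ forall t, is_derive t (1 : R) (T x) (f t (x t)).
  move=> cx; have [I0 dI] := HI _ (cf x cx); split; first by rewrite /T I0 addr0.
  move=> t; have := is_deriveD (is_derive_cst a t (1 : R)) (dI t).
  by rewrite add0r.
have cT x : continuous x -> continuous (T x).
  by move=> cx t; exact: is_derive_continuous ((TP x cx).2 t).
have growT (x y : R -> E) (c : R) : continuous x -> continuous y -> 0 <= c ->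
    (forall t, `|x t - y t| <= c * g `|t|) -> forall t, `|T x t - T y t| <= c / 2 * g `|t|.
  move=> cx cy c0 H t.
  have [Tx0 dTx] := TP x cx; have [Ty0 dTy] := TP y cy.
  have := @norm_le_growth R N (fun t => T x t - T y t) (fun t => f t (x t) - f t (y t))
     (fun t => c / 2 * g t) (fun t => c / 2 * (g t * m t)).
  rewrite Tx0 Ty0 subrr => /(_ erefl) H1.
  apply: (le_trans (H1 _ _ _ t)).
  - move=> s; apply: le_trans (Lf _ _ _) _.
    have [Ls|Ls] := leP 0 (L s).
      apply: (@le_trans _ _ (L s * (c * g `|s|))); first by rewrite ler_wpM2l.
      by rewrite mulrCA -mulrA ler_wpM2l // gL.
    apply: (@le_trans _ _ 0); first by rewrite nmulr_rle0.
    by rewrite !mulr_ge0 // ltW.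
  by rewrite gerBl mulr_ge0 ?mulr_ge0 // ltW.
pose X n := iter n T (fun=> a).
have cX n : continuous (X n).
  by elim: n => [|n IH] /=; [move=> t; exact: cst_continuous|exact: cT].
have X1 t : `|X 1%N t - X 0%N t| <= g `|t|.
  have [T0 dT] := TP _ (cX 0%N).
  have := @norm_le_growth R N (fun t => X 1%N t - a) (fun t => f t a) g (fun t => g t * m t).
  rewrite /X /= T0 subrr => /(_ erefl) H1.
  apply: (le_trans (H1 _ _ _ t)) => //.
    by move=> s; have := is_deriveB (dT s) (is_derive_cst a s (1 : R)); rewrite subr0.
  by rewrite gerBl ltW.
have Xn n t : `|X n.+1 t - X n t| <= 2^-1 ^+ n * g `|t|.
  elim: n t => [|n IH] t; first by rewrite expr0 mul1r.
  by rewrite exprSr; apply: (growT (X n.+1) (X n) (2^-1 ^+ n)) => //; exact: exprn_ge0.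
have CX (t : R) : exists l : E, forall n, `|l - X n t| <= 2 * g `|t| * 2^-1 ^+ n.
  by apply: (@geometric_limit_rV R N (fun n => X n t) (g `|t|)) => n; rewrite mulrC.
have [x Hx] := choice CX.
have cx : continuous x.
  move=> t0; apply/cvgrPdist_le => e e0.
  have e30 : 0 < e / 3 by rewrite divr_gt0.
  have [n Hn] := geometric_small (2 * g (`|t0| + 1)) e30.
  have xX t : `|t - t0| <= 1 -> `|x t - X n t| <= e / 3.
    move=> tt; apply: le_trans (Hx t n) _; apply: le_trans Hn.
    rewrite ler_wpM2r ?exprn_ge0 // ler_wpM2l // gle // -[t in `|t|](subrK t0).
    by apply: le_trans (ler_normD _ _) _; rewrite addrC lerD2l.
  have /cvgrPdist_le /(_ _ e30) cXn := cX n t0.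
  near=> t.
  have tt : `|t - t0| <= 1.
    rewrite distrC; near: t; apply/nbhs_ballP; by exists 1 => //= s /ltW.
  have -> : x t0 - x t = (x t0 - X n t0) + (X n t0 - X n t) - (x t - X n t).
    by rewrite opprB !addrA !subrK.
  have -> : e = e / 3 + e / 3 + e / 3 by field.
  apply: le_trans (ler_normB _ _) _; rewrite lerD ?xX //.
  apply: le_trans (ler_normD _ _) _; rewrite lerD ?xX ?subrr ?normr0 //.
  by near: t.
have [Tx0 dTx] := TP x cx.
suff xT : x = T x by exists x => [|t]; [rewrite {1}xT|rewrite {1}xT].
apply/funext => t; apply/eqP; rewrite -subr_eq0 -normr_le0; apply/ler_addgt0Pl => e e0.
rewrite addr0; have [n Hn] := geometric_small (2 * g `|t|) e0; apply: le_trans Hn.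
have H1 : `|x t - X n.+1 t| <= g `|t| * 2^-1 ^+ n.
  by apply: le_trans (Hx t n.+1) _; rewrite exprS mulrACA mulfV // mul1r.
have H2 : `|X n.+1 t - T x t| <= g `|t| * 2^-1 ^+ n.
  have := growT (X n) x (2 * 2^-1 ^+ n) (cX n) cx.
  rewrite mulr_ge0 ?exprn_ge0 // => /(_ erefl) H; apply: le_trans (H _ t) _.
    by move=> s; rewrite distrC; apply: le_trans (Hx s n) _; rewrite mulrAC.
  by move: (2^-1 ^+ n) => z; rewrite (mulrC 2 z) mulfK // mulrC.
rewrite -(subrKA (X n.+1 t)); apply: le_trans (ler_normD _ _) _.
by apply: le_trans (lerD H1 H2) _; rewrite -mulrA mulr_natl mulr2n.
Unshelve. all: by end_near. Qed.

(** The product of [p t] and [expR (- (c * t))] is nonincreasing. *)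
Lemma gronwall_scalar (p p' : R -> R) (c : R) :
  (forall t : R, 0 <= t <= 1 -> is_derive t (1 : R) p (p' t)) ->
  (forall t : R, 0 <= t <= 1 -> p' t <= c * p t) ->
  forall t : R, 0 <= t <= 1 -> p t <= p 0 * expR (c * t).
Proof.
move=> dp Hp t /andP[t0 t1].
have de s : is_derive s (1 : R) (fun s => expR (- (c * s))) (expR (- (c * s)) * - c).
  apply: (@is_derive_comp_R (@expR R) (fun s => - (c * s))).
  apply: is_deriveN; have := @is_deriveZ R R R id c s 1 1 (is_derive_id s 1).
  by rewrite [c *: 1]mulr1; exact.
have H := @le0_derive_ge R (fun s => p s * expR (- (c * s)))
  (fun s => p s * (expR (- (c * s)) * - c) + expR (- (c * s)) * p' s) 0 t t0.
have : p t * expR (- (c * t)) <= p 0 * expR (- (c * 0)).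
  apply: H => s /andP[s0 st]; have s01 : 0 <= s <= 1 by rewrite s0 (le_trans st).
    exact: (@is_deriveM R R p (fun s => expR (- (c * s))) s 1 _ _ (dp s s01) (de s)).
  have -> : p s * (expR (- (c * s)) * - c) + expR (- (c * s)) * p' s = expR (- (c * s)) * (p' s - c * p s) by ring.
  by rewrite pmulr_rle0 ?expR_gt0 // subr_le0 Hp.
rewrite mulr0 oppr0 expR0 mulr1 expRN => H1.
by rewrite -ler_pdivrMr ?expR_gt0.
Qed.

(** The sup norm is not differentiable, so the scalar inequality is applied to the sum of squares
    plus [e ^+ 2]; the dimension enters [K] through the comparison of the two norms. [K] is chosen
    before the function and the source term. *)
Lemma gronwall (L : R) : 0 <= L -> exists2 K : R, 0 <= K &
  forall (y y' : R -> E) (e : R), 0 <= e ->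
   (forall t : R, 0 <= t <= 1 -> is_derive t (1 : R) y (y' t)) ->
   (forall t : R, 0 <= t <= 1 -> `|y' t| <= L * `|y t| + e) ->
   forall t : R, 0 <= t <= 1 -> `|y t| <= K * (`|y 0| + e).
Proof.
move=> L0; pose c := 2 * N%:R * (L + 1).
have c0 : 0 <= c by rewrite !mulr_ge0 // addr_ge0.
exists (Num.sqrt ((N%:R + 1) * expR c)); first exact: sqrtr_ge0.
move=> y y' e e0 dy Hy t t01.
pose q t := \sum_j (y t 0 j) ^+ 2.
have q0 s : 0 <= q s by apply: sumr_ge0 => j _; exact: sqr_ge0.
have dyj (s : R) j : 0 <= s <= 1 -> is_derive s (1 : R) (fun s => y s 0 j) (y' s 0 j).
  by move=> /dy /is_derive_mxP; exact.
have dq (s : R) : 0 <= s <= 1 -> is_derive s (1 : R) q (\sum_j 2 * y s 0 j * y' s 0 j).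
  move=> s01; rewrite (_ : q = \sum_j (fun s => (y s 0 j) ^+ 2)); last by apply/funext => u; rewrite fct_sumE.
  apply: is_derive_sum => j.
  have := @is_deriveM R R (fun s => y s 0 j) (fun s => y s 0 j) s 1 _ _ (dyj s j s01) (dyj s j s01).
  rewrite (_ : (fun s => y s 0 j) * (fun s => y s 0 j) = (fun s => y s 0 j ^+ 2)); last by apply/funext => u.
  by move=> H; apply: is_derive_eq H _; transitivity (y s 0 j * y' s 0 j + y s 0 j * y' s 0 j) => //; ring.
have yq s : `|y s| ^+ 2 <= q s.
  case: (posnP N) => [N0|Npos].
    have -> : y s = 0 by apply/rowP => j; exfalso; case: j => j; rewrite N0.
    by rewrite normr0 expr0n.
  have : `|y s| <= Num.sqrt (q s).
    apply: norm_rV_le => [|j]; first exact: sqrtr_ge0.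
    rewrite -sqrtr_sqr; apply: ler_wsqrtr; rewrite /q (bigD1 j) //= lerDl.
    by apply: sumr_ge0 => k _; exact: sqr_ge0.
  move=> H; rewrite -(sqr_sqrtr (q0 s)) ler_sqr ?nnegrE ?sqrtr_ge0 //.
have qy s : q s <= N%:R * `|y s| ^+ 2.
  apply: (@le_trans _ _ (\sum_(j < N) `|y s| ^+ 2)).
    apply: ler_sum => j _; rewrite -real_normK ?num_real // ler_sqr ?nnegrE // norm_coord_le //.
  by rewrite sumr_const card_ord mulr_natl.
have Hq s : 0 <= s <= 1 -> \sum_j 2 * y s 0 j * y' s 0 j <= c * (q s + e ^+ 2).
  move=> s01; apply: (@le_trans _ _ (\sum_(j < N) 2 * (`|y s| * (L * `|y s| + e)))).
    apply: ler_sum => j _; rewrite -mulrA ler_pM2l //; apply: le_trans (ler_norm _) _.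
    rewrite normrM ler_pM ?norm_coord_le //.
    by apply: le_trans (Hy s s01); exact: norm_coord_le.
  rewrite sumr_const card_ord -[_ *+ N]mulr_natl /c [2 * N%:R]mulrC -!mulrA ler_wpM2l // ler_pM2l //.
  apply: (@le_trans _ _ ((L + 1) * (`|y s| ^+ 2 + e ^+ 2))); last first.
    by rewrite ler_wpM2l ?addr_ge0 // lerD2r yq.
  have := sqr_ge0 (`|y s| - e); have : 0 <= L * e ^+ 2 by rewrite mulr_ge0 ?sqr_ge0.
  have := sqr_ge0 (`|y s| + e).
  set Y := `|y s|; nra.
have G := @gronwall_scalar (fun t => q t + e ^+ 2) (fun s => \sum_j 2 * y s 0 j * y' s 0 j) c _ Hq t t01.
have {}G : q t + e ^+ 2 <= (q 0 + e ^+ 2) * expR (c * t).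
  apply: G => s s01; have := is_deriveD (dq s s01) (is_derive_cst (e ^+ 2) s (1 : R)).
  by rewrite addr0.
have Y : `|y t| ^+ 2 <= (N%:R + 1) * expR c * (`|y 0| + e) ^+ 2.
  apply: le_trans (yq t) _; apply: (@le_trans _ _ (q t + e ^+ 2)); first by rewrite lerDl sqr_ge0.
  apply: le_trans G _.
  apply: (@le_trans _ _ ((N%:R + 1) * (`|y 0| + e) ^+ 2 * expR c)); last by rewrite mulrAC.
  apply: ler_pM => //.
  - by rewrite addr_ge0 // sqr_ge0.
  - have := qy 0; have : 0 <= (N%:R : R) by []. have := normr_ge0 (y 0).
    move: (q 0) `|y 0| (N%:R : R) => Q Y n Y0 n0 QY.
    have : 0 <= n * (Y * e) by rewrite !mulr_ge0.
    have : 0 <= n * e ^+ 2 by rewrite mulr_ge0 // sqr_ge0.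
    have : 0 <= Y * e by rewrite mulr_ge0.
    have := sqr_ge0 Y. nra.
  - rewrite ler_expR; case/andP: t01 => t0 t1; by rewrite -[leRHS]mulr1 ler_wpM2l.
rewrite -(@ler_sqr R) ?nnegrE ?mulr_ge0 ?sqrtr_ge0 ?addr_ge0 // exprMn sqr_sqrtr //.
Qed.

End Picard.

(** * Uniform first- and second-order bounds on balls *)

Section LocalLipschitz.
Context {R : realType}.

Lemma continuous_bounded_ball m (h : 'rV[R]_m -> R) (r : R) :
  (forall x, {for x, continuous h}) ->
  exists2 B : R, 0 <= B & forall x, `|x| <= r -> `|h x| <= B.
Proof.
move=> ch; case: (ltP r 0) => r0.
  by exists 0 => // x xr; have := lt_le_trans r0 (normr_ge0 x); rewrite ltNge xr.
pose A := [set v : 'rV[R]_m | forall i, `[- r, r]%classic (v ord0 i)].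
have cA : compact A by apply: (@rV_compact R m (fun=> `[- r, r]%classic)) => i; exact: segment_compact.
have A0 : A !=set0 by exists 0 => i /=; rewrite mxE in_itv /= oppr_le0 r0.
have [c _ Hc] : exists2 c, c \in A & forall t, t \in A -> `|h t| <= `|h c|.
  apply: (@EVT_max_rV R m (fun x => `|h x|)) => //; apply: continuous_subspaceT => x.
  by apply: continuous_comp; [exact: ch|exact: norm_continuous].
exists `|h c| => // x xr; apply: Hc; rewrite inE => i /=.
by rewrite in_itv /= -ler_norml; apply: le_trans xr; exact: norm_coord_le.
Qed.

Lemma norm_segment_le m (x y : 'rV[R]_m) (r s : R) : `|x| <= r -> `|y| <= r -> 0 <= s <= 1 ->
  `|y + s *: (x - y)| <= r.
Proof.
move=> xr yr /andP[s0 s1].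
have -> : y + s *: (x - y) = s *: x + (1 - s) *: y.
  by rewrite scalerBr scalerBl scale1r addrC -addrA (addrC (- _)).
apply: le_trans (ler_normD _ _) _; rewrite !normrZ ger0_norm // ger0_norm ?subr_ge0 //.
apply: (@le_trans _ _ (s * r + (1 - s) * r)); last by rewrite -mulrDl addrC subrK mul1r.
by rewrite lerD // ler_wpM2l // subr_ge0.
Qed.

Lemma MVT_segment_rV m (F : 'rV[R]_m -> R) (x y : 'rV[R]_m) :
  (forall s : R, 0 <= s <= 1 -> differentiable F (y + s *: (x - y))) ->
  exists2 s : R, 0 <= s <= 1 & F x - F y = 'D_(x - y) F (y + s *: (x - y)).
Proof.
move=> dF.
have [|s s01 E] := @MVT01 R (fun s => F (y + s *: (x - y))) (fun s => 'D_(x - y) F (y + s *: (x - y))) 0 1 ler01.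
  by move=> t t01; apply: is_derive_line; exact/diff_derivable/dF.
exists s => //; move: E; rewrite scale1r scale0r addr0 subr0 mulr1 => <-.
by rewrite (addrC y) subrK.
Qed.

Lemma norm_derive_le m (F : 'rV[R]_m -> R) (x h : 'rV[R]_m) : differentiable F x ->
  `|'D_h F x| <= `|h| * \sum_j `|'D_(delta_mx 0 j) F x|.
Proof.
move=> dF; rewrite derive_sum_coord //; apply: le_trans (ler_norm_sum _ _ _) _.
rewrite mulr_sumr; apply: ler_sum => j _.
by rewrite normrM ler_wpM2r // norm_coord_le.
Qed.

Lemma sum_derive_bounded m (F : 'rV[R]_m -> R) (r : R) : sm 1 setT F ->
  exists2 B : R, 0 <= B & forall x, `|x| <= r -> \sum_j `|'D_(delta_mx 0 j) F x| <= B.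
Proof.
move=> /smS[dF DF].
have [|B B0 HB] := @continuous_bounded_ball m (fun x => \sum_j `|'D_(delta_mx 0 j) F x|) r.
  move=> x; rewrite (_ : (fun x => _) = \sum_j (fun x => `|'D_(delta_mx 0 j) F x|)); last by apply/funext => u; rewrite fct_sumE.
  elim/big_ind : _ => [||j _]; [exact: cst_continuous|by move=> *; exact: continuousD|].
  by apply: continuous_comp; [exact: (DF (delta_mx 0 j))|exact: norm_continuous].
by exists B => // x xr; apply: le_trans (HB x xr); exact: ler_norm.
Qed.

Lemma C1_lipschitz_ball m (F : 'rV[R]_m -> R) (r : R) : sm 1 setT F ->
  exists2 L : R, 0 <= L & forall x y, `|x| <= r -> `|y| <= r -> `|F x - F y| <= L * `|x - y|.
Proof.
move=> sF; have [B B0 HB] := sum_derive_bounded r sF; have [dF _] := (smS _ _ _).1 sF.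
exists B => // x y xr yr.
have [|s s01 ->] := @MVT_segment_rV m F x y; first by move=> s _; exact: dF.
apply: le_trans (norm_derive_le _ (dF _ I)) _; rewrite mulrC ler_wpM2r // HB //.
exact: norm_segment_le.
Qed.

(** The mean value theorem gives the derivative at an intermediate point, which differs from the one
    at [y] by a Lipschitz bound; the ball is convex, so the point stays in it. *)
Lemma C2_taylor_ball m (F : 'rV[R]_m -> R) (r : R) : sm 2 setT F ->
  exists2 K : R, 0 <= K & forall x y, `|x| <= r -> `|y| <= r ->
    `|F x - F y - 'D_(x - y) F y| <= K * `|x - y| ^+ 2.
Proof.
move=> /smS[dF DF].
have LJ (j : 'I_m) : exists L : R, 0 <= L /\ forall x y, `|x| <= r -> `|y| <= r ->
    `|'D_(delta_mx 0 j) F x - 'D_(delta_mx 0 j) F y| <= L * `|x - y|.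
  by have [L L0 HL] := C1_lipschitz_ball r (DF (delta_mx 0 j)); exists L.
have [L HL] := choice LJ.
exists (\sum_j L j); first by apply: sumr_ge0 => j _; have [] := HL j.
move=> x y xr yr.
have [|s /andP[s0 s1] ->] := @MVT_segment_rV m F x y; first by move=> s _; exact: dF.
have zr : `|y + s *: (x - y)| <= r by apply: norm_segment_le => //; rewrite s0.
rewrite !(derive_sum_coord _ (dF _ I)) -sumrB; apply: le_trans (ler_norm_sum _ _ _) _.
rewrite mulr_suml; apply: ler_sum => j _.
rewrite -scalerBr normrM mulrC expr2 mulrA.
apply: ler_pM => //; last exact: norm_coord_le.
apply: le_trans ((HL j).2 _ _ zr yr) _; rewrite addrAC subrr add0r normrZ ger0_norm //.
by rewrite ler_wpM2l ?(HL j).1 // ler_piMl.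
Qed.

Lemma C1_lipschitz_ball_rV m N (F : 'rV[R]_m -> 'rV[R]_N) (r : R) : sm 1 setT F ->
  exists2 L : R, 0 <= L & forall x y, `|x| <= r -> `|y| <= r -> `|F x - F y| <= L * `|x - y|.
Proof.
move=> sF.
have LJ (j : 'I_N) : exists L : R, 0 <= L /\ forall x y, `|x| <= r -> `|y| <= r ->
    `|F x 0 j - F y 0 j| <= L * `|x - y|.
  have [L L0 HL] := C1_lipschitz_ball r ((sm_mxP openT 1 F).1 sF 0 j); by exists L.
have [L HL] := choice LJ.
exists (\sum_j L j) => [|x y xr yr]; first by apply: sumr_ge0 => j _; have [] := HL j.
have S0 : 0 <= \sum_j L j by apply: sumr_ge0 => j _; have [] := HL j.
apply: norm_rV_le => [|j]; first by rewrite mulr_ge0.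
rewrite !mxE; apply: le_trans ((HL j).2 x y xr yr) _.
rewrite ler_wpM2r // (bigD1 j) //= lerDl; apply: sumr_ge0 => k _; exact: (HL k).1.
Qed.

Lemma C2_taylor_ball_rV m N (F : 'rV[R]_m -> 'rV[R]_N) (r : R) : sm 2 setT F ->
  exists2 K : R, 0 <= K & forall x y, `|x| <= r -> `|y| <= r ->
    `|F x - F y - 'D_(x - y) F y| <= K * `|x - y| ^+ 2.
Proof.
move=> sF; have [dF _] := (smS _ _ _).1 sF.
have LJ (j : 'I_N) : exists L : R, 0 <= L /\ forall x y, `|x| <= r -> `|y| <= r ->
    `|F x 0 j - F y 0 j - ('D_(x - y) F y) 0 j| <= L * `|x - y| ^+ 2.
  have [L L0 HL] := C2_taylor_ball r ((sm_mxP openT 2 F).1 sF 0 j); exists L; split => // x y xr yr.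
  by have := HL x y xr yr; rewrite derive_mx ?mxE //; exact/diff_derivable/dF.
have [L HL] := choice LJ.
exists (\sum_j L j) => [|x y xr yr]; first by apply: sumr_ge0 => j _; have [] := HL j.
have S0 : 0 <= \sum_j L j by apply: sumr_ge0 => j _; have [] := HL j.
apply: norm_rV_le => [|j]; first by rewrite mulr_ge0 // exprn_ge0.
apply: (@le_trans _ _ (L j * `|x - y| ^+ 2)).
  have := (HL j).2 x y xr yr; move: (F x) (F y) ('D_(x - y) F y) => a b c.
  by rewrite !mxE.
rewrite ler_wpM2r ?exprn_ge0 // (bigD1 j) //= lerDl; apply: sumr_ge0 => k _; exact: (HL k).1.
Qed.

Lemma derive_bound_ball_rV m N (F : 'rV[R]_m -> 'rV[R]_N) (r : R) : sm 1 setT F ->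
  exists2 L : R, 0 <= L & forall x h, `|x| <= r -> `|'D_h F x| <= L * `|h|.
Proof.
move=> sF; have [dF _] := (smS _ _ _).1 sF.
have LJ (j : 'I_N) : exists L : R, 0 <= L /\ forall x h, `|x| <= r ->
    `|('D_h F x) 0 j| <= L * `|h|.
  have sj := (sm_mxP openT 1 F).1 sF 0 j.
  have [L L0 HL] := sum_derive_bounded r sj; exists L; split => // x h xr.
  have [dFj _] := (smS _ _ _).1 sj.
  rewrite derive_mx ?mxE //; last exact/diff_derivable/dF.
  apply: le_trans (norm_derive_le h (dFj x I)) _; by rewrite mulrC ler_wpM2r // HL.
have [L HL] := choice LJ.
have S0 : 0 <= \sum_j L j by apply: sumr_ge0 => j _; have [] := HL j.
exists (\sum_j L j) => // x h xr.
apply: norm_rV_le => [|j]; first by rewrite mulr_ge0.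
apply: le_trans ((HL j).2 x h xr) _.
rewrite ler_wpM2r // (bigD1 j) //= lerDl; apply: sumr_ge0 => k _; exact: (HL k).1.
Qed.

End LocalLipschitz.

(** * Smooth dependence of the flow on initial data *)

Section Flow.
Context {R : realType}.

Definition solution N (F : 'rV[R]_N -> 'rV[R]_N) (x : R -> 'rV[R]_N) : Prop :=
  forall t : R, is_derive t (1 : R) x (F (x t)).

(* The a priori bound in the last clause makes the class stable under passing
   to the variational field, so that smoothness of the flow follows by
   induction on the order of differentiability. *)
Definition complete_field N (F : 'rV[R]_N -> 'rV[R]_N) : Prop :=
  [/\ smooth setT F,
      forall a, exists2 x, x 0 = a & solution F x &
      forall r : R, exists r' : R, forall x, solution F x -> `|x 0| <= r ->
        forall t : R, 0 <= t <= 1 -> `|x t| <= r'].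

Definition flow1 N (F : 'rV[R]_N -> 'rV[R]_N) (a : 'rV[R]_N) : 'rV[R]_N :=
  get [set x : R -> 'rV[R]_N | x 0 = a /\ solution F x] 1.

Lemma solution_dist N (F : 'rV[R]_N -> 'rV[R]_N) (r : R) : complete_field F ->
  exists2 K : R, 0 <= K & forall x y, solution F x -> solution F y ->
    `|x 0| <= r -> `|y 0| <= r ->
    forall t : R, 0 <= t <= 1 -> `|x t - y t| <= K * `|x 0 - y 0|.
Proof.
move=> [sF _ bF]; have [r' Hr'] := bF r.
have [L L0 HL] := C1_lipschitz_ball_rV r' (sF 1%N).
have [K K0 HK] := @gronwall R N L L0.
exists K => // x y sx sy xr yr t t01.
have := HK (fun t => x t - y t) (fun t => F (x t) - F (y t)) 0 (lexx _).
rewrite addr0; apply => // s s01; first exact: (is_deriveB (sx s) (sy s)).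
by rewrite addr0; apply: HL; [exact: (Hr' x)|exact: (Hr' y)].
Qed.

Lemma solution_unique N (F : 'rV[R]_N -> 'rV[R]_N) x y : complete_field F ->
  solution F x -> solution F y -> x 0 = y 0 -> forall t : R, 0 <= t <= 1 -> x t = y t.
Proof.
move=> cF sx sy xy0 t t01; have [K K0 HK] := solution_dist (`|x 0|) cF.
have := HK x y sx sy (lexx _); rewrite -xy0 => /(_ (lexx _) t t01).
by rewrite subrr normr0 mulr0 normr_le0 subr_eq0 => /eqP.
Qed.

Lemma flow1E N (F : 'rV[R]_N -> 'rV[R]_N) x : complete_field F -> solution F x ->
  flow1 F (x 0) = x 1.
Proof.
move=> cF sx; rewrite /flow1.
have [] := @getPex _ [set y : R -> 'rV[R]_N | y 0 = x 0 /\ solution F y]; first by exists x.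
set y := get _ => y0 sy; apply: (solution_unique cF) => //.
by rewrite ler01 lexx.
Qed.

Lemma flow1_lipschitz N (F : 'rV[R]_N -> 'rV[R]_N) (r : R) : complete_field F ->
  exists2 K : R, 0 <= K & forall a b, `|a| <= r -> `|b| <= r ->
    `|flow1 F a - flow1 F b| <= K * `|a - b|.
Proof.
move=> cF; have [K K0 HK] := solution_dist r cF; exists K => // a b.
have [_ ex _] := cF; have [x <- sx] := ex a; have [y <- sy] := ex b => ar br.
by rewrite !flow1E //; apply: HK => //; rewrite ler01 lexx.
Qed.

Lemma locally_lipschitz_continuous (V W : normedModType R) (f : V -> W) (a : V) (K : R) :
  (forall b, `|a - b| <= 1 -> `|f a - f b| <= K * `|a - b|) -> {for a, continuous f}.
Proof.
move=> H; apply/cvgrPdist_le => e e0.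
have K1 : 0 < `|K| + 1 by rewrite ltr_wpDl.
have d0 : 0 < Num.min 1 (e / (`|K| + 1)) by rewrite lt_min ltr01 divr_gt0.
apply/nbhs_ballP; exists (Num.min 1 (e / (`|K| + 1))) => // b.
rewrite -ball_normE /= lt_min => /andP[ab1 abe].
apply: le_trans (H b (ltW ab1)) _.
apply: (@le_trans _ _ ((`|K| + 1) * `|a - b|)).
  by rewrite ler_wpM2r //; apply: le_trans (ler_norm _) _; rewrite lerDl.
by rewrite mulrC -ler_pdivlMr // ltW.
Qed.

Lemma flow1_continuous N (F : 'rV[R]_N -> 'rV[R]_N) a : complete_field F ->
  {for a, continuous (flow1 F)}.
Proof.
move=> cF; have [K K0 HK] := flow1_lipschitz (`|a| + 1) cF.
apply: (@locally_lipschitz_continuous _ _ _ _ K) => b ab; apply: HK; first by rewrite lerDl.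
rewrite -(subrK a b); apply: le_trans (ler_normD _ _) _.
by rewrite addrC lerD2l distrC.
Qed.

(** The field coupled with its linearisation: the first component is a trajectory, the second the
    derivative of the flow applied to a tangent vector. *)
Definition variational N (F : 'rV[R]_N -> 'rV[R]_N) (z : 'rV[R]_(N + N)) : 'rV[R]_(N + N) :=
  row_mx (F (lsubmx z)) ('D_(rsubmx z) F (lsubmx z)).

Lemma sm_lsubmx k (V : normedModType R) (U : set V) n1 n2 (f : V -> 'rV[R]_(n1 + n2)) :
  open U -> sm k U f -> sm k U (fun x => lsubmx (f x)).
Proof.
move=> oU sf; apply/(sm_mxP oU) => i j; apply: sm_eq ((sm_mxP oU k f).1 sf i (lshift n2 j)) => x.
by rewrite mxE.
Qed.

Lemma sm_rsubmx k (V : normedModType R) (U : set V) n1 n2 (f : V -> 'rV[R]_(n1 + n2)) :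
  open U -> sm k U f -> sm k U (fun x => rsubmx (f x)).
Proof.
move=> oU sf; apply/(sm_mxP oU) => i j; apply: sm_eq ((sm_mxP oU k f).1 sf i (rshift n1 j)) => x.
by rewrite mxE.
Qed.

Lemma sm_row_mx k (V : normedModType R) (U : set V) n1 n2 (f : V -> 'rV[R]_n1) (g : V -> 'rV[R]_n2) :
  open U -> sm k U f -> sm k U g -> sm k U (fun x => row_mx (f x) (g x)).
Proof.
move=> oU sf sg; apply/(sm_mxP oU) => i j; case: (splitP j) => a ja.
  have -> : j = lshift n2 a by apply/val_inj.
  by apply: sm_eq ((sm_mxP oU k f).1 sf i a) => x; rewrite row_mxEl.
have -> : j = rshift n1 a by apply/val_inj.
by apply: sm_eq ((sm_mxP oU k g).1 sg i a) => x; rewrite row_mxEr.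
Qed.

Lemma sm_id k m (U : set 'rV[R]_m) : open U -> sm k U (fun x : 'rV[R]_m => x).
Proof. by move=> oU; apply/(sm_mxP oU) => i j; exact: sm_coord. Qed.

Lemma sm_comp_rV k (V : normedModType R) (U : set V) m N (U' : set 'rV[R]_m) (f : 'rV[R]_m -> 'rV[R]_N) (g : V -> 'rV[R]_m) :
  open U -> open U' -> (forall x, U x -> U' (g x)) ->
  sm k U' f -> sm k U g -> sm k U (fun x => f (g x)).
Proof.
move=> oU oU' gU sf sg; apply/(sm_mxP oU) => i j.
exact: (sm_comp oU oU' gU ((sm_mxP oU' k f).1 sf i j) sg).
Qed.

Lemma variational_smooth N (F : 'rV[R]_N -> 'rV[R]_N) : smooth setT F -> smooth setT (variational F).
Proof.
move=> sF k; have sl := sm_lsubmx openT (@sm_id k (N + N) setT openT).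
have sr := sm_rsubmx openT (@sm_id k (N + N) setT openT).
apply: sm_row_mx => //; first exact: openT.
  by apply: (sm_comp_rV openT openT).
apply/(sm_mxP openT) => i j.
have S : sm k setT (fun z : 'rV[R]_(N + N) => \sum_l rsubmx z 0 l * ('D_(delta_mx 0 l) F (lsubmx z)) i j).
  apply: sm_sum => [|l _]; first exact: openT.
  apply: smM; [exact: openT|exact: ((sm_mxP openT k _).1 sr)|].
  have [_ DF] := (smS _ _ _).1 (sF k.+1).
  exact: (@sm_comp _ _ _ openT k N setT (fun x => ('D_(delta_mx 0 l) F x) i j) _ openT _ ((sm_mxP openT k _).1 (DF _) i j) sl).
apply: sm_eq S => z.
have [dF _] := (smS _ _ _).1 (sF 1%N).
rewrite (derive_sum_coord _ (dF _ I)) summxE; apply: eq_bigr => l _.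
by rewrite [RHS]mxE.
Qed.

Lemma solution_lsubmx N (F : 'rV[R]_N -> 'rV[R]_N) z : solution (variational F) z ->
  solution F (fun t => lsubmx (z t)).
Proof.
move=> sz t; apply/is_derive_mxP => i j.
have /is_derive_mxP /(_ i (lshift N j)) := sz t.
rewrite /variational row_mxEl (_ : (fun s => z s i _) = (fun s => lsubmx (z s) i j)) //.
by apply/funext => s; rewrite mxE.
Qed.

Lemma is_derive_rsubmx N (F : 'rV[R]_N -> 'rV[R]_N) z : solution (variational F) z ->
  forall t : R, is_derive t (1 : R) (fun t => rsubmx (z t)) ('D_(rsubmx (z t)) F (lsubmx (z t))).
Proof.
move=> sz t; apply/is_derive_mxP => i j.
have /is_derive_mxP /(_ i (rshift N j)) := sz t.
rewrite /variational row_mxEr (_ : (fun s => z s i _) = (fun s => rsubmx (z s) i j)) //.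
by apply/funext => s; rewrite mxE.
Qed.

Lemma norm_lsubmx_le n1 n2 (z : 'rV[R]_(n1 + n2)) : `|lsubmx z| <= `|z|.
Proof. by apply: norm_rV_le => // j; rewrite mxE norm_coord_le. Qed.

Lemma norm_rsubmx_le n1 n2 (z : 'rV[R]_(n1 + n2)) : `|rsubmx z| <= `|z|.
Proof. by apply: norm_rV_le => // j; rewrite mxE norm_coord_le. Qed.

Lemma norm_row_mx_le n1 n2 (x : 'rV[R]_n1) (y : 'rV[R]_n2) (r : R) :
  0 <= r -> `|x| <= r -> `|y| <= r -> `|row_mx x y| <= r.
Proof.
move=> r0 xr yr; apply: norm_rV_le => // j; case: (splitP j) => a ja.
  have -> : j = lshift n2 a by apply/val_inj.
  by rewrite row_mxEl; apply: le_trans xr; exact: norm_coord_le.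
have -> : j = rshift n1 a by apply/val_inj.
by rewrite row_mxEr; apply: le_trans yr; exact: norm_coord_le.
Qed.

Lemma deriveB_dir N M (F : 'rV[R]_N -> 'rV[R]_M) x u v : differentiable F x ->
  'D_(u - v) F x = 'D_u F x - 'D_v F x.
Proof. by move=> dF; rewrite !deriveE // linearB. Qed.

(** Along a given trajectory the second component solves a linear equation with continuous
    coefficients, so [picard] applies for all times; the a priori bound on it comes from
    [gronwall]. *)
Lemma variational_complete N (F : 'rV[R]_N -> 'rV[R]_N) : complete_field F ->
  complete_field (variational F).
Proof.
move=> cF; have [sF eF bF] := cF; have [dF DF] := (smS _ _ _).1 (sF 1%N).
split; first exact: variational_smooth.
  move=> z0; have [x x0 sx] := eF (lsubmx z0).
  have cx : forall t, {for t, continuous x} by move=> t; exact: is_derive_continuous (sx t).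
  pose L (t : R) : R := \sum_j `|'D_(delta_mx 0 j) F (x t)|.
  have [|||y y0 dy] := @picard R N (fun t y => 'D_y F (x t)) L (rsubmx z0).
  - move=> t; rewrite (_ : L = \sum_j (fun t => `|'D_(delta_mx 0 j) F (x t)|)); last by apply/funext => u; rewrite fct_sumE.
    elim/big_ind : _ => [||j _]; [exact: cst_continuous|by move=> *; exact: continuousD|].
    apply: (@continuous_comp _ _ _ (fun t => 'D_(delta_mx 0 j) F (x t)) (fun z => `|z|)); last exact: norm_continuous.
    by apply: (@continuous_comp _ _ _ x ('D_(delta_mx 0 j) F)); [exact: cx|exact: (DF (delta_mx 0 j))].
  - move=> t y1 y2; rewrite -deriveB_dir; last exact: dF.
    rewrite (derive_sum_coord _ (dF _ I)); apply: le_trans (ler_norm_sum _ _ _) _.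
    rewrite /L mulr_suml; apply: ler_sum => j _.
    by rewrite normrZ mulrC ler_wpM2l // norm_coord_le.
  - move=> y cy t; rewrite (_ : (fun t => _) = \sum_j (fun t => y t 0 j *: 'D_(delta_mx 0 j) F (x t))); last first.
      by apply/funext => u; rewrite fct_sumE derive_sum_coord //; exact: dF.
    elim/big_ind : _ => [||j _]; [exact: cst_continuous|by move=> *; exact: continuousD|].
    apply: (@continuousZ _ _ _ (fun t => y t 0 j) (fun t => 'D_(delta_mx 0 j) F (x t))).
      by have /continuous_mxP := cy t; exact.
    by apply: (@continuous_comp _ _ _ x ('D_(delta_mx 0 j) F)); [exact: cx|exact: (DF (delta_mx 0 j))].
  exists (fun t => row_mx (x t) (y t)); first by rewrite x0 y0 hsubmxK.
  move=> t; apply/is_derive_mxP => i j; rewrite /variational row_mxKl row_mxKr.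
  case: (splitP j) => a ja.
    have -> : j = lshift N a by apply/val_inj.
    rewrite row_mxEl (_ : (fun s => _) = (fun s => x s i a)); last by apply/funext => s; rewrite row_mxEl.
    by have /is_derive_mxP := sx t; exact.
  have -> : j = rshift N a by apply/val_inj.
  rewrite row_mxEr (_ : (fun s => _) = (fun s => y s i a)); last by apply/funext => s; rewrite row_mxEr.
  by have /is_derive_mxP := dy t; exact.
move=> r; have [r' Hr'] := bF r.
have [L L0 HL] := derive_bound_ball_rV r' (sF 1%N).
have [K K0 HK] := @gronwall R N L L0.
exists (Num.max r' (K * r)) => z sz zr t t01.
have xr' s : 0 <= s <= 1 -> `|lsubmx (z s)| <= r'.
  by apply: (Hr' _ (solution_lsubmx sz)); apply: le_trans zr; exact: norm_lsubmx_le.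
have yr : `|rsubmx (z t)| <= K * r.
  apply: le_trans (HK (fun t => rsubmx (z t)) (fun t => 'D_(rsubmx (z t)) F (lsubmx (z t))) 0 (lexx _) _ _ t t01) _.
  - by move=> s _; exact: is_derive_rsubmx.
  - by move=> s s01; rewrite addr0; apply: HL; exact: xr'.
  by rewrite addr0 ler_wpM2l //; apply: le_trans zr; exact: norm_rsubmx_le.
rewrite -(hsubmxK (z t)); apply: norm_row_mx_le.
- by rewrite le_max; apply/orP; left; apply: le_trans (xr' t t01).
- by rewrite le_max xr'.
- by rewrite le_max yr orbT.
Qed.

Lemma is_derive_quadratic (V W : normedModType R) (f : V -> W) (a v : V) (l : W) (C : R) :
  (forall h : R, `|h| <= 1 -> `|f (a + h *: v) - f a - h *: l| <= C * h ^+ 2) ->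
  is_derive a v f l.
Proof.
move=> H.
have C0 : 0 <= C by have := H 1; rewrite normr1 lexx expr1n mulr1 => /(_ isT); apply: le_trans.
have cv : (fun h : R => h^-1 *: ((f \o shift a) (h *: v) - f a)) @ 0^' --> l.
  apply/cvgrPdist_le => e e0.
  have d0 : 0 < Num.min 1 (e / (C + 1)) by rewrite lt_min ltr01 divr_gt0 // ltr_wpDl.
  apply/nbhs_ballP; exists (Num.min 1 (e / (C + 1))) => // h.
  rewrite -ball_normE /= sub0r normrN lt_min => /andP[h1 he] h0.
  have -> : l - h^-1 *: (f (h *: v + a) - f a) = - (h^-1 *: (f (a + h *: v) - f a - h *: l)).
    by rewrite (addrC a) (scalerBr _ (_ - _)) scalerA mulVf // scale1r opprB.
  rewrite normrN normrZ normfV ler_pdivrMl ?normr_gt0 //.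
  apply: le_trans (H h (ltW h1)) _.
  rewrite -real_normK ?num_real // expr2 mulrA mulrC ler_wpM2l //.
  apply: (@le_trans _ _ ((C + 1) * `|h|)); first by rewrite ler_wpM2r // lerDl.
  by rewrite mulrC -ler_pdivlMr ?ltr_wpDl // ltW.
split; first by apply/cvg_ex; exists l.
exact: cvg_lim cv.
Qed.

(** The error [w - x - h *: y] of the linear approximation solves the linearised equation up to a
    source quadratic in [h], by Taylor's formula and the Lipschitz dependence of solutions;
    [gronwall] keeps it quadratic at time 1. *)
Lemma flow1_is_derive N (F : 'rV[R]_N -> 'rV[R]_N) a v : complete_field F ->
  is_derive a v (flow1 F) (rsubmx (flow1 (variational F) (row_mx a v))).
Proof.
move=> cF; have [sF eF bF] := cF; have [dF DF] := (smS _ _ _).1 (sF 1%N).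
have cE := variational_complete cF; have [_ eE _] := cE.
have [z z0 sz] := eE (row_mx a v); rewrite -z0 flow1E //.
have sx := solution_lsubmx sz; have dy := is_derive_rsubmx sz.
have x0 : lsubmx (z 0) = a by rewrite z0 row_mxKl.
have y0 : rsubmx (z 0) = v by rewrite z0 row_mxKr.
pose x t := lsubmx (z t); pose y t := rsubmx (z t).
pose r := `|a| + `|v|.
have [K1 K10 HK1] := solution_dist r cF.
have [r' Hr'] := bF r.
have [K K0 HK] := C2_taylor_ball_rV r' (sF 2).
have [L L0 HL] := derive_bound_ball_rV r' (sF 1%N).
have [G G0 HG] := @gronwall R N L L0.
apply: (@is_derive_quadratic _ _ _ _ _ _ (G * (K * (K1 * `|v|) ^+ 2))) => h h1.
have [w w0 sw] := eF (a + h *: v).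
have ar : `|a| <= r by rewrite lerDl.
have wr : `|w 0| <= r.
  rewrite w0; apply: le_trans (ler_normD _ _) _; rewrite lerD2l normrZ.
  by rewrite ler_piMl.
have xr' s : 0 <= s <= 1 -> `|x s| <= r' by apply: (Hr' _ sx); rewrite x0.
have wr' s : 0 <= s <= 1 -> `|w s| <= r' by apply: (Hr' _ sw).
have wx s : 0 <= s <= 1 -> `|w s - x s| <= K1 * `|v| * `|h|.
  move=> s01; apply: le_trans (HK1 w x sw sx wr _ s s01) _; first by rewrite /x x0.
  by rewrite w0 /x x0 addrAC subrr add0r normrZ (mulrC `|h|) mulrA.
have Ew : flow1 F (a + h *: v) = w 1 by rewrite -w0 flow1E.
have Ex : flow1 F a = x 1 by rewrite -x0 (flow1E cF sx).
rewrite Ew Ex.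
have dd (s : R) : 0 <= s <= 1 -> is_derive s (1 : R) (fun s => w s - x s - h *: y s)
   (F (w s) - F (x s) - h *: 'D_(y s) F (x s)).
  by move=> _; exact: (is_deriveB (is_deriveB (sw s) (sx s)) (@is_deriveZ _ _ _ y h s 1 _ (dy s))).
have := HG _ _ (K * (K1 * `|v| * `|h|) ^+ 2) _ dd _ 1.
rewrite ler01 lexx /= w0 /x x0 /y y0 => H.
have {H} := H _ _ isT.
have E0 : a + h *: v - a - h *: v = 0 by rewrite (addrC a) addrK subrr.
rewrite E0 normr0 add0r => H.
apply: le_trans (H _ _) _.
- by rewrite mulr_ge0 // exprn_ge0 // !mulr_ge0.
- move=> s s01; rewrite -/(x s) -/(y s).
  have -> : F (w s) - F (x s) - h *: 'D_(y s) F (x s) =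
     'D_(w s - x s - h *: y s) F (x s) + (F (w s) - F (x s) - 'D_(w s - x s) F (x s)).
    rewrite (deriveB_dir _ _ (dF _ I)).
    have -> : 'D_(h *: y s) F (x s) = h *: 'D_(y s) F (x s) by rewrite !deriveE ?linearZ //; exact: dF.
    move: ('D_(w s - x s) F (x s)) ('D_(y s) F (x s)) => p q.
    by rewrite [RHS]addrC subrKA.
  apply: le_trans (ler_normD _ _) _; rewrite lerD //; first by apply: HL; exact: xr'.
  apply: le_trans (HK _ _ (wr' s s01) (xr' s s01)) _.
  by rewrite ler_wpM2l // ler_sqr ?nnegrE ?mulr_ge0 // wx.
- by rewrite (exprMn _ _ `|h|) real_normK ?num_real // !mulrA.
Qed.

Lemma sm_row_mx_l k m1 m2 (v : 'rV[R]_m2) : sm k setT (fun a : 'rV[R]_m1 => row_mx a v).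
Proof. by apply: (sm_row_mx openT); [exact: (sm_id k openT)|exact: sm_cst]. Qed.

(** Each derivative of the time-one map is a component of the time-one map of the variational field,
    which is again complete; the induction therefore runs over all dimensions and fields
    together. *)
Lemma flow1_sm k N (F : 'rV[R]_N -> 'rV[R]_N) : complete_field F -> sm k setT (flow1 F).
Proof.
elim: k N F => [|k IH] N F cF; first by move=> x _; exact: flow1_continuous.
have E v : 'D_v (flow1 F) = (fun a => rsubmx (flow1 (variational F) (row_mx a v))).
  by apply/funext => a; have [_ ->] := flow1_is_derive a v cF.
have S v : sm k setT ('D_v (flow1 F)).
  rewrite E; apply: (sm_rsubmx openT).
  apply: (sm_comp_rV openT openT) => //; first exact: IH (variational_complete cF).
  exact: sm_row_mx_l.
split=> // a _; apply/differentiable_mxP => i j.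
have dc v b : derivable (flow1 F) b v by case: (flow1_is_derive b v cF).
apply: (@C1_differentiable _ _ _ setT) => //; first exact: openT.
  by move=> b l _; move/derivable_mxP: (dc (delta_mx 0 l) b); exact.
move=> l; have cD := sm_continuous (S (delta_mx 0 l)) (I : setT a).
have /continuous_mxP/(_ i j) := cD.
rewrite (_ : (fun y => 'D_(delta_mx 0 l) (flow1 F) y i j) = 'D_(delta_mx 0 l) (fun y => flow1 F y i j)) //.
apply/funext => b; have -> := derive_mx (dc (delta_mx 0 l) b).
by rewrite mxE.
Qed.

End Flow.

(** * Inverse functions *)

Lemma continuous_eps {R : realType} (V W : normedModType R) (f : V -> W) (a : V) :
  (forall e : R, 0 < e -> exists2 d : R, 0 < d & forall b, `|a - b| < d -> `|f a - f b| <= e) ->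
  {for a, continuous f}.
Proof.
move=> H; apply/cvgrPdist_le => e /H[d d0 Hd].
by apply/nbhs_ballP; exists d => // b; rewrite -ball_normE /=; exact: Hd.
Qed.

Section InverseFunction.
Context {R : realType} {m : nat}.
Local Notation E := 'rV[R]_m.
Variables (f : E -> E) (U : set E).
Hypothesis sf : smooth setT f.
Hypothesis oU : open U.
Hypothesis injf : forall v w, U v -> U w -> f v = f w -> v = w.
Hypothesis derf : forall w z, U w -> 'D_z f w = 0 -> z = 0.

(** The transpose of the usual Jacobian: its rows are the partial derivatives, so that it acts on
    row vectors from the right. *)
Definition jac (w : E) : 'M[R]_m := \matrix_(i, j) ('D_(delta_mx 0 i) f w) 0 j.

Lemma smooth_differentiable (w : E) : differentiable f w.
Proof. by have [d _] := (smS _ _ _).1 (sf 1%N); exact: d. Qed.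

Lemma derive_jac w z : 'D_z f w = z *m jac w.
Proof.
rewrite derive_sum_coord; last exact: smooth_differentiable.
by apply/rowP => j; rewrite summxE !mxE; apply: eq_bigr => i _; rewrite !mxE.
Qed.

Lemma jac_unit w : U w -> jac w \in unitmx.
Proof.
move=> Uw; rewrite -row_free_unit; apply: inj_row_free => v v0.
by apply: (derf Uw); rewrite derive_jac.
Qed.

Lemma norm_mulmx_le (z : E) (B : 'M[R]_m) : `|z *m B| <= (\sum_i \sum_j `|B i j|) * `|z|.
Proof.
apply: norm_rV_le => [|j]; first by rewrite mulr_ge0 // sumr_ge0 // => i _; rewrite sumr_ge0.
rewrite mxE; apply: le_trans (ler_norm_sum _ _ _) _; rewrite mulr_suml; apply: ler_sum => i _.
rewrite normrM mulrC ler_pM ?norm_coord_le //.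
by rewrite (bigD1 j) //= lerDl sumr_ge0.
Qed.

Lemma mulmx_continuous (B : 'M[R]_m) : continuous (fun z : E => z *m B).
Proof.
move=> z; apply: (@locally_lipschitz_continuous _ _ _ _ _ (\sum_i \sum_j `|B i j|)) => b _.
by rewrite -mulmxBl norm_mulmx_le.
Qed.

(** A differentiable substitute for the squared sup norm of [f w - y], to be minimised in [w]. *)
Let sqdist (y w : E) : R := \sum_i (f w 0 i - y 0 i) ^+ 2.

Lemma norm_sq_le_sqdist y w : `|f w - y| ^+ 2 <= sqdist y w.
Proof.
have q0 : 0 <= sqdist y w by apply: sumr_ge0 => i _; exact: sqr_ge0.
rewrite -(sqr_sqrtr q0) ler_sqr ?nnegrE ?sqrtr_ge0 //.
apply: norm_rV_le => [|j]; first exact: sqrtr_ge0.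
rewrite -sqrtr_sqr; apply: ler_wsqrtr; rewrite /sqdist (bigD1 j) //= !mxE lerDl.
by apply: sumr_ge0 => k _; exact: sqr_ge0.
Qed.

Lemma sqdist_le_norm_sq y w : sqdist y w <= m%:R * `|f w - y| ^+ 2.
Proof.
apply: (@le_trans _ _ (\sum_(j < m) `|f w - y| ^+ 2)).
  apply: ler_sum => j _; rewrite -real_normK ?num_real // ler_sqr ?nnegrE //.
  by have := norm_coord_le (f w - y) j; rewrite !mxE.
by rewrite sumr_const card_ord mulr_natl.
Qed.

Lemma is_derive_sqdist y w z (s : R) :
  is_derive s (1 : R) (fun s => sqdist y (w + s *: z))
    (\sum_i 2 * (f (w + s *: z) 0 i - y 0 i) * ('D_z f (w + s *: z)) 0 i).
Proof.
rewrite (_ : (fun s => _) = \sum_i (fun s => (f (w + s *: z) 0 i - y 0 i) ^+ 2)); last by apply/funext => u; rewrite fct_sumE.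
apply: is_derive_sum => i.
have H : is_derive s (1 : R) (fun s => f (w + s *: z) 0 i - y 0 i) ('D_z f (w + s *: z) 0 i).
  have dz : derivable f (w + s *: z) z by apply: diff_derivable; exact: smooth_differentiable.
  have := @is_derive_line _ _ _ f w z s dz.
  move=> /is_derive_mxP /(_ 0 i) H; have := is_deriveB H (is_derive_cst (y 0 i) s (1 : R)).
  by rewrite subr0.
have H2 := @is_deriveM R R _ _ s 1 _ _ H H.
apply: is_derive_eq H2 _.
move: (f (w + s *: z) 0 i - y 0 i) ('D_z f (w + s *: z) 0 i) => a b.
by transitivity (a * b + a * b) => //; ring.
Qed.

(** The squared distance to [y] is minimised on a closed cube around [w0]. Injectivity keeps [f]
    away from [f w0] on the boundary, so for [y] close to [f w0] the minimum is interior, hence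
    critical, and an invertible Jacobian forces it to be 0. *)
Lemma local_surjectivity w0 (e : R) : U w0 -> 0 < e ->
  exists2 d : R, 0 < d & forall y, `|y - f w0| < d ->
    exists w, [/\ U w, `|w - w0| < e & f w = y].
Proof.
move=> Uw0 e0.
have [r0 r00 Hr0] : exists2 r : R, 0 < r & forall w, `|w - w0| < r -> U w.
  have : nbhs w0 U by exact: open_nbhs_nbhs.
  move=> /nbhs_ballP[r /= r0 Hr]; exists r => // w wr; apply: Hr.
  by rewrite -ball_normE /= distrC.
pose r := Num.min r0 e / 2.
have m0 : 0 < Num.min r0 e by rewrite lt_min r00.
have rpos : 0 < r by rewrite divr_gt0.
have rlt : r < Num.min r0 e by rewrite /r ltr_pdivrMr // ltr_pMr // ltr1n.
have rr0 : r < r0 by apply: lt_le_trans rlt _; rewrite ge_min lexx.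
have re : r < e by apply: lt_le_trans rlt _; rewrite ge_min lexx orbT.
pose K := [set v : E | forall i, `[w0 0 i - r, w0 0 i + r]%classic (v ord0 i)].
have KP v : K v <-> `|v - w0| <= r.
  split=> [Kv|vr i].
    apply: norm_rV_le => [|i]; first exact: ltW.
    by rewrite !mxE ler_distl; have := Kv i; rewrite /= in_itv /=.
  rewrite /= in_itv /= -ler_distl; apply: le_trans vr.
  by have := norm_coord_le (v - w0) i; rewrite !mxE.
have cK : compact K by apply: (@rV_compact R m (fun i => `[w0 0 i - r, w0 0 i + r]%classic)) => i; exact: segment_compact.
have Kw0 : K w0 by apply/KP; rewrite subrr normr0 ltW.
have KU v : K v -> U v by move/KP => vr; apply: Hr0; apply: le_lt_trans rr0.
have csq y : continuous (sqdist y).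
  move=> w; suff : sm 0 setT (sqdist y) by move=> H; exact: (H w I).
  apply: sm_sum => [|i _]; first exact: openT.
  apply: sm_eq (smM openT (smB openT ((sm_mxP openT 0 f).1 (sf 0%N) 0 i) (sm_cst 0 setT (y 0 i)))
                          (smB openT ((sm_mxP openT 0 f).1 (sf 0%N) 0 i) (sm_cst 0 setT (y 0 i)))) => x.
  by rewrite expr2.
pose S := [set v : E | K v /\ `|v - w0| = r].
have [d d0 Hd] : exists2 d : R, 0 < d & forall v, S v -> d <= `|f v - f w0|.
  (* The boundary of the cube is empty when [m = 0]; any positive [d] then works. *)
  have [[s Ss]|nS] := pselect (exists s, S s); last by exists 1 => // v Sv; exfalso; apply: nS; exists v.
  have cS : compact S.
    rewrite (_ : S = K `&` [set v | `|v - w0| = r]); last by [].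
    apply: compact_closedI => //.
    have cn : continuous (fun v : E => `|v - w0|).
      move=> v; apply: (@continuous_comp _ _ _ (fun v : E => v - w0) (fun z => `|z|)); last exact: norm_continuous.
      by apply: (@continuousB _ _ _ id (fun=> w0)); [exact: cvg_id|exact: cst_continuous].
    rewrite (_ : [set v | _] = (fun v : E => `|v - w0|) @^-1` [set r]); last by [].
    by apply: preimage_closed => //; exact: closed_eq.
  have [|c cS' Hc] := @EVT_min_rV R m (fun v => `|f v - f w0|) S (ex_intro _ s Ss) cS.
    apply: continuous_subspaceT => v.
    apply: (@continuous_comp _ _ _ (fun v : E => f v - f w0) (fun z => `|z|)); last exact: norm_continuous.
    apply: (@continuousB _ _ _ f (fun=> f w0)); last exact: cst_continuous.
    exact: differentiable_continuous (smooth_differentiable v).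
  exists `|f c - f w0|; last by move=> v Sv; apply: Hc; rewrite inE.
  rewrite normr_gt0 subr_eq0; apply/eqP => fc.
  move: cS'; rewrite inE => -[Kc cr].
  have E : c = w0 by apply: injf => //; exact: KU.
  by move: cr; rewrite E subrr normr0 => r0'; move: rpos; rewrite -r0' ltxx.
(* The margin pays for the factor [m] between the two norms: with [D] this radius, a boundary
   minimum would give [(D (m + 1))^2 <= m D^2]. *)
exists (d / (m%:R + 2)); first by rewrite divr_gt0 // ltr_wpDl.
move=> y yd.
have [w Kw Hw] := @EVT_min_rV R m (sqdist y) K (ex_intro _ w0 Kw0) cK (continuous_subspaceT (csq y)).
move: Kw; rewrite inE => Kw.
have le0 : sqdist y w <= sqdist y w0 by apply: Hw; rewrite inE.
set D := d / (m%:R + 2) in yd.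
have m2 : 0 < (m%:R : R) + 2 by rewrite ltr_wpDl.
have dD : d = D * (m%:R + 2) by rewrite /D divfK // gt_eqF.
have D0 : 0 < D by rewrite divr_gt0.
clearbody D.
have wr : `|w - w0| < r.
  rewrite lt_neqAle; apply/andP; split; last by apply/KP.
  apply/eqP => wr; have dw := Hd w (conj Kw wr).
  have : (D * (m%:R + 1)) ^+ 2 <= m%:R * D ^+ 2.
    apply: (@le_trans _ _ (sqdist y w)).
      apply: le_trans (norm_sq_le_sqdist y w); rewrite ler_sqr ?nnegrE ?mulr_ge0 ?addr_ge0 ?(ltW D0) //.
      have : `|f w - f w0| <= `|f w - y| + `|y - f w0| by rewrite -{1}(subrKA y) ler_normD.
      by move: yd dw; rewrite {1}dD; lra.
    apply: le_trans le0 _; apply: le_trans (sqdist_le_norm_sq y w0) _.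
    by rewrite ler_wpM2l // ler_sqr ?nnegrE ?(ltW D0) // distrC ltW.
  have mm : 0 <= (m%:R : R) by [].
  by rewrite exprMn; have := exprn_gt0 2 D0; move: (D ^+ 2) (m%:R : R) mm => q n n0 q0; nra.
exists w; split; [exact: KU|exact: lt_trans re|].
have crit z : \sum_i 2 * (f w 0 i - y 0 i) * ('D_z f w) 0 i = 0.
  have [s0 s00 Hs] : exists2 s0 : R, 0 < s0 & forall s : R, `|s| < s0 -> K (w + s *: z).
    have z1 : 0 < `|z| + 1 by apply: ltr_wpDl.
    exists ((r - `|w - w0|) / (`|z| + 1)); first by rewrite divr_gt0 // subr_gt0.
    move=> s; rewrite (ltr_pdivlMr _ _ z1) => sz; apply/KP.
    rewrite addrAC; apply: le_trans (ler_normD _ _) _; rewrite -lerBrDl normrZ.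
    by apply: le_trans (ltW sz); rewrite ler_wpM2l // lerDl.
  have D' (t : R) : is_derive t (1 : R) (fun s => sqdist y (w + s *: z)) _ := is_derive_sqdist y w z t.
  have := @derive1_at_min R (fun s => sqdist y (w + s *: z)) (- s0) s0 0.
  have ii : (0 : R) \in `]- s0, s0[%R by rewrite in_itv /= oppr_lt0 s00.
  move=> /(_ _ _ ii) [].
  - by rewrite ltW // (lt_trans _ s00) // oppr_lt0.
  - by move=> t _; case: (D' t).
  - move=> t; rewrite in_itv /= => /andP[t1 t2]; rewrite scale0r addr0; apply: Hw.
    by rewrite inE; apply: Hs; rewrite ltr_norml t1.
  - by move=> _; case: (D' 0) => _ ->; rewrite scale0r addr0.
(* In this direction [f] varies at first order by [f w - y] itself, so the derivative of [sqdist] is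
   twice its value. *)
have := crit ((f w - y) *m invmx (jac w)).
rewrite derive_jac mulmxKV; last by apply: jac_unit; exact: KU.
move=> H0; have {H0} : sqdist y w = 0.
  have {H0} : 2 * sqdist y w = 0.
    by rewrite -[RHS]H0 /sqdist mulr_sumr; apply: eq_bigr => i _; rewrite !mxE expr2 mulrA.
  by move/eqP; rewrite mulf_eq0 pnatr_eq0 /= => /eqP.
move=> s0; have := norm_sq_le_sqdist y w; rewrite s0.
by rewrite exprn_even_le0 //= normr_eq0 subr_eq0 => /eqP.
Qed.

Lemma open_image : open (f @` U).
Proof.
rewrite openE => _ [w Uw <-].
have [d d0 Hd] := local_surjectivity Uw ltr01.
apply/nbhs_ballP; exists d => // y; rewrite -ball_normE /= distrC => /Hd[v [Uv _ <-]].
by exists v.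
Qed.

Variable g : E -> E.
Hypothesis gf : forall w, U w -> g (f w) = w.

Lemma inverse_continuous w : U w -> {for f w, continuous g}.
Proof.
move=> Uw; apply: continuous_eps => e e0.
have [d d0 Hd] := local_surjectivity Uw e0.
exists d => // y; rewrite distrC => /Hd[v [Uv vw <-]].
by rewrite !gf // distrC ltW.
Qed.

Lemma inverse_differentiable w : U w ->
  differentiable g (f w) /\ forall v, 'D_v g (f w) = v *m invmx (jac w).
Proof.
move=> Uw; set B := invmx (jac w); set C := \sum_i \sum_j `|B i j|.
have C0 : 0 <= C by apply: sumr_ge0 => i _; exact: sumr_ge0.
have cL : continuous (mulmxr B : E -> E) by exact: mulmx_continuous.
suff H : forall e : R, 0 < e -> \forall h \near (0 : E), `|g (h + f w) - g (f w) - mulmxr B h| <= e * `|h|.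
  have [dg Dg] := differentiable_eps cL H; split => // v.
  by rewrite deriveE // Dg.
move=> e e0.
(* The first bound lets [|k|] be absorbed and gives [|k| <= 2 C |h|]; the second one then brings the
   error under [e |h|]. *)
pose e' := Num.min (2 * (C + 1))^-1 (e / (2 * (C + 1) ^+ 2)).
have C1 : 0 < C + 1 by rewrite ltr_wpDl.
have e'0 : 0 < e' by rewrite lt_min invr_gt0 mulr_gt0 // divr_gt0 // mulr_gt0 // exprn_gt0.
have [d1 d10 Hd1] : exists2 d : R, 0 < d & forall k, `|k| < d -> `|f (k + w) - f w - 'D_k f w| <= e' * `|k|.
  have := differentiable_epsE (smooth_differentiable w) e'0.
  move=> /nbhs_ballP[d /= d0 Hd]; exists d => // k kd.
  rewrite deriveE; last exact: smooth_differentiable.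
  by apply: Hd; rewrite -ball_normE /= sub0r normrN.
have [d d0 Hd] := local_surjectivity Uw d10.
apply/nbhs_ballP; exists d => // h; rewrite -ball_normE /= sub0r normrN => hd.
have [v [Uv vw fv]] : exists v, [/\ U v, `|v - w| < d1 & f v = h + f w] by apply: Hd; rewrite addrK.
rewrite -fv !gf //.
have := Hd1 (v - w) vw; rewrite subrK fv addrK derive_jac.
set k := v - w => Hk.
have kE : k - h *m B = - ((h - k *m jac w) *m B).
  by rewrite mulmxBl mulmxK ?opprB //; exact: jac_unit.
have H1 : `|k - h *m B| <= C * (e' * `|k|).
  rewrite kE normrN; apply: le_trans (norm_mulmx_le _ _) _; by rewrite ler_wpM2l.
have hB : `|h *m B| <= C * `|h| by exact: norm_mulmx_le.
have e'1 : e' <= (2 * (C + 1))^-1 by rewrite ge_min lexx.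
have e'2 : e' <= e / (2 * (C + 1) ^+ 2) by rewrite ge_min lexx orbT.
have Ce : C * e' <= 2^-1.
  apply: (@le_trans _ _ ((C + 1) * (2 * (C + 1))^-1)).
    by apply: ler_pM => //; [exact: ltW|rewrite lerDl].
  by rewrite invfM mulrCA mulfV ?mulr1 // gt_eqF.
have k2 : `|k| <= 2 * (C * `|h|).
  have : `|k| <= `|k - h *m B| + `|h *m B| by rewrite -{1}(subrK (h *m B) k) ler_normD.
  have : C * (e' * `|k|) <= 2^-1 * `|k| by rewrite mulrA ler_wpM2r.
  by move: H1 hB; move: `|k - h *m B| `|h *m B| => p q; lra.
apply: le_trans H1 _; apply: (@le_trans _ _ (C * (e / (2 * (C + 1) ^+ 2) * (2 * (C * `|h|))))).
  by rewrite ler_wpM2l // ler_pM // ltW.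
have -> : C * (e / (2 * (C + 1) ^+ 2) * (2 * (C * `|h|))) = (C ^+ 2 / (C + 1) ^+ 2) * (e * `|h|).
  by field; rewrite gt_eqF.
rewrite ler_piMl //; first by rewrite mulr_ge0 // ltW.
by rewrite ler_pdivrMr ?exprn_gt0 // mul1r ler_sqr ?nnegrE ?(ltW C1) // lerDl.
Qed.

(** Bootstrapping: the derivative of [g] is the inverse Jacobian of [f] composed with [g], hence as
    regular as [g]. *)
Lemma inverse_smooth : smooth (f @` U) g.
Proof.
elim=> [|k IH].
  by move=> _ [w Uw <-]; exact: inverse_continuous.
split=> [_ [w Uw <-]|v]; first by have [] := inverse_differentiable Uw.
have oV := open_image.
have S : sm k (f @` U) (fun y => v *m invmx (jac (g y))).
  apply/(sm_mxP oV) => i j.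
  apply: (@sm_eq _ _ _ _ _ (fun y => \sum_l v i l * invmx (jac (g y)) l j)); first by move=> y; rewrite mxE.
  apply: sm_sum => // l _; apply: smM => //; first exact: sm_cst.
  apply: sm_invmx => // [a b|_ [w Uw <-]]; last by rewrite gf //; exact: jac_unit.
  have [_ Df] := (smS _ _ _).1 (sf k.+1).
  have := @sm_comp _ _ _ oV k m setT (fun w => ('D_(delta_mx 0 a) f w) 0 b) g openT (fun _ _ => I) ((sm_mxP openT k _).1 (Df _) 0 b) IH.
  by apply: sm_eq => y; rewrite mxE.
apply: sm_ext S => // _ [w Uw <-].
by have [_ ->] := inverse_differentiable Uw; rewrite gf.
Qed.

End InverseFunction.

(** * Positive definite forms *)

Section BilinearForms.
Context {R : realType}.

Definition bf {m} (A : 'M[R]_m) (w z : 'rV[R]_m) : R := (w *m A *m z^T) 0 0.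

Section Fixed.
Context {m : nat}.
Implicit Types (A B : 'M[R]_m) (w z : 'rV[R]_m).

Lemma quadfE A w : quadf A w = bf A w w. Proof. by []. Qed.

Lemma bfE A w z : bf A w z = \sum_i \sum_j A i j * (w 0 i * z 0 j).
Proof.
rewrite /bf mxE exchange_big /=; apply: eq_bigr => j _.
rewrite !mxE mulr_suml; apply: eq_bigr => i _; ring.
Qed.

Lemma bfDl A w1 w2 z : bf A (w1 + w2) z = bf A w1 z + bf A w2 z.
Proof. by rewrite /bf !mulmxDl mxE. Qed.
Lemma bfDr A w z1 z2 : bf A w (z1 + z2) = bf A w z1 + bf A w z2.
Proof. by rewrite /bf linearD mulmxDr mxE. Qed.
Lemma bfZl A a w z : bf A (a *: w) z = a * bf A w z.
Proof. by rewrite /bf -!scalemxAl mxE. Qed.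
Lemma bfZr A a w z : bf A w (a *: z) = a * bf A w z.
Proof. by rewrite /bf linearZ -scalemxAr mxE. Qed.
Lemma bfNl A w z : bf A (- w) z = - bf A w z.
Proof. by rewrite -scaleN1r bfZl mulN1r. Qed.
Lemma bfNr A w z : bf A w (- z) = - bf A w z.
Proof. by rewrite -scaleN1r bfZr mulN1r. Qed.
Lemma bfBl A w1 w2 z : bf A (w1 - w2) z = bf A w1 z - bf A w2 z.
Proof. by rewrite bfDl bfNl. Qed.
Lemma bfBr A w z1 z2 : bf A w (z1 - z2) = bf A w z1 - bf A w z2.
Proof. by rewrite bfDr bfNr. Qed.
Lemma bf0l A z : bf A 0 z = 0. Proof. by rewrite /bf !mul0mx mxE. Qed.
Lemma bf0r A w : bf A w 0 = 0. Proof. by rewrite /bf trmx0 mulmx0 mxE. Qed.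
Lemma bfDm A B w z : bf (A + B) w z = bf A w z + bf B w z.
Proof. by rewrite /bf mulmxDr mulmxDl mxE. Qed.
Lemma bfZm A a w z : bf (a *: A) w z = a * bf A w z.
Proof. by rewrite /bf -scalemxAr -scalemxAl mxE. Qed.
Lemma bfBm A B w z : bf (A - B) w z = bf A w z - bf B w z.
Proof. by rewrite bfDm -scaleN1r bfZm mulN1r. Qed.
Lemma bfC A w z : A^T = A -> bf A w z = bf A z w.
Proof.
move=> sA; have E : (w *m A *m z^T)^T = z *m A *m w^T by rewrite !trmx_mul trmxK sA mulmxA.
by rewrite /bf -E [RHS]mxE.
Qed.

Lemma quadfD A w z : A^T = A -> quadf A (w + z) = quadf A w + 2 * bf A w z + quadf A z.
Proof. by move=> sA; rewrite !quadfE bfDl !bfDr (bfC z w sA); ring. Qed.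
Lemma quadfZ A a w : quadf A (a *: w) = a ^+ 2 * quadf A w.
Proof. by rewrite !quadfE bfZl bfZr mulrA expr2. Qed.
Lemma quadfN A w : quadf A (- w) = quadf A w.
Proof. by rewrite -scaleN1r quadfZ sqrrN expr1n mul1r. Qed.
Lemma quadfB A w z : A^T = A -> quadf A (w - z) = quadf A w - 2 * bf A w z + quadf A z.
Proof. by move=> sA; rewrite quadfD // quadfN bfNr mulrN. Qed.
Lemma quadf0 A : quadf A 0 = 0. Proof. exact: bf0l. Qed.

Lemma bf_cauchy A w z : A^T = A -> (forall x, 0 <= quadf A x) ->
  bf A w z ^+ 2 <= quadf A w * quadf A z.
Proof.
move=> sA pA; set b := bf A w z.
have H (a c : R) : 0 <= a ^+ 2 * quadf A w - 2 * (a * c * b) + c ^+ 2 * quadf A z.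
  have := pA (a *: w - c *: z); rewrite quadfB // !quadfZ bfZl bfZr -/b.
  by rewrite (mulrA a c b).
have [z0|zN0] := eqVneq (quadf A z) 0.
  suff -> : b = 0 by rewrite expr0n /= z0 mulr0.
  (* With [quadf A z = 0], this choice of coefficients makes [H] read
     [0 <= - b ^+ 2 * (quadf A w + 2)]. *)
  apply/eqP/negPn/negP => b0; have := H b (quadf A w + 1); rewrite z0.
  have b2 : 0 < b ^+ 2 by rewrite lt_def sqrf_eq0 b0 sqr_ge0.
  have := pA w; move: (quadf A w) b2 => q; rewrite !expr2 => b2 q0.
  by nra.
have zp : 0 < quadf A z by rewrite lt_def zN0 pA.
have := H (quadf A z) b; move: zp; move: (quadf A z) (quadf A w) => q p q0 HH.
rewrite -subr_ge0 -(pmulr_rge0 _ q0).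
by move: HH; congr (0 <= _); ring.
Qed.

Definition normq A w := Num.sqrt (quadf A w).

Lemma normq_ge0 A w : 0 <= normq A w. Proof. exact: sqrtr_ge0. Qed.

Section Posdef.
Variable A : 'M[R]_m.
Hypotheses (sA : A^T = A) (pA : posdefmx A).

Lemma posdef_ge0 w : 0 <= quadf A w.
Proof. by have [->|/pA/ltW//] := eqVneq w 0; rewrite quadf0. Qed.

Lemma normq_sqr w : normq A w ^+ 2 = quadf A w.
Proof. by rewrite sqr_sqrtr ?posdef_ge0. Qed.

Lemma bf_le w z : `|bf A w z| <= normq A w * normq A z.
Proof.
rewrite -(@ler_sqr R) ?nnegrE ?mulr_ge0 ?normq_ge0 // exprMn !normq_sqr real_normK ?num_real //.
exact: bf_cauchy posdef_ge0.
Qed.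

Lemma normqD w z : normq A (w + z) <= normq A w + normq A z.
Proof.
rewrite -(@ler_sqr R) ?nnegrE ?addr_ge0 ?normq_ge0 // normq_sqr quadfD // sqrrD !normq_sqr.
rewrite lerD2r lerD2l mulr2n; have := le_trans (ler_norm _) (bf_le w z); lra.
Qed.

Lemma normqZ a w : normq A (a *: w) = `|a| * normq A w.
Proof. by rewrite /normq quadfZ sqrtrM ?sqr_ge0 // sqrtr_sqr. Qed.

Lemma normqN w : normq A (- w) = normq A w.
Proof. by rewrite /normq quadfN. Qed.

Lemma normq0 : normq A 0 = 0.
Proof. by rewrite /normq quadf0 sqrtr0. Qed.

Lemma normq_gt0 w : w != 0 -> 0 < normq A w.
Proof. by move=> /pA; rewrite sqrtr_gt0. Qed.

(** Polarisation is applied to [b *: w] and [a *: z], which have the same length for [A]; the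
    parallelogram law then passes from quadratic to bilinear form without loss in the constant. *)
Lemma bf_le_of_quadf S (c : R) w z : S^T = S -> 0 <= c ->
  (forall x, `|quadf S x| <= c * quadf A x) ->
  `|bf S w z| <= c * (normq A w * normq A z).
Proof.
move=> sS c0 H.
have [->|w0] := eqVneq w 0; first by rewrite bf0l normr0 !mulr_ge0 ?normq_ge0.
have [->|z0] := eqVneq z 0; first by rewrite bf0r normr0 !mulr_ge0 ?normq_ge0.
have a0 := normq_gt0 w0; have b0 := normq_gt0 z0.
set a := normq A w in a0 *; set b := normq A z in b0 *.
have par : quadf A (b *: w + a *: z) + quadf A (b *: w - a *: z) = 4 * (a * b) ^+ 2.
  rewrite quadfD // quadfB // !quadfZ -!normq_sqr -/a -/b; ring.
have pol : 4 * (a * b) * bf S w z = quadf S (b *: w + a *: z) - quadf S (b *: w - a *: z).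
  by rewrite quadfD // quadfB // !quadfZ bfZl bfZr; ring.
have ab0 : 0 < a * b by rewrite mulr_gt0.
have : 4 * (a * b) * `|bf S w z| <= 4 * (a * b) * (c * (a * b)).
  have -> : 4 * (a * b) * `|bf S w z| = `|4 * (a * b) * bf S w z|.
    by rewrite normrM ger0_norm // mulr_ge0 // ltW.
  rewrite pol; apply: le_trans (ler_normB _ _) _; apply: le_trans (lerD (H _) (H _)) _.
  by rewrite -mulrDr par le_eqVlt; apply/orP; left; apply/eqP; ring.
by rewrite ler_pM2l // mulr_gt0.
Qed.

Lemma posdef_unitmx : A \in unitmx.
Proof.
rewrite -row_free_unit; apply: inj_row_free => v v0; apply/eqP/negPn/negP => /pA.
by rewrite quadfE /bf v0 mul0mx mxE ltxx.
Qed.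

Lemma invmx_sym : (invmx A)^T = invmx A.
Proof. by rewrite trmx_inv sA. Qed.

Lemma quadf_invmx w : quadf (invmx A) w = quadf A (w *m invmx A).
Proof.
rewrite !quadfE /bf trmx_mul invmx_sym !mulmxA mulmxKV ?posdef_unitmx //.
Qed.

Lemma posdef_invmx : posdefmx (invmx A).
Proof.
move=> w w0; rewrite quadf_invmx; apply: pA; apply: contra w0 => /eqP E.
by rewrite -(mulmxKV posdef_unitmx w) E mul0mx.
Qed.

Lemma dotp_bf w z : dotp w z = bf A w (z *m invmx A).
Proof.
rewrite /bf trmx_mul invmx_sym mulmxA mulmxK ?posdef_unitmx // mxE.
by apply: eq_bigr => i _; rewrite !mxE.
Qed.

Lemma dotp_le w z : dotp w z ^+ 2 <= quadf A w * quadf (invmx A) z.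
Proof. by rewrite dotp_bf quadf_invmx; apply: bf_cauchy => //; exact: posdef_ge0. Qed.

End Posdef.
End Fixed.

(** Gaussian elimination of the first coordinate leaves the Schur complement [D'], again symmetric
    and positive definite. The rows of [B] form an orthonormal frame for [A]. *)
Lemma cholesky n (A : 'M[R]_n) : A^T = A -> posdefmx A -> exists B : 'M[R]_n, B *m A *m B^T = 1%:M.
Proof.
elim: n A => [|n IH] A sA pA; first by exists 0; apply/matrixP => -[].
rewrite -[n.+1]/(1 + n)%N in A sA pA *.
pose a := A 0 0; pose b := ursubmx A; pose D := drsubmx A.
have ul : ulsubmx A = a%:M.
  apply/matrixP => i j; rewrite !mxE (ord1 i) (ord1 j) eqxx mulr1n /a; congr (A _ _); exact/val_inj.
have bt : dlsubmx A = b^T by rewrite -[in LHS]sA -trmx_ursub.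
have sD : D^T = D by rewrite /D trmx_drsub sA.
have EA : A = block_mx a%:M b b^T D by rewrite -ul -bt submxK.
have a0 : 0 < a.
  have := pA (delta_mx 0 0); rewrite quadfE bfE => /(_ _).
  rewrite (bigD1 0) //= (bigD1 0) //= !mxE eqxx !mulr1 big1 ?addr0 => [|j j0]; last first.
    by rewrite !mxE (negbTE j0) andbF !mulr0.
  rewrite big1 ?addr0 => [|i i0]; last first.
    by rewrite big1 // => j _; rewrite !mxE (negbTE i0) andbF mul0r mulr0.
  apply; apply/eqP => /matrixP/(_ 0 0); rewrite !mxE !eqxx => /eqP; by rewrite oner_eq0.
pose P : 'M[R]_(1 + n) := block_mx 1%:M 0 (- a^-1 *: b^T) 1%:M.
pose D' := D - a^-1 *: (b^T *m b).
have PAP : P *m A *m P^T = block_mx a%:M 0 0 D'.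
  rewrite EA /P tr_block_mx !mulmx_block !mul1mx !mul0mx !addr0 ?trmx1 ?trmx0.
  rewrite !mulmx1 !mulmx0 !addr0 linearZ /= trmxK.
  have E1 : - a^-1 *: b^T *m a%:M + b^T = 0.
    by rewrite mul_mx_scalar scalerA mulrN mulfV ?gt_eqF // scaleN1r addNr.
  have E2 : a%:M *m (- a^-1 *: b) + b = 0.
    by rewrite mul_scalar_mx scalerA mulrN mulfV ?gt_eqF // scaleN1r addNr.
  by rewrite E1 E2 mul0mx add0r -scalemxAl scaleNr addrC.
have sD' : D'^T = D'.
  by rewrite /D' linearB /= linearZ /= trmx_mul trmxK sD.
have pD' : posdefmx D'.
  move=> w w0; pose x : 'rV[R]_(1 + n) := row_mx 0 w.
  have x0 : x *m P != 0.
    rewrite mul_row_block !mul0mx mulmx1 !add0r; apply: contra w0 => /eqP.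
    by rewrite -[0]row_mx0 => /eq_row_mx[_ ->].
  have E : x *m P *m A *m (x *m P)^T = x *m (P *m A *m P^T) *m x^T by rewrite trmx_mul !mulmxA.
  have := pA _ x0; rewrite quadfE /bf E PAP.
  rewrite /x mul_row_block !mul0mx mulmx0 !add0r tr_row_mx mul_row_col mul0mx add0r.
  by [].
have [B' HB'] := IH D' sD' pD'.
pose s := Num.sqrt a.
have s0 : s != 0 by rewrite sqrtr_eq0 -ltNge.
exists (block_mx s^-1%:M 0 0 B' *m P).
set Q := block_mx _ _ _ _.
have -> : Q *m P *m A *m (Q *m P)^T = Q *m (P *m A *m P^T) *m Q^T by rewrite trmx_mul !mulmxA.
rewrite PAP /Q.
rewrite tr_block_mx !mulmx_block !trmx0 !mulmx0 ?mul0mx ?addr0 ?add0r ?mulmx0 ?mul0mx ?addr0 ?add0r HB' tr_scalar_mx.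
rewrite -!scalar_mxM; have -> : s^-1 * a * s^-1 = 1; last by rewrite -scalar_mx_block.
by rewrite -(sqr_sqrtr (ltW a0)) -/s; field.
Qed.

(** The trace is the sum of the squared lengths of the rows of [T], so the Cauchy-Schwarz inequality
    is used once for [x] and once for each row. *)
Lemma frobenius_cauchy N (T : 'M[R]_N) (x y : 'rV[R]_N) :
  ((x *m T *m y^T) 0 0) ^+ 2 <= dotp x x * dotp y y * \tr (T *m T^T).
Proof.
have sI : (1%:M : 'M[R]_N)^T = 1%:M by rewrite trmx1.
have b1 (u v : 'rV[R]_N) : bf 1%:M u v = dotp u v.
  by rewrite /bf mulmx1 mxE; apply: eq_bigr => i _; rewrite mxE.
have pI (u : 'rV[R]_N) : 0 <= quadf 1%:M u.
  by rewrite quadfE b1; apply: sumr_ge0 => i _; rewrite -expr2 sqr_ge0.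
have cs (u v : 'rV[R]_N) : dotp u v ^+ 2 <= dotp u u * dotp v v.
  by rewrite -!b1; exact: bf_cauchy.
have -> : (x *m T *m y^T) 0 0 = dotp x (y *m T^T).
  rewrite -mulmxA mxE; apply: eq_bigr => i _; congr (_ * _).
  by rewrite -(trmxK T) -trmx_mul mxE trmxK.
apply: le_trans (cs _ _) _; rewrite -mulrA ler_wpM2l //; first by rewrite -b1; exact: pI.
rewrite mulr_sumr; apply: ler_sum => i _.
have -> : (y *m T^T) 0 i * (y *m T^T) 0 i = dotp y (row i T) ^+ 2.
  by rewrite expr2; congr (_ * _); rewrite mxE; apply: eq_bigr => j _; rewrite !mxE.
apply: le_trans (cs _ _) _; rewrite le_eqVlt; apply/orP; left; apply/eqP; congr (_ * _).
by rewrite mxE; apply: eq_bigr => j _; rewrite !mxE.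
Qed.

(* In a frame B with B K B^T = 1 the trace becomes the sum of the squares of
   the components of the tensor. *)
Lemma curvature_form_le n (K : 'M[R]_n) (S : 'M[R]_(n * n)) (w z : 'rV[R]_n) :
  K^T = K -> posdefmx K -> S^T = S ->
  \tr (S *m (invmx K *t invmx K) *m (S *m (invmx K *t invmx K))) <= 1 ->
  `|((w *t w) *m S *m (z *t z)^T) (mxtens_index (0, 0)) (mxtens_index (0, 0))| <= quadf K w * quadf K z.
Proof.
move=> sK pK sS trS.
have [B HB] := cholesky sK pK.
have uB : B \in unitmx.
  have : B *m (K *m B^T) = 1%:M by rewrite mulmxA.
  by case/mulmx1_unit.
have BK : B^T *m B = invmx K.
  have E1 : K *m B^T = invmx B by rewrite -[LHS](mulKmx uB) (mulmxA B) HB mulmx1.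
  have E2 : K *m (B^T *m B) = 1%:M by rewrite mulmxA E1 mulVmx.
  by rewrite -[LHS](mulKmx (posdef_unitmx pK)) E2 mulmx1.
have ww (x : 'rV[R]_n) : x = (x *m invmx B) *m B by rewrite mulmxKV.
have dK (x : 'rV[R]_n) : dotp (x *m invmx B) (x *m invmx B) = quadf K x.
  rewrite [in RHS](ww x) quadfE /bf; move: (x *m invmx B) => y.
  have -> : y *m B *m K *m (y *m B)^T = y *m (B *m K *m B^T) *m y^T by rewrite trmx_mul !mulmxA.
  by rewrite HB mulmx1 mxE; apply: eq_bigr => i _; rewrite mxE.
pose T := (B *t B) *m S *m (B *t B)^T.
have trT : \tr (T *m T^T) <= 1.
  apply: le_trans trS; rewrite le_eqVlt; apply/orP; left; apply/eqP.
  have -> : T^T = T by rewrite /T !trmx_mul trmxK sS mulmxA.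
  rewrite -BK -tensmx_mul -trmx_tens /T.
  by rewrite -!mulmxA mxtrace_mulC -!mulmxA.
have E : (w *t w) *m S *m (z *t z)^T =
   ((w *m invmx B) *t (w *m invmx B)) *m T *m ((z *m invmx B) *t (z *m invmx B))^T.
  rewrite {1 2}(ww w) {1 2}(ww z) -tensmx_mul -[X in X^T](tensmx_mul (z *m invmx B)) trmx_mul /T.
  by rewrite !mulmxA.
rewrite E.
have dt (x : 'rV[R]_n) : dotp (x *t x : 'rV[R]_(n * n)) (x *t x) = dotp x x ^+ 2.
  rewrite /dotp expr2 mulr_sum; apply: eq_bigr => k _; rewrite !mxE !ord1; ring.
have := frobenius_cauchy T ((w *m invmx B) *t (w *m invmx B) : 'rV[R]_(n * n)) ((z *m invmx B) *t (z *m invmx B) : 'rV[R]_(n * n)).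
rewrite !dt !dK => H.
rewrite -(@ler_sqr R) ?nnegrE ?mulr_ge0 ?posdef_ge0 // real_normK ?num_real //.
have -> : (mxtens_index (0, 0) : 'I_(1 * 1)) = 0 by apply/val_inj.
apply: le_trans H _; rewrite exprMn ler_piMr // mulr_ge0 ?sqr_ge0 //.
Qed.

End BilinearForms.

(** * Geodesics *)

Section EnergyCutoff.
Context {R : realType}.

Lemma clamp_lipschitz (a b x y : R) :
  `|Num.max a (Num.min b x) - Num.max a (Num.min b y)| <= `|x - y|.
Proof.
have minL : `|Num.min b x - Num.min b y| <= `|x - y|.
  rewrite /Num.min; case: (ltP b x) => h1; case: (ltP b y) => h2; rewrite ler_norml;
  have := ler_norm (x - y); have := ler_norm (- (x - y)); rewrite normrN => k1 k2; apply/andP; split; lra.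
apply: le_trans minL; move: (Num.min b x) (Num.min b y) => {}x {}y.
rewrite /Num.max; case: (ltP a x) => h1; case: (ltP a y) => h2; rewrite ler_norml;
have := ler_norm (x - y); have := ler_norm (- (x - y)); rewrite normrN => k1 k2; apply/andP; split; lra.
Qed.

Lemma floor_representative m (p : 'rV[R]_m) : exists2 q, lattice_eq p q & `|q| <= 1.
Proof.
exists (\row_j (p 0 j - (Num.floor (p 0 j))%:~R)).
  move=> i; rewrite mxE opprB addrCA subrr addr0; exact: intr_int.
apply: norm_rV_le => // j; rewrite mxE.
have := floor_le (p 0 j); have := floorD1_gt (p 0 j).
rewrite intrD => h1 h2; rewrite ger0_norm ?subr_ge0 //; lra.
Qed.

(** Lattice translations act on positions only, not on velocities: this is periodicity on the
    tangent bundle. *)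
Definition fiber_periodic m (T : Type) (f : 'rV[R]_(m + m) -> T) : Prop :=
  forall p q w, lattice_eq p q -> f (row_mx p w) = f (row_mx q w).

Lemma derive_fiber_periodic m (f : 'rV[R]_(m + m) -> R) v : fiber_periodic f ->
  fiber_periodic ('D_v f).
Proof.
move=> pf p q w pq; rewrite /derive.
have E (u : 'rV[R]_(m + m)) : f (u + row_mx p w) = f (u + row_mx q w).
  rewrite -(hsubmxK u) !add_row_mx; apply: pf => i; rewrite !mxE.
  rewrite (_ : _ - _ = p 0 i - q 0 i) //; ring.
have -> // : (fun h : R => h^-1 *: ((f \o shift (row_mx p w)) (h *: v) - f (row_mx p w))) =
          (fun h : R => h^-1 *: ((f \o shift (row_mx q w)) (h *: v) - f (row_mx q w))).
by apply/funext => h /=; rewrite E (pf _ _ _ pq).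
Qed.

(** A strip of bounded velocity is not compact, but periodicity moves each position to a
    representative of norm at most 1; together with its velocity it lies in the ball of radius
    [|r| + 1]. *)
Lemma strip_bounds m (f : 'rV[R]_(m + m) -> R) (r : R) : fiber_periodic f -> sm 1 setT f ->
  exists2 L : R, 0 <= L & (forall z, `|rsubmx z| <= r -> `|f z| <= L) /\
   forall z z', `|rsubmx z| <= r -> `|rsubmx z'| <= r -> `|f z - f z'| <= L * `|z - z'|.
Proof.
move=> pf sf; have [df Df] := (smS _ _ _).1 sf.
have [B1 B10 HB1] := continuous_bounded_ball (`|r| + 1) (fun x => sm_continuous sf (I : setT x)).
have [B2 B20 HB2] := sum_derive_bounded (`|r| + 1) sf.
have rep (z : 'rV[R]_(m + m)) : `|rsubmx z| <= r ->
    exists2 q, lattice_eq (lsubmx z) q & `|row_mx q (rsubmx z)| <= `|r| + 1.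
  move=> zr; have [q lq q1] := floor_representative (lsubmx z); exists q => //.
  apply: norm_row_mx_le; first by rewrite addr_ge0.
    by apply: le_trans q1 _; rewrite lerDr.
  by apply: le_trans zr _; apply: le_trans (ler_norm r) _; rewrite lerDl.
exists (B1 + B2); first by rewrite addr_ge0.
split=> [z zr|z z' zr z'r].
  have [q lq qr] := rep z zr.
  rewrite -(hsubmxK z) (pf _ q) //; apply: le_trans (HB1 _ qr) _; by rewrite lerDl.
have [s s01 ->] := @MVT_segment_rV R _ f z z' (fun s _ => df _ I).
apply: le_trans (norm_derive_le _ (df _ I)) _; rewrite mulrC ler_wpM2r //.
set y := z' + s *: (z - z').
have yr : `|rsubmx y| <= r.
  have -> : rsubmx y = rsubmx z' + s *: (rsubmx z - rsubmx z').
    by rewrite /y; apply/rowP => j; rewrite !mxE.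
  exact: norm_segment_le.
have [q lq qr] := rep y yr.
apply: (@le_trans _ _ B2); last by rewrite lerDr.
apply: le_trans (HB2 _ qr); rewrite le_eqVlt; apply/orP; left; apply/eqP.
apply: eq_bigr => j _; rewrite -{1}(hsubmxK y); congr `|_|.
exact: derive_fiber_periodic.
Qed.

Lemma strip_bounds_rV m N (F : 'rV[R]_(m + m) -> 'rV[R]_N) (r : R) : fiber_periodic F -> sm 1 setT F ->
  exists2 L : R, 0 <= L & (forall z, `|rsubmx z| <= r -> `|F z| <= L) /\
   forall z z', `|rsubmx z| <= r -> `|rsubmx z'| <= r -> `|F z - F z'| <= L * `|z - z'|.
Proof.
move=> pF sF.
have LJ (j : 'I_N) : exists L : R, 0 <= L /\ ((forall z, `|rsubmx z| <= r -> `|F z 0 j| <= L) /\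
   forall z z', `|rsubmx z| <= r -> `|rsubmx z'| <= r -> `|F z 0 j - F z' 0 j| <= L * `|z - z'|).
  have [||L L0 HL] := @strip_bounds m (fun z => F z 0 j) r; last by exists L.
    by move=> p q w pq; rewrite (pF p q).
  exact: (sm_mxP openT 1 F).1.
have [L HL] := choice LJ.
have S0 : 0 <= \sum_j L j by apply: sumr_ge0 => j _; have [] := HL j.
have LS j : L j <= \sum_j L j by rewrite (bigD1 j) //= lerDl; apply: sumr_ge0 => k _; have [] := HL k.
exists (\sum_j L j) => //; split=> [z zr|z z' zr z'r].
  by apply: norm_rV_le => // j; have [_ [H _]] := HL j; apply: le_trans (H z zr) _.
apply: norm_rV_le => [|j]; first by rewrite mulr_ge0.
have [_ [_ H]] := HL j; rewrite !mxE; apply: le_trans (H z z' zr z'r) _.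
by rewrite ler_wpM2r.
Qed.

(* A field that preserves e is integrated after multiplication by a cut-off
   function of e: this makes it globally Lipschitz and only rescales time. *)
Lemma energy_complete m (X : 'rV[R]_(m + m) -> 'rV[R]_(m + m)) (e : 'rV[R]_(m + m) -> R) (k : R) :
  0 < k -> smooth setT X -> smooth setT e -> fiber_periodic X -> fiber_periodic e ->
  (forall z, k * `|rsubmx z| ^+ 2 <= e z) ->
  (forall z, 'D_(X z) e z = 0) ->
  (forall z, lsubmx (X z) = rsubmx z) ->
  complete_field X.
Proof.
move=> k0 sX se pX pe ke De lX.
have de z : differentiable e z by have [d _] := (smS _ _ _).1 (se 1%N); exact: d.
have e0 z : 0 <= e z by apply: le_trans (ke z); rewrite mulr_ge0 ?exprn_ge0 // ltW.
have e_const (z : R -> 'rV[R]_(m + m)) (th : R -> R) :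
    (forall t : R, is_derive t (1 : R) z (th t *: X (z t))) -> forall t, e (z t) = e (z 0).
  move=> dz t; have [|c _ H] := @MVTsym R (fun t => e (z t)) (fun=> 0) t.
    move=> s _; have := is_derive_comp1 (de (z s)) (dz s).
    by rewrite deriveE // linearZ /= -deriveE // De scaler0.
  by apply/eqP; rewrite -subr_eq0 H mul0r.
split=> // [a|r].
  pose rho := e a + 1.
  have rho0 : 0 < rho by rewrite /rho ltr_wpDl.
  (* Velocities of norm at least [r] have energy at least [2 * rho], where the cut-off [th]
     vanishes; below energy [rho] it equals 1. *)
  pose r := Num.sqrt (2 * rho / k).
  have r0 : 0 <= r by exact: sqrtr_ge0.
  have kr2 : k * r ^+ 2 = 2 * rho.
    by rewrite sqr_sqrtr ?divr_ge0 ?mulr_ge0 ?(ltW k0) ?(ltW rho0) // mulrC divfK // gt_eqF.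
  pose th (s : R) := Num.max 0 (Num.min 1 (2 - s / rho)).
  have th_out s : 2 * rho <= s -> th s = 0.
    move=> s2; rewrite /th; have : 2 <= s / rho by rewrite ler_pdivlMr.
    by move=> h; rewrite max_l // ge_min; apply/orP; right; lra.
  have th01 s : `|th s| <= 1.
    rewrite /th ger0_norm; first by rewrite ge_max ler01 ge_min lexx.
    by rewrite le_max lexx.
  have thL s s' : `|th s - th s'| <= `|s - s'| / rho.
    apply: le_trans (clamp_lipschitz _ _ _ _) _.
    by rewrite opprB addrC addrA subrK -mulrBl normrM normfV (gtr0_norm rho0) distrC.
  (* Clamping the velocity brings every point into the strip where the bounds hold, so that [Y] is
     globally Lipschitz. By the choice of [r] it does not alter the cut-off field, which is [YE]. *)
  pose cl (z : 'rV[R]_(m + m)) : 'rV[R]_(m + m) :=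
    row_mx (lsubmx z) (\row_j Num.max (- r) (Num.min r (rsubmx z 0 j))).
  have clr z : `|rsubmx (cl z)| <= r.
    rewrite row_mxKr; apply: norm_rV_le => // j; rewrite mxE ler_norml le_max lexx /=.
    by rewrite ge_max ge_min lexx /= andbT; lra.
  have clL z z' : `|cl z - cl z'| <= `|z - z'|.
    rewrite opp_row_mx add_row_mx; apply: norm_row_mx_le => //.
      rewrite -linearB; exact: norm_lsubmx_le.
    apply: norm_rV_le => // j; rewrite !mxE; apply: le_trans (clamp_lipschitz _ _ _ _) _.
    by have := norm_coord_le (z - z') (rshift m j); rewrite !mxE.
  have clE z : `|rsubmx z| <= r -> cl z = z.
    move=> zr; rewrite -[RHS]hsubmxK; congr row_mx; apply/rowP => j; rewrite mxE.
    have := le_trans (norm_coord_le _ j) zr; rewrite ler_norml => /andP[h1 h2].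
    by rewrite min_r // max_r.
  have clout z : r < `|rsubmx z| -> r <= `|rsubmx (cl z)|.
    move=> rz; have [j rj] : exists j, r < `|rsubmx z 0 j|.
      apply: contrapT => H; move: rz; rewrite ltNge; apply/negP/negPn; apply: norm_rV_le => // j.
      by rewrite leNgt; apply/negP => rj; apply: H; exists j.
    apply: le_trans (norm_coord_le _ j); rewrite row_mxKr mxE.
    move: rj; case: (leP 0 (rsubmx z 0 j)) => zj.
      rewrite ger0_norm // => rj; rewrite (min_l (ltW rj)) max_r; last by lra.
      by rewrite ger0_norm.
    rewrite ltr0_norm // => rj; rewrite min_r; last by lra.
    by rewrite max_l; [rewrite normrN ger0_norm|lra].
  pose Y z := th (e (cl z)) *: X (cl z).
  have YE z : Y z = th (e z) *: X z.
    rewrite /Y; case: (leP `|rsubmx z| r) => zr; first by rewrite clE.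
    rewrite (th_out (e (cl z))) ?(th_out (e z)) ?scale0r //.
      apply: le_trans (ke z); rewrite -kr2 ler_pM2l // ler_sqr ?nnegrE //; exact: ltW.
    apply: le_trans (ke _); rewrite -kr2 ler_pM2l // ler_sqr ?nnegrE //; exact: clout.
  have [L1 L10 [B1 H1]] := strip_bounds_rV r pX (sX 1%N).
  have [L2 L20 [B2 H2]] := strip_bounds r pe (se 1%N).
  have YL z z' : `|Y z - Y z'| <= (L2 / rho * L1 + L1) * `|z - z'|.
    have -> : Y z - Y z' = (th (e (cl z)) - th (e (cl z'))) *: X (cl z) + th (e (cl z')) *: (X (cl z) - X (cl z')).
      by rewrite scalerBl scalerBr addrA subrK.
    have T1 : `|th (e (cl z)) - th (e (cl z'))| <= L2 / rho * `|z - z'|.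
      apply: le_trans (thL _ _) _.
      rewrite mulrAC ler_wpM2r ?invr_ge0 ?(ltW rho0) //; apply: le_trans (H2 _ _ _ _) _ => //.
      by rewrite ler_wpM2l.
    apply: le_trans (ler_normD _ _) _; rewrite mulrDl !normrZ; apply: lerD.
      by rewrite mulrAC; apply: ler_pM => //; exact: B1.
    apply: le_trans (_ : 1 * (L1 * `|z - z'|) <= _); last by rewrite mul1r.
    apply: ler_pM => //; apply: le_trans (H1 _ _ _ _) _ => //; by rewrite ler_wpM2l.
  have [|||z z0 dz] := @picard R (m + m) (fun=> Y) (fun=> L2 / rho * L1 + L1) a.
  - by move=> t; exact: cst_continuous.
  - by move=> t x y; exact: YL.
  - move=> x cx t; apply: (@continuous_comp _ _ _ x Y); first exact: cx.
    by apply: (@locally_lipschitz_continuous _ _ _ _ _ (L2 / rho * L1 + L1)) => b _; exact: YL.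
  have dz' (t : R) : is_derive t (1 : R) z (th (e (z t)) *: X (z t)) by rewrite -YE.
  (* Energy is preserved along [Y] as well, so the cut-off keeps its initial value 1 and the
     trajectory solves the original equation. *)
  exists z => // t; have := dz' t; rewrite (e_const z _ dz') z0.
  have -> : th (e a) = 1; last by rewrite scale1r.
  have h : e a / rho <= 1 by rewrite ler_pdivrMr // mul1r /rho lerDl.
  by rewrite /th min_l ?max_r //; lra.
(* A priori bound: conservation of energy bounds the velocity by [K], and the position moves by at
   most [K] in unit time. *)
have [B B0 HB] := continuous_bounded_ball r (fun x => sm_continuous (se 0%N) (I : setT x)).
pose K := Num.sqrt (B / k).
have K0 : 0 <= K by exact: sqrtr_ge0.
exists (Num.max (r + K) K) => z sz zr t t01.
have ec s : e (z s) = e (z 0).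
  by apply: (e_const z (fun=> 1)) => u; rewrite scale1r.
have wK s : `|rsubmx (z s)| <= K.
  rewrite -(@ler_sqr R) ?nnegrE // sqr_sqrtr ?divr_ge0 ?(ltW k0) // ler_pdivlMr // mulrC.
  by apply: le_trans (ke _) _; rewrite ec; apply: le_trans (HB _ zr); exact: ler_norm.
rewrite -(hsubmxK (z t)); apply: norm_row_mx_le; first by rewrite le_max K0 orbT.
  rewrite le_max; apply/orP; left; case/andP: t01 => t0 t1.
  have dl s : is_derive s (1 : R) (fun s => lsubmx (z s) - lsubmx (z 0)) (rsubmx (z s)).
    rewrite -lX -[X in is_derive _ _ _ X]subr0; apply: is_deriveB.
    apply/is_derive_mxP => i j; have /is_derive_mxP /(_ i (lshift m j)) := sz s.
    by rewrite (_ : lsubmx (X (z s)) i j = X (z s) i (lshift m j)) ?mxE // (_ : (fun s => lsubmx (z s) i j) = (fun s => z s i (lshift m j))) //; apply/funext => u; rewrite mxE.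
  have := @norm_le_growth R m _ _ (fun s => K * s) (fun=> K) (subrr _) dl.
  have dK s : is_derive s (1 : R) (fun s => K * s) K.
    have := @is_deriveZ R R R id K s 1 1 (is_derive_id s 1).
    by rewrite [K *: 1]mulr1; exact.
  move=> /(_ dK (fun s => wK s) t); rewrite mulr0 subr0 ger0_norm // => H.
  rewrite -(subrK (lsubmx (z 0)) (lsubmx (z t))) addrC; apply: le_trans (ler_normD _ _) _.
  rewrite lerD //; first by apply: le_trans zr; exact: norm_lsubmx_le.
  by apply: le_trans H _; rewrite ler_piMr.
by rewrite le_max wK orbT.
Qed.

Lemma solution_smooth N (F : 'rV[R]_N -> 'rV[R]_N) (z : R -> 'rV[R]_N) : smooth setT F ->
  solution F z -> smooth setT z.
Proof.
move=> sF sz; elim=> [|k IH].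
  by move=> t _; exact: is_derive_continuous (sz t).
have dz (t : R) : differentiable z t by apply/derivable1_diffP; case: (sz t).
split=> // v.
have E (t : R) : v *: F (z t) = 'D_v z t.
  by rewrite deriveE // (diff1E (dz t)) derive1E; case: (sz t) => _ ->.
apply: sm_eq E _; apply/(sm_mxP openT) => i j.
apply: sm_eq (smM openT (sm_cst k setT v) ((sm_mxP openT k _).1 (sm_comp_rV openT openT (fun _ _ => I) (sF k) IH) i j)) => t.
by rewrite mxE.
Qed.

End EnergyCutoff.

(** * The geodesic field of a periodic metric *)

Section MetricCalculus.
Context {R : realType} {m : nat}.

Lemma is_derive_bf (M : R -> 'M[R]_m) (a b : R -> 'rV[R]_m) (t : R) M' a' b' :
  is_derive t (1 : R) M M' -> is_derive t (1 : R) a a' -> is_derive t (1 : R) b b' ->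
  is_derive t (1 : R) (fun s => bf (M s) (a s) (b s))
    (bf M' (a t) (b t) + bf (M t) a' (b t) + bf (M t) (a t) b').
Proof.
move=> /is_derive_mxP dM /is_derive_mxP da /is_derive_mxP db.
rewrite (_ : (fun s => _) = \sum_i \sum_j (fun s => M s i j * (a s 0 i * b s 0 j))); last first.
  apply/funext => s; rewrite bfE fct_sumE; apply: eq_bigr => i _; rewrite fct_sumE.
  by apply: eq_bigr => j _.
rewrite (_ : _ + _ + _ = \sum_i \sum_j (M t i j * (a t 0 i * b' 0 j + b t 0 j * a' 0 i) + (a t 0 i * b t 0 j) * M' i j)); last first.
  rewrite !bfE -!big_split /=; apply: eq_bigr => i _; rewrite -!big_split /=; apply: eq_bigr => j _; ring.
apply: is_derive_sum => i; apply: is_derive_sum => j.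
exact: (@is_deriveM R R (fun s => M s i j) (fun s => a s 0 i * b s 0 j) t 1 _ _ (dM i j) (@is_deriveM R R (fun s => a s 0 i) (fun s => b s 0 j) t 1 _ _ (da 0 i) (db 0 j))).
Qed.

Lemma is_derive_cstV (V : normedModType R) (a : V) (t : R) : is_derive t (1 : R) (fun=> a) 0.
Proof. exact: is_derive_cst. Qed.

Lemma is_derive_unique (V : normedModType R) (f : R -> V) (t : R) a b :
  is_derive t (1 : R) f a -> is_derive t (1 : R) f b -> a = b.
Proof. by move=> [_ <-] [_ <-]. Qed.

Lemma is_derive_affine (V : normedModType R) (p v : V) (t : R) :
  is_derive t (1 : R) (fun s : R => p + s *: v) v.
Proof.
have di : derivable (id : V -> V) (p + t *: v) v by exact: derivable_id.
by have := is_derive_line di; rewrite derive_id.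
Qed.

Lemma derive_periodic (f : 'rV[R]_m -> R) v : periodic f -> periodic ('D_v f).
Proof.
move=> pf p q pq; rewrite /derive.
have E (u : 'rV[R]_m) : f (u + p) = f (u + q).
  apply: pf => i; rewrite !mxE; rewrite (_ : _ - _ = p 0 i - q 0 i) //; ring.
have -> // : (fun h : R => h^-1 *: ((f \o shift p) (h *: v) - f p)) =
          (fun h : R => h^-1 *: ((f \o shift q) (h *: v) - f q)).
by apply/funext => h /=; rewrite E (pf _ _ pq).
Qed.

Variable G : 'rV[R]_m -> 'M[R]_m.
Hypothesis sG : forall i j, smooth setT (fun p => G p i j).

Definition dmetric (p mu : 'rV[R]_m) : 'M[R]_m := \matrix_(i, j) 'D_mu (fun q => G q i j) p.

Lemma metric_differentiable i j p : differentiable (fun q => G q i j) p.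
Proof. by have [d _] := (smS _ _ _).1 (sG i j 1%N); exact: d. Qed.

Lemma dmetricE p mu a b : bf (dmetric p mu) a b =
  \sum_l \sum_i \sum_j partial l (fun q => G q i j) p * (mu 0 l * a 0 i * b 0 j).
Proof.
rewrite bfE [RHS]exchange_big /=; apply: eq_bigr => i _; rewrite [RHS]exchange_big /=; apply: eq_bigr => j _.
rewrite mxE derive_sum_coord; last exact: metric_differentiable.
by rewrite mulr_suml; apply: eq_bigr => l _; rewrite /partial [_ *: _]mulrC; ring.
Qed.

Lemma is_derive_metric (g : R -> 'rV[R]_m) (t : R) g' : is_derive t (1 : R) g g' ->
  is_derive t (1 : R) (fun s => G (g s)) (dmetric (g t) g').
Proof.
move=> dg; apply/is_derive_mxP => i j; rewrite mxE.
by apply: (@is_derive_comp1 _ _ _ (fun q => G q i j)) => //; exact: metric_differentiable.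
Qed.

Hypothesis symG : forall p, (G p)^T = G p.
Hypothesis perG : periodic G.
Variable c : R.
Hypothesis c0 : 0 < c.
Hypothesis cG : forall p w, c * dotp w w <= quadf (G p) w.

Lemma norm_sq_le_dotp (w : 'rV[R]_m) : `|w| ^+ 2 <= dotp w w.
Proof.
have q0 : 0 <= dotp w w by apply: sumr_ge0 => i _; rewrite -expr2 sqr_ge0.
rewrite -(sqr_sqrtr q0) ler_sqr ?nnegrE ?sqrtr_ge0 //.
apply: norm_rV_le => [|j]; first exact: sqrtr_ge0.
rewrite -sqrtr_sqr; apply: ler_wsqrtr; rewrite /dotp (bigD1 j) //= -expr2 lerDl.
by apply: sumr_ge0 => k _; rewrite -expr2 sqr_ge0.
Qed.

Lemma metric_ge p w : c * `|w| ^+ 2 <= quadf (G p) w.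
Proof. by apply: le_trans (cG p w); rewrite ler_pM2l // norm_sq_le_dotp. Qed.

Lemma metric_posdef p : posdefmx (G p).
Proof.
move=> w w0; apply: lt_le_trans (metric_ge p w).
by rewrite mulr_gt0 // exprn_gt0 // normr_gt0.
Qed.

Definition geodesic_acc (p w : 'rV[R]_m) : 'rV[R]_m :=
  \row_k (- \sum_i \sum_j christoffel G p k i j * w 0 i * w 0 j).

Definition geodesic_field (z : 'rV[R]_(m + m)) : 'rV[R]_(m + m) :=
  row_mx (rsubmx z) (geodesic_acc (lsubmx z) (rsubmx z)).

(** Pairing with the metric turns the Christoffel symbols into those of the first kind. The inverse
    metric disappears, and later estimates need derivatives of the metric only. *)
Lemma geodesic_acc_covector p w y :
  bf (G p) (geodesic_acc p w) y = - bf (dmetric p w) w y + 2^-1 * bf (dmetric p y) w w.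
Proof.
pose g i j l := partial i (fun q => G q j l) p.
pose L : 'rV[R]_m := \row_l \sum_i \sum_j (g i j l + g j i l - g l i j) * (w 0 i * w 0 j).
have E : geodesic_acc p w = - 2^-1 *: (L *m invmx (G p)).
  apply/rowP => k; rewrite !mxE mulNr; congr (- _).
  rewrite mulr_sumr; under [RHS]eq_bigr do rewrite mxE mulr_suml mulr_sumr.
  rewrite [RHS]exchange_big /=; apply: eq_bigr => i _.
  under [RHS]eq_bigr do rewrite mulr_suml mulr_sumr.
  rewrite [RHS]exchange_big /=; apply: eq_bigr => j _.
  rewrite /christoffel mulr_sumr !mulr_suml; apply: eq_bigr => l _.
  have -> : invmx (G p) l k = invmx (G p) k l by rewrite -[in LHS](invmx_sym (symG p)) mxE.
  by rewrite /g; ring.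
have uG := posdef_unitmx (@metric_posdef p).
have -> : bf (G p) (geodesic_acc p w) y = - 2^-1 * dotp L y.
  rewrite E bfZl; congr (_ * _); rewrite /bf mulmxKV // mxE.
  by apply: eq_bigr => i _; rewrite [y^T i 0]mxE.
have -> : dotp L y = bf (dmetric p w) w y + bf (dmetric p w) w y - bf (dmetric p y) w w.
  rewrite !dmetricE -/g.
  have S1 : dotp L y = \sum_l \sum_i \sum_j (g i j l * (w 0 i * w 0 j * y 0 l) + g j i l * (w 0 j * w 0 i * y 0 l) - g l i j * (y 0 l * w 0 i * w 0 j)).
    apply: eq_bigr => l _; rewrite mxE mulr_suml; apply: eq_bigr => i _; rewrite mulr_suml.
    by apply: eq_bigr => j _; ring.
  rewrite S1.
  have -> : \sum_l \sum_i \sum_j partial l (fun q => G q i j) p * (w 0 l * w 0 i * y 0 j) =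
            \sum_l \sum_i \sum_j g i j l * (w 0 i * w 0 j * y 0 l).
    rewrite [RHS]exchange_big /=; apply: eq_bigr => i _; rewrite [RHS]exchange_big /=.
    by apply: eq_bigr.
  have E2 : \sum_l \sum_i \sum_j g i j l * (w 0 i * w 0 j * y 0 l) =
            \sum_l \sum_i \sum_j g j i l * (w 0 j * w 0 i * y 0 l).
    by apply: eq_bigr => l _; rewrite exchange_big.
  rewrite {2}E2 -sumrN -!big_split /=; apply: eq_bigr => l _.
  rewrite -sumrN -!big_split /=; apply: eq_bigr => i _.
  by rewrite -sumrN -!big_split /=; apply: eq_bigr => j _.
by field.
Qed.

Definition energy (z : 'rV[R]_(m + m)) : R := quadf (G (lsubmx z)) (rsubmx z).

Lemma sm_metric k i j : sm k setT (fun z : 'rV[R]_(m + m) => G (lsubmx z) i j).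
Proof.
apply: (sm_comp openT openT (fun _ _ => I) (sG i j k)).
by apply: (sm_lsubmx openT); exact: sm_id openT.
Qed.

Lemma sm_velocity k i : sm k setT (fun z : 'rV[R]_(m + m) => rsubmx z 0 i).
Proof.
have H : sm k setT (fun z : 'rV[R]_(m + m) => rsubmx z) by apply: (sm_rsubmx openT); exact: sm_id openT.
exact: ((sm_mxP openT k _).1 H).
Qed.

Lemma energy_smooth : smooth setT energy.
Proof.
move=> k; apply: (@sm_eq _ _ _ _ _ (fun z => \sum_i \sum_j G (lsubmx z) i j * (rsubmx z 0 i * rsubmx z 0 j))).
  by move=> z; rewrite /energy quadfE bfE.
apply: (sm_sum openT) => i _; apply: (sm_sum openT) => j _.
apply: (smM openT); first exact: sm_metric.
by apply: (smM openT); exact: sm_velocity.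
Qed.

Lemma sm_partial_metric k l i j : sm k setT (fun p => partial l (fun q => G q i j) p).
Proof. by have [_ D] := (smS _ _ _).1 (sG i j k.+1); exact: D. Qed.

Lemma christoffel_smooth k i j : smooth setT (fun p => christoffel G p k i j).
Proof.
move=> n; apply: (smM openT); first exact: sm_cst.
apply: (sm_sum openT) => l _; apply: (smM openT).
  apply: (sm_invmx openT) => [a b|p _]; first exact: sG.
  exact: (posdef_unitmx (@metric_posdef p)).
by apply: (smB openT); [apply: (smD openT)|]; exact: sm_partial_metric.
Qed.

Lemma geodesic_field_smooth : smooth setT geodesic_field.
Proof.
move=> k; apply: (sm_row_mx openT); first by apply: (sm_rsubmx openT); exact: sm_id openT.
apply/(sm_mxP openT) => i0 l.
apply: (@sm_eq _ _ _ _ _ (fun z => - \sum_i \sum_j christoffel G (lsubmx z) l i j * rsubmx z 0 i * rsubmx z 0 j)).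
  by move=> z; rewrite mxE.
apply: (smN openT); apply: (sm_sum openT) => i _; apply: (sm_sum openT) => j _.
apply: (smM openT); last exact: sm_velocity.
apply: (smM openT); last exact: sm_velocity.
apply: (sm_comp openT openT (fun _ _ => I) (christoffel_smooth l i j k)).
by apply: (sm_lsubmx openT); exact: sm_id openT.
Qed.

Lemma energy_derive (z v : 'rV[R]_(m + m)) :
  'D_v energy z = bf (dmetric (lsubmx z) (lsubmx v)) (rsubmx z) (rsubmx z)
    + 2 * bf (G (lsubmx z)) (rsubmx v) (rsubmx z).
Proof.
have de : differentiable energy z by have [d _] := (smS _ _ _).1 (energy_smooth 1%N); exact: d.
have D1 := @is_derive_line R _ _ energy z v 0.
have dv : derivable energy z v by exact: diff_derivable.
have := D1; rewrite scale0r addr0 => /(_ dv) {}D1.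
have dl := is_derive_affine (lsubmx z) (lsubmx v) 0.
have dr := is_derive_affine (rsubmx z) (rsubmx v) 0.
have D2 := is_derive_bf (is_derive_metric dl) dr dr.
have E : (fun s : R => bf (G (lsubmx z + s *: lsubmx v)) (rsubmx z + s *: rsubmx v) (rsubmx z + s *: rsubmx v)) =
         (fun s : R => energy (z + s *: v)).
  by apply/funext => s; rewrite /energy quadfE; congr (bf (G _) _ _); apply/rowP => j; rewrite !mxE.
rewrite E !scale0r !addr0 in D2.
rewrite (is_derive_unique D1 D2) -addrA; congr (_ + _).
by rewrite (bfC (rsubmx z) _ (symG _)) mulr_natl mulr2n.
Qed.

(** For [y = w] the acceleration contributes minus one plus one half of the variation of the metric
    along [w]; doubled, this cancels the variation of the metric itself. *)
Lemma energy_conserved z : 'D_(geodesic_field z) energy z = 0.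
Proof.
rewrite energy_derive row_mxKl row_mxKr geodesic_acc_covector.
by field.
Qed.

Lemma geodesic_field_periodic : fiber_periodic geodesic_field.
Proof.
move=> p q w pq; rewrite /geodesic_field !row_mxKl !row_mxKr; congr row_mx.
apply/rowP => k; rewrite !mxE; congr (- _); apply: eq_bigr => i _; apply: eq_bigr => j _.
have pe a b l : partial l (fun x => G x a b) p = partial l (fun x => G x a b) q.
  by apply: derive_periodic pq => x y xy; rewrite (perG xy).
suff -> : christoffel G p k i j = christoffel G q k i j by [].
by rewrite /christoffel (perG pq); under eq_bigr do rewrite !pe.
Qed.

Lemma energy_periodic : fiber_periodic energy.
Proof. by move=> p q w pq; rewrite /energy !row_mxKl !row_mxKr (perG pq). Qed.

Lemma geodesic_field_complete : complete_field geodesic_field.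
Proof.
apply: (@energy_complete R m geodesic_field energy c) => //.
- exact: geodesic_field_smooth.
- exact: energy_smooth.
- exact: geodesic_field_periodic.
- exact: energy_periodic.
- by move=> z; exact: metric_ge.
- exact: energy_conserved.
- by move=> z; rewrite row_mxKl.
Qed.

Lemma solution_velocity z : solution geodesic_field z ->
  forall t : R, is_derive t (1 : R) (fun s => lsubmx (z s)) (rsubmx (z t)).
Proof.
move=> sz t; apply/is_derive_mxP => i j; have /is_derive_mxP /(_ i (lshift m j)) := sz t.
rewrite /geodesic_field row_mxEl (_ : (fun s => lsubmx (z s) i j) = (fun s => z s i (lshift m j))) //.
by apply/funext => u; rewrite mxE.
Qed.

Lemma solution_acc z : solution geodesic_field z ->
  forall t : R, is_derive t (1 : R) (fun s => rsubmx (z s)) (geodesic_acc (lsubmx (z t)) (rsubmx (z t))).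
Proof.
move=> sz t; apply/is_derive_mxP => i j; have /is_derive_mxP /(_ i (rshift m j)) := sz t.
rewrite /geodesic_field row_mxEr (_ : (fun s => rsubmx (z s) i j) = (fun s => z s i (rshift m j))) //.
by apply/funext => u; rewrite mxE.
Qed.

Lemma is_derive1_eq (V : normedModType R) (f : R -> V) (g : R -> V) :
  (forall t : R, is_derive t (1 : R) f (g t)) -> derive1 f = g.
Proof. by move=> H; apply/funext => t; rewrite derive1E; case: (H t). Qed.

Lemma geodesic_of_solution z : solution geodesic_field z ->
  geodesic G (fun t => lsubmx (z t)) /\ derive1 (fun t => lsubmx (z t)) = (fun t => rsubmx (z t)).
Proof.
move=> sz; have E1 := is_derive1_eq (solution_velocity sz).
have E2 := is_derive1_eq (solution_acc sz).
split=> //; split; last by move=> t k; rewrite E1 E2 mxE.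
exists setT; split=> //; first exact: openT.
move=> k; apply: sm_Ck; apply: (sm_lsubmx openT).
exact: (solution_smooth geodesic_field_smooth sz).
Qed.

Lemma solution_of_geodesic g : geodesic G g ->
  solution geodesic_field (fun t => row_mx (g t) (derive1 g t)).
Proof.
move=> [[U [oU UT Cg]] Hg].
have d1 (t : R) : is_derive t (1 : R) g (derive1 g t).
  have [_ C1] := Cg 1%N; have [d _] := C1 1; split; last by rewrite derive1E.
  by apply: d; exact: UT.
have E1 : derive1 g = 'D_1 g by apply/funext => t; rewrite derive1E.
have d2 (t : R) : is_derive t (1 : R) (derive1 g) (derive1 (derive1 g) t).
  have [_ C2] := Cg 2; have [_ [_ C3]] := C2 1; have [d _] := C3 1.
  split; last by rewrite [RHS]derive1E.
  by rewrite E1; apply: d; exact: UT.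
move=> t; apply/is_derive_mxP => i j; rewrite /geodesic_field row_mxKl row_mxKr.
case: (splitP j) => a ja.
  have -> : j = lshift m a by apply/val_inj.
  rewrite row_mxEl (_ : (fun s => _) = (fun s => g s i a)); last by apply/funext => s; rewrite row_mxEl.
  by have /is_derive_mxP := d1 t; exact.
have -> : j = rshift m a by apply/val_inj.
rewrite row_mxEr (_ : (fun s => _) = (fun s => derive1 g s i a)); last by apply/funext => s; rewrite row_mxEr.
have /is_derive_mxP /(_ i a) := d2 t; congr (is_derive _ _ _ _).
by rewrite (ord1 i) Hg mxE.
Qed.

(** [get] returns an unspecified geodesic with the given initial data; uniqueness for the complete
    geodesic field identifies its endpoint with that of [z]. *)
Lemma exp_mapE z : solution geodesic_field z ->
  exp_map G (lsubmx (z 0)) (rsubmx (z 0)) = lsubmx (z 1).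
Proof.
move=> sz; have [gz gz'] := geodesic_of_solution sz; rewrite /exp_map.
set S := [set gamma | _].
have [] := @getPex _ S; first by exists (fun t => lsubmx (z t)); split => //; rewrite gz'.
set g := get S => gg g0 g1; have sg := solution_of_geodesic gg.
have H := solution_unique geodesic_field_complete sg sz.
have : row_mx (g 1) (derive1 g 1) = z 1.
  by apply: H; [rewrite g0 g1 hsubmxK|rewrite ler01 lexx].
by move=> <-; rewrite row_mxKl.
Qed.

Lemma exp_map_flow p w : exp_map G p w = lsubmx (flow1 geodesic_field (row_mx p w)).
Proof.
have [_ ex _] := geodesic_field_complete; have [z z0 sz] := ex (row_mx p w).
have := exp_mapE sz; rewrite z0 row_mxKl row_mxKr => ->.
by rewrite -z0 flow1E //; exact: geodesic_field_complete.
Qed.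

Lemma exp_map_smooth p : smooth setT (exp_map G p).
Proof.
move=> k; apply: (@sm_eq _ _ _ _ _ (fun w => lsubmx (flow1 geodesic_field (row_mx p w)))).
  by move=> w; rewrite exp_map_flow.
apply: (sm_lsubmx openT); apply: (sm_comp_rV openT openT (fun _ _ => I)).
  exact: flow1_sm geodesic_field_complete.
by apply: (sm_row_mx openT); [exact: sm_cst|exact: sm_id openT].
Qed.

End MetricCalculus.

(** * Quantitative estimates for the exponential map *)

Section MetricComparison.
Context {R : realType} {m : nat}.
Variable G : 'rV[R]_m -> 'M[R]_m.
Hypothesis sG : forall i j, smooth setT (fun p => G p i j).
Hypothesis symG : forall p, (G p)^T = G p.
Variable c : R.
Hypothesis c0 : 0 < c.
Hypothesis cG : forall p w, c * dotp w w <= quadf (G p) w.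
Variable A : R.
Hypothesis A0 : 0 <= A.
Hypothesis HA : forall p mu w, `|quadf (dmetric G p mu) w| <= A * normq (G p) mu * quadf (G p) w.

Let pos p := metric_posdef c0 cG p.

Lemma expR_le2 (x : R) : x <= 2^-1 -> expR x <= 2.
Proof.
move=> x2; have := expR_ge1Dx (- x); rewrite expRN => H.
have e0 := expR_gt0 x; have H2 : (2 : R)^-1 <= (expR x)^-1 by apply: le_trans H; lra.
by rewrite -lef_pV2 ?posrE.
Qed.

(** The logarithmic derivative of the squared length of [w] along the curve is at most
    [A * s <= 1/2], and [expR] of 1/2 is at most 2. *)
Lemma metric_along (g g' : R -> 'rV[R]_m) (s : R) w :
  (forall t : R, 0 <= t <= 1 -> is_derive t (1 : R) g (g' t)) ->
  (forall t : R, 0 <= t <= 1 -> normq (G (g t)) (g' t) <= s) -> A * s <= 2^-1 ->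
  forall t : R, 0 <= t <= 1 ->
  2^-1 * quadf (G (g 0)) w <= quadf (G (g t)) w <= 2 * quadf (G (g 0)) w.
Proof.
move=> dg ds As t t01.
pose f t := quadf (G (g t)) w; pose f' t := quadf (dmetric G (g t) (g' t)) w.
have df (u : R) : 0 <= u <= 1 -> is_derive u (1 : R) f (f' u).
  move=> /dg du; have := is_derive_bf (is_derive_metric sG du) (is_derive_cstV w u) (is_derive_cstV w u).
  by rewrite bf0l bf0r !addr0.
have Hf (u : R) : 0 <= u <= 1 -> `|f' u| <= A * s * f u.
  move=> u01; apply: le_trans (HA _ _ _) _; apply: ler_wpM2r; first exact: posdef_ge0 (pos _) w.
  by apply: ler_wpM2l => //; exact: ds.
have s0 : 0 <= s by apply: le_trans (ds 0 _); rewrite ?normq_ge0 // lexx ler01.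
have As0 : 0 <= A * s by rewrite mulr_ge0.
have f0 : 0 <= f 0 by exact: posdef_ge0 (pos _) w.
have /andP[t0 t1] := t01.
have Ast : A * s * t <= 2^-1 by apply: le_trans As; rewrite ler_piMr.
have U : f t <= f 0 * expR (A * s * t).
  apply: (gronwall_scalar df) t01 => u u01; exact: le_trans (ler_norm _) (Hf u u01).
have L : - f t <= - f 0 * expR (- (A * s) * t).
  apply: (@gronwall_scalar _ (fun u => - f u) (fun u => - f' u)) t01 => u u01.
    by apply: is_deriveN; exact: df.
  rewrite mulrNN; apply: le_trans (ler_norm _) _; rewrite normrN; exact: Hf.
apply/andP; split; last first.
  by apply: le_trans U _; rewrite mulrC ler_wpM2r // expR_le2.
have := expR_ge1Dx (- (A * s) * t); rewrite mulNr => e1.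
have e2 : 2^-1 <= expR (- (A * s * t)) by lra.
have := ler_wpM2l f0 e2; move: L; rewrite mulNr lerN2 mulNr => L1 L2.
by apply: le_trans L1; rewrite mulrC.
Qed.

(** The factor 2 on norms is coarser than the square root of 2 that the quadratic forms give; it
    keeps the later constants rational. *)
Definition comparable_metrics p q := forall w,
  normq (G q) w <= 2 * normq (G p) w /\ normq (G p) w <= 2 * normq (G q) w.

Lemma comparable_quadf p q :
  (forall w, 2^-1 * quadf (G p) w <= quadf (G q) w <= 2 * quadf (G p) w) ->
  comparable_metrics p q.
Proof.
move=> H w; have /andP[h1 h2] := H w.
have q1 := posdef_ge0 (pos p) w; have q2 := posdef_ge0 (pos q) w.
split; rewrite -(@ler_sqr R) ?nnegrE ?mulr_ge0 ?normq_ge0 // exprMn (normq_sqr (pos p)) (normq_sqr (pos q)) expr2; lra.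
Qed.

(* [f^(-1/2)], for [f] the squared speed, has derivative bounded by [A / 2]. *)
Lemma segment_speed p d : A * normq (G p) d <= 1 ->
  forall t : R, 0 <= t <= 1 -> normq (G (p + t *: d)) d <= 2 * normq (G p) d.
Proof.
move=> Ad t t01; have /andP[t0 t1] := t01.
have [->|d0] := eqVneq d 0; first by rewrite scaler0 addr0; have := normq_ge0 (G p) 0; lra.
pose f u := quadf (G (p + u *: d)) d; pose f' u := quadf (dmetric G (p + u *: d) d) d.
have df (u : R) : is_derive u (1 : R) f (f' u).
  have := is_derive_bf (is_derive_metric sG (is_derive_affine p d u)) (is_derive_cstV d u) (is_derive_cstV d u).
  by rewrite bf0l bf0r !addr0.
have f0 u : 0 < f u by exact: pos.
pose h u := (Num.sqrt (f u))^-1.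
pose h' u := - (Num.sqrt (f u)) ^- 2 *: ((2 * Num.sqrt (f u))^-1 * f' u).
have s0 u : 0 < Num.sqrt (f u) by rewrite sqrtr_gt0.
have dh (u : R) : is_derive u (1 : R) h (h' u).
  have ds : is_derive u (1 : R) (fun u => Num.sqrt (f u)) ((2 * Num.sqrt (f u))^-1 * f' u).
    by apply: is_derive_comp_R (df u); exact: is_derive1_sqrt.
  by apply: is_deriveV; rewrite gt_eqF.
have h'b u : - (A / 2) <= h' u.
  have H : f' u <= A * Num.sqrt (f u) * f u by apply: le_trans (ler_norm _) (HA _ _ _).
  rewrite /h' scaleNr lerN2 /GRing.scale /=.
  have E : f u = Num.sqrt (f u) ^+ 2 by rewrite sqr_sqrtr // ltW.
  move: H; rewrite {2}E; move: (Num.sqrt (f u)) (s0 u) => y y0 H.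
  rewrite invfM mulrA -ler_pdivlMl ?mulr_gt0 ?invr_gt0 ?exprn_gt0 //.
  rewrite (_ : _ * (A / 2) = A * y * y ^+ 2) //; field; exact: lt0r_neq0.
  by rewrite mulr_gt0.
have [e /andP[e0 et] E] := @MVT01 _ h h' 0 t t0 (fun u _ => dh u).
have ht : h 0 - A / 2 <= h t.
  have : - (A / 2) * t <= h' e * t by rewrite ler_wpM2r.
  rewrite subr0 in E; rewrite -E => H.
  have : A / 2 * t <= A / 2 by rewrite ler_piMr // divr_ge0.
  by lra.
have n0 : Num.sqrt (f 0) = normq (G p) d by rewrite /f scale0r addr0.
have h0 : h 0 = (normq (G p) d)^-1 by rewrite /h n0.
have np : 0 < normq (G p) d by rewrite -n0.
have : (2 * normq (G p) d)^-1 <= h t.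
  apply: le_trans ht; rewrite h0 invfM.
  have : A <= (normq (G p) d)^-1 by rewrite -[leRHS]mul1r ler_pdivlMr.
  by move: (_^-1) => y; lra.
by rewrite /h lef_pV2 // posrE // mulr_gt0.
Qed.

(** By [segment_speed] the straight segment from [p] to [q] has speed at most twice its initial one;
    1/4 is what makes [A] times this at most 1/2, as [metric_along] asks. *)
Lemma comparable_ball p q : A * normq (G p) (q - p) <= 4^-1 -> comparable_metrics p q.
Proof.
move=> H; apply: comparable_quadf => w.
have sp : forall t : R, 0 <= t <= 1 -> normq (G (p + t *: (q - p))) (q - p) <= 2 * normq (G p) (q - p).
  by apply: segment_speed; lra.
have := @metric_along (fun t => p + t *: (q - p)) (fun=> q - p) _ w
  (fun t _ => is_derive_affine p (q - p) t) sp.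
have H2 : A * (2 * normq (G p) (q - p)) <= 2^-1 by rewrite mulrCA; lra.
move=> /(_ H2 1); rewrite ler01 lexx => /(_ isT).
by rewrite scale0r addr0 scale1r addrC subrK.
Qed.

(* The displacement is measured by pairing it with itself, which avoids
   differentiating the norm. *)
Lemma normq_displacement p (x x' : R -> 'rV[R]_m) (k t : R) : 0 <= t -> 
  (forall u : R, 0 <= u <= t -> is_derive u (1 : R) x (x' u)) ->
  (forall u : R, 0 <= u <= t -> normq (G p) (x' u) <= k) ->
  normq (G p) (x t - x 0) <= k * t.
Proof.
move=> t0 dx kx; set y := x t - x 0.
have [e et E] : exists2 e, 0 <= e <= t & bf (G p) (x t) y - bf (G p) (x 0) y = bf (G p) (x' e) y * (t - 0).
  apply: (@MVT01 _ (fun u => bf (G p) (x u) y) (fun u => bf (G p) (x' u) y)) => // u ut.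
  have := is_derive_bf (is_derive_cstV (G p) u) (dx u ut) (is_derive_cstV y u).
  by rewrite bf0r /bf mulmx0 !mul0mx mxE add0r addr0.
move: E; rewrite -bfBl subr0 -/y -quadfE -(normq_sqr (pos p)) => E.
have [->|/(normq_gt0 (pos p)) y0] := eqVneq y 0.
  by rewrite normq0 mulr_ge0 //; apply: le_trans (kx 0 _); rewrite ?normq_ge0 // lexx.
rewrite -(ler_pM2r y0) -expr2 E mulrAC; apply: ler_wpM2r => //.
apply: le_trans (ler_norm _) _; apply: le_trans (bf_le (symG p) (pos p) _ _) _.
by apply: ler_wpM2r; [exact: normq_ge0|exact: kx].
Qed.

End MetricComparison.

(** Telescoping for [acc_variation]: the difference of two accelerations, paired with [z], is split
    into terms in which a single argument changes. Stated on scalars, it is a field identity. *)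
Lemma difference_identity (R : realType) (Z p1 p2 q2 a b c c' s1 s2 s3 s' d1 d2 d3 d4 : R) :
  Z = p1 - p2 -> p1 = - a + 2^-1 * s1 -> q2 = - c' + 2^-1 * s' ->
  d1 = a - b -> d2 = b - c -> d3 = s1 - s2 -> d4 = s2 - s3 ->
  Z = - (d1 + d2) + 2^-1 * (d3 + d4) - (c - c') + 2^-1 * (s3 - s') - (p2 - q2).
Proof. by move=> -> -> -> -> -> -> ->; field. Qed.

Lemma seven_term_bound (R : realType) (x1 x2 x3 x4 x5 x6 x7 y1 y2 y3 : R) :
  `|x1| <= y1 -> `|x2| <= y1 -> `|x3| <= y1 -> `|x4| <= y1 ->
  `|x5| <= y2 -> `|x6| <= y2 -> `|x7| <= y3 ->
  - (x1 + x2) + 2^-1 * (x3 + x4) - x5 + 2^-1 * x6 - x7 <= 3 * y1 + (3 / 2 * y2 + y3).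
Proof.
rewrite !ler_norml => /andP[? ?] /andP[? ?] /andP[? ?] /andP[? ?] /andP[? ?] /andP[? ?] /andP[? ?]; lra.
Qed.

(** * Bounds on the geodesic acceleration relative to a base point *)

Section GeodesicEstimates.
Context {R : realType} {m : nat}.
Variable G : 'rV[R]_m -> 'M[R]_m.
Hypothesis sG : forall i j, smooth setT (fun p => G p i j).
Hypothesis symG : forall p, (G p)^T = G p.
Hypothesis perG : periodic G.
Variable c : R.
Hypothesis c0 : 0 < c.
Hypothesis cG : forall p w, c * dotp w w <= quadf (G p) w.

Definition d2metric (p mu nu : 'rV[R]_m) : 'M[R]_m :=
  \matrix_(i, j) 'D_nu ('D_mu (fun q => G q i j)) p.

Variables A B : R.
Hypotheses (A0 : 0 <= A) (B0 : 0 <= B).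
Hypothesis HA : forall p mu w, `|quadf (dmetric G p mu) w| <= A * normq (G p) mu * quadf (G p) w.
Hypothesis HB : forall p mu nu w,
  `|quadf (d2metric p mu nu) w| <= B * (normq (G p) mu * normq (G p) nu) * quadf (G p) w.

Let pos p := metric_posdef c0 cG p.

Lemma metric_symE i j : (fun q => G q i j) = (fun q => G q j i).
Proof. by apply/funext => q; rewrite -[in LHS]symG mxE. Qed.

Lemma dmetric_sym p mu : (dmetric G p mu)^T = dmetric G p mu.
Proof. by apply/matrixP => i j; rewrite !mxE metric_symE. Qed.

Lemma d2metric_sym p mu nu : (d2metric p mu nu)^T = d2metric p mu nu.
Proof. by apply/matrixP => i j; rewrite !mxE metric_symE. Qed.

Lemma dmetricB p a b : dmetric G p (a - b) = dmetric G p a - dmetric G p b.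
Proof.
apply/matrixP => i j; have d := metric_differentiable sG i j p.
by rewrite !mxE !deriveE // linearB.
Qed.

Lemma is_derive_dmetric (g : R -> 'rV[R]_m) (t : R) g' mu : is_derive t (1 : R) g g' ->
  is_derive t (1 : R) (fun s => dmetric G (g s) mu) (d2metric (g t) mu g').
Proof.
move=> dg; apply/is_derive_mxP => i j; rewrite mxE.
rewrite (_ : (fun s => _) = (fun s => 'D_mu (fun q => G q i j) (g s))); last first.
  by apply/funext => s; rewrite mxE.
apply: is_derive_comp1 dg.
have [_ D] := (smS _ _ _).1 (sG i j 2%N); have [d _] := (smS _ _ _).1 (D mu); exact: d.
Qed.

(** Each of the three vectors costs a factor 2 when its norm is moved from [q] to [p], hence 8; with
    four vectors, 16 in [d2metric_bound]. *)
Lemma dmetric_bound p q a x y : comparable_metrics G p q ->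
  `|bf (dmetric G q a) x y| <= 8 * A * (normq (G p) a * (normq (G p) x * normq (G p) y)).
Proof.
move=> cpq; have [ca _] := cpq a; have [cx _] := cpq x; have [cy _] := cpq y.
have k0 : 0 <= A * normq (G q) a by rewrite mulr_ge0 ?normq_ge0.
apply: le_trans (bf_le_of_quadf (symG q) (pos q) x y (dmetric_sym q a) k0 (HA q a)) _.
rewrite (_ : 8 * A * _ = A * (2 * normq (G p) a) * (2 * normq (G p) x * (2 * normq (G p) y))); last by ring.
by rewrite ler_pM ?mulr_ge0 ?normq_ge0 ?ler_pM ?normq_ge0.
Qed.

Lemma d2metric_bound p q a b x y : comparable_metrics G p q ->
  `|bf (d2metric q a b) x y| <=
    16 * B * (normq (G p) a * normq (G p) b * (normq (G p) x * normq (G p) y)).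
Proof.
move=> cpq; have [ca _] := cpq a; have [cb _] := cpq b; have [cx _] := cpq x; have [cy _] := cpq y.
have k0 : 0 <= B * (normq (G q) a * normq (G q) b) by rewrite !mulr_ge0 ?normq_ge0.
apply: le_trans (bf_le_of_quadf (symG q) (pos q) x y (d2metric_sym q a b) k0 (HB q a b)) _.
rewrite (_ : 16 * B * _ = B * (2 * normq (G p) a * (2 * normq (G p) b)) *
   (2 * normq (G p) x * (2 * normq (G p) y))); last by ring.
by rewrite !ler_pM ?mulr_ge0 ?normq_ge0.
Qed.

Variable p0 : 'rV[R]_m.
Local Notation N0 := (normq (G p0)).

Definition near_base q := A * N0 (q - p0) <= 4^-1.

(** [near_base] is a ball for the fixed norm at [p0], hence convex, and [comparable_ball] applies on
    the whole segment. *)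
Lemma near_base_segment q1 q2 (t : R) : near_base q1 -> near_base q2 -> 0 <= t <= 1 ->
  comparable_metrics G p0 (q2 + t *: (q1 - q2)).
Proof.
move=> n1 n2 /andP[t0 t1]; apply: (comparable_ball sG c0 cG A0 HA).
rewrite (_ : _ - p0 = (1 - t) *: (q2 - p0) + t *: (q1 - p0)); last first.
  by apply/rowP => i; rewrite !mxE; ring.
apply: le_trans (_ : (1 - t) * (A * N0 (q2 - p0)) + t * (A * N0 (q1 - p0)) <= _).
  have t1' : 0 <= 1 - t by lra.
  apply: le_trans (ler_wpM2l A0 (normqD (symG p0) (pos p0) _ _)) _.
  by rewrite !normqZ // (ger0_norm t0) (ger0_norm t1') mulrDr !(mulrCA A).
by move: n1 n2; rewrite /near_base; move: (A * _) (A * _) => x y; nra.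
Qed.

Lemma metric_variation q1 q2 x y : near_base q1 -> near_base q2 ->
  `|bf (G q1) x y - bf (G q2) x y| <= 8 * A * (N0 (q1 - q2) * (N0 x * N0 y)).
Proof.
move=> n1 n2.
have [|e e01] := @MVT01 _ (fun t => bf (G (q2 + t *: (q1 - q2))) x y)
  (fun t => bf (dmetric G (q2 + t *: (q1 - q2)) (q1 - q2)) x y) 0 1 ler01.
  move=> t _; have := is_derive_bf (is_derive_metric sG (is_derive_affine q2 (q1 - q2) t))
    (is_derive_cstV x t) (is_derive_cstV y t).
  by rewrite bf0l bf0r !addr0.
rewrite scale1r scale0r addr0 (addrC q2) subrK subr0 mulr1 => ->.
exact: dmetric_bound (near_base_segment n1 n2 e01).
Qed.

Lemma dmetric_variation q1 q2 a x y : near_base q1 -> near_base q2 ->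
  `|bf (dmetric G q1 a) x y - bf (dmetric G q2 a) x y| <=
    16 * B * (N0 a * N0 (q1 - q2) * (N0 x * N0 y)).
Proof.
move=> n1 n2.
have [|e e01] := @MVT01 _ (fun t => bf (dmetric G (q2 + t *: (q1 - q2)) a) x y)
  (fun t => bf (d2metric (q2 + t *: (q1 - q2)) a (q1 - q2)) x y) 0 1 ler01.
  move=> t _; have := is_derive_bf (is_derive_dmetric a (is_derive_affine q2 (q1 - q2) t))
    (is_derive_cstV x t) (is_derive_cstV y t).
  by rewrite bf0l bf0r !addr0.
rewrite scale1r scale0r addr0 (addrC q2) subrK subr0 mulr1 => ->.
exact: d2metric_bound (near_base_segment n1 n2 e01).
Qed.

(** The acceleration is paired with itself: the two terms of [geodesic_acc_covector] give
    [3/2 * A * r ^+ 2] for its norm at [q], and comparison with [p0] doubles it. *)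
Lemma acc_bound q w (r : R) : normq (G q) w <= r -> comparable_metrics G p0 q ->
  N0 (geodesic_acc G q w) <= 3 * A * r ^+ 2.
Proof.
move=> wr cpq; set al := geodesic_acc G q w; have [_ h] := cpq al.
have r0 : 0 <= r by apply: le_trans wr; exact: normq_ge0.
have bq a x y : `|bf (dmetric G q a) x y| <= A * normq (G q) a * (normq (G q) x * normq (G q) y).
  apply: (bf_le_of_quadf (symG q) (pos q)); [exact: dmetric_sym|by rewrite mulr_ge0 ?normq_ge0|exact: HA].
have E := geodesic_acc_covector sG symG c0 cG q w al.
have : normq (G q) al ^+ 2 <= 3 / 2 * A * r ^+ 2 * normq (G q) al.
  rewrite (normq_sqr (pos q)) quadfE E.
  have := bq w w al; have := bq al w w; move: (bf _ _ _) (bf _ _ _) => u v.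
  rewrite !ler_norml => /andP[u1 u2] /andP[v1 v2].
  set X := normq (G q) al in u1 u2 v1 v2 *; set W := normq (G q) w in wr u1 u2 v1 v2 *.
  have X0 : 0 <= X by exact: normq_ge0.
  have W0 : 0 <= W by exact: normq_ge0.
  have W2 : A * (W ^+ 2 * X) <= A * (r ^+ 2 * X).
    by rewrite ler_wpM2l // ler_wpM2r // ler_sqr.
  have E1 : A * W * (W * X) = A * (W ^+ 2 * X) by ring.
  have E2 : A * X * (W * W) = A * (W ^+ 2 * X) by ring.
  rewrite E1 in v1 v2; rewrite E2 in u1 u2.
  rewrite (_ : 3 / 2 * A * r ^+ 2 * X = 3 / 2 * (A * (r ^+ 2 * X))); last by ring.
  by move: (A * _) (A * _) W2 u1 u2 v1 v2 => s1 s2; lra.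
have X0 := normq_ge0 (G q) al.
move: (normq (G q) al) h X0 => X h; rewrite le_eqVlt => /orP[/eqP X0|X0].
  move=> _; apply: le_trans h _; rewrite -X0 mulr0 !mulr_ge0 // exprn_ge0 //.
rewrite expr2 ler_pM2r // => H; apply: le_trans h _; move: (r ^+ 2) H => r2 H; lra.
Qed.

(** The difference [z] of the accelerations is paired with itself in the metric at [q1]. In the
    paired estimate the constants are [48 = 3 * 8 * 2], [96 = 3/2 * 16 * 4] and [24 = 8 * 3];
    returning to the norm at [p0] multiplies each by 4. *)
Lemma acc_variation q1 q2 a1 a2 (r : R) : near_base q1 -> near_base q2 -> 
  N0 a1 <= 2 * r -> N0 a2 <= 2 * r -> N0 (geodesic_acc G q2 a2) <= 3 * A * r ^+ 2 ->
  N0 (geodesic_acc G q1 a1 - geodesic_acc G q2 a2) <=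
    192 * A * r * N0 (a1 - a2) + (384 * B + 96 * A ^+ 2) * r ^+ 2 * N0 (q1 - q2).
Proof.
move=> n1 n2 h1 h2 h3; have E1 := geodesic_acc_covector sG symG c0 cG q1 a1; have E2 := geodesic_acc_covector sG symG c0 cG q2 a2.
move: (geodesic_acc G q1 a1) (geodesic_acc G q2 a2) E1 E2 h3 => al1 al2 E1 E2 h3.
(* The differences get opaque names, so that the bilinear forms in them are not expanded by later
   rewriting. *)
have [z Ez] : exists z, z = al1 - al2 by exists (al1 - al2).
have [d Ed] : exists d, d = a1 - a2 by exists (a1 - a2).
have [e Ee] : exists e, e = q1 - q2 by exists (q1 - q2).
rewrite -Ez -Ed -Ee.
have c1 : comparable_metrics G p0 q1.
  have := near_base_segment n1 n2 (t := 1); rewrite ler01 lexx => /(_ isT).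
  by rewrite scale1r addrC subrK.
have r0 : 0 <= r by have := normq_ge0 (G p0) a1; lra.
have key : bf (G q1) z z =
  - (bf (dmetric G q1 d) a1 z + bf (dmetric G q1 a2) d z)
  + 2^-1 * (bf (dmetric G q1 z) d a1 + bf (dmetric G q1 z) a2 d)
  - (bf (dmetric G q1 a2) a2 z - bf (dmetric G q2 a2) a2 z)
  + 2^-1 * (bf (dmetric G q1 z) a2 a2 - bf (dmetric G q2 z) a2 a2)
  - (bf (G q1) al2 z - bf (G q2) al2 z).
  have e0 : bf (G q1) z z = bf (G q1) al1 z - bf (G q1) al2 z by rewrite -bfBl -Ez.
  have e1 := E1 z; have e2 := E2 z.
  have e3 : bf (dmetric G q1 d) a1 z = bf (dmetric G q1 a1) a1 z - bf (dmetric G q1 a2) a1 z.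
    by rewrite -bfBm -dmetricB Ed.
  have e4 : bf (dmetric G q1 a2) d z = bf (dmetric G q1 a2) a1 z - bf (dmetric G q1 a2) a2 z.
    by rewrite -bfBl Ed.
  have e5 : bf (dmetric G q1 z) d a1 = bf (dmetric G q1 z) a1 a1 - bf (dmetric G q1 z) a2 a1.
    by rewrite -bfBl Ed.
  have e6 : bf (dmetric G q1 z) a2 d = bf (dmetric G q1 z) a2 a1 - bf (dmetric G q1 z) a2 a2.
    by rewrite -bfBr Ed.
  exact: difference_identity e0 e1 e2 e3 e4 e5 e6.
have k1 := normq_ge0 (G p0) z; have k2 := normq_ge0 (G p0) d; have k3 := normq_ge0 (G p0) e.
have l1 := normq_ge0 (G p0) a1; have l2 := normq_ge0 (G p0) a2; have l3 := normq_ge0 (G p0) al2.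
have m1 : `|bf (dmetric G q1 d) a1 z| <= 8 * A * (2 * r) * (N0 d * N0 z).
  apply: le_trans (dmetric_bound _ _ _ c1) _; rewrite -!mulrA !ler_wpM2l //.
  by rewrite mulrCA ![2 * (r * _)]mulrA ler_wpM2r // mulr_ge0.
have m2 : `|bf (dmetric G q1 a2) d z| <= 8 * A * (2 * r) * (N0 d * N0 z).
  apply: le_trans (dmetric_bound _ _ _ c1) _; rewrite -!mulrA !ler_wpM2l //.
  by rewrite ![2 * (r * _)]mulrA ler_wpM2r // mulr_ge0.
have m3 : `|bf (dmetric G q1 z) d a1| <= 8 * A * (2 * r) * (N0 d * N0 z).
  apply: le_trans (dmetric_bound _ _ _ c1) _; rewrite -!mulrA !ler_wpM2l //.
  by rewrite mulrA mulrC ![2 * (r * _)]mulrA [N0 z * _]mulrC ler_wpM2r // mulr_ge0.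
have m4 : `|bf (dmetric G q1 z) a2 d| <= 8 * A * (2 * r) * (N0 d * N0 z).
  apply: le_trans (dmetric_bound _ _ _ c1) _; rewrite -!mulrA !ler_wpM2l //.
  by rewrite mulrCA ![2 * (r * _)]mulrA [N0 z * _]mulrC ler_wpM2r // mulr_ge0.
have aa : N0 a2 * N0 a2 <= 4 * r ^+ 2.
  by rewrite (_ : 4 * r ^+ 2 = (2 * r) * (2 * r)) ?ler_pM //; ring.
have m5 : `|bf (dmetric G q1 a2) a2 z - bf (dmetric G q2 a2) a2 z| <= 64 * B * r ^+ 2 * (N0 e * N0 z).
  apply: le_trans (dmetric_variation _ _ _ n1 n2) _.
  rewrite (_ : N0 a2 * _ * _ = (N0 a2 * N0 a2) * (N0 e * N0 z)); last by rewrite Ee; ring.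
  rewrite (_ : 64 * B * r ^+ 2 * _ = 16 * B * (4 * r ^+ 2 * (N0 e * N0 z))); last by ring.
  by rewrite ler_wpM2l ?mulr_ge0 // ler_wpM2r // mulr_ge0.
have m6 : `|bf (dmetric G q1 z) a2 a2 - bf (dmetric G q2 z) a2 a2| <= 64 * B * r ^+ 2 * (N0 e * N0 z).
  apply: le_trans (dmetric_variation _ _ _ n1 n2) _.
  rewrite (_ : N0 z * _ * _ = (N0 a2 * N0 a2) * (N0 e * N0 z)); last by rewrite Ee; ring.
  rewrite (_ : 64 * B * r ^+ 2 * _ = 16 * B * (4 * r ^+ 2 * (N0 e * N0 z))); last by ring.
  by rewrite ler_wpM2l ?mulr_ge0 // ler_wpM2r // mulr_ge0.
have m7 : `|bf (G q1) al2 z - bf (G q2) al2 z| <= 24 * A ^+ 2 * r ^+ 2 * (N0 e * N0 z).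
  apply: le_trans (metric_variation _ _ n1 n2) _; rewrite -Ee.
  rewrite (_ : 24 * A ^+ 2 * r ^+ 2 * _ = 8 * A * (N0 e * (3 * A * r ^+ 2 * N0 z))); last by ring.
  by rewrite ler_wpM2l ?mulr_ge0 // ler_wpM2l // ler_wpM2r.
have tot : bf (G q1) z z <= 48 * A * r * (N0 d * N0 z) + (96 * B + 24 * A ^+ 2) * r ^+ 2 * (N0 e * N0 z).
  rewrite (_ : 48 * A * r * (N0 d * N0 z) = 3 * (8 * A * (2 * r) * (N0 d * N0 z))); last by ring.
  rewrite (_ : (96 * B + 24 * A ^+ 2) * r ^+ 2 * (N0 e * N0 z) = 
    3 / 2 * (64 * B * r ^+ 2 * (N0 e * N0 z)) + 24 * A ^+ 2 * r ^+ 2 * (N0 e * N0 z)); last by field.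
  rewrite key; exact: seven_term_bound m1 m2 m3 m4 m5 m6 m7.
have [_ hz] := c1 z.
have hz2 : N0 z ^+ 2 <= 4 * bf (G q1) z z.
  rewrite -quadfE -(normq_sqr (pos q1)) (_ : 4 * _ = (2 * normq (G q1) z) ^+ 2); last by rewrite exprMn; ring.
  by rewrite ler_sqr ?nnegrE // mulr_ge0 // normq_ge0.
have H : N0 z ^+ 2 <= (192 * A * r * N0 d + (384 * B + 96 * A ^+ 2) * r ^+ 2 * N0 e) * N0 z.
  apply: le_trans hz2 _; rewrite (_ : _ * N0 z = 4 * (48 * A * r * (N0 d * N0 z) + (96 * B + 24 * A ^+ 2) * r ^+ 2 * (N0 e * N0 z))); last by ring.
  by rewrite ler_wpM2l.
move: k1; rewrite le_eqVlt => /orP[/eqP <-|zp]; last by move: H; rewrite expr2 ler_pM2r.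
have x1 : 0 <= 192 * A * r * N0 d := mulr_ge0 (mulr_ge0 (mulr_ge0 (ler0n R 192) A0) r0) k2.
have x2 : 0 <= (384 * B + 96 * A ^+ 2) * r ^+ 2.
  apply: mulr_ge0 (exprn_ge0 2 r0); apply: addr_ge0 (mulr_ge0 (ler0n R 384) B0) _.
  exact: mulr_ge0 (ler0n R 96) (exprn_ge0 2 A0).
exact: addr_ge0 x1 (mulr_ge0 x2 k3).
Qed.

End GeodesicEstimates.

Lemma is_derive_lower (R : realType) (h : R -> R) (d k del : R) : 0 < del ->
  is_derive (0 : R) (1 : R) h d -> h 0 = 0 -> (forall s, 0 < s -> s < del -> s * k <= h s) -> k <= d.
Proof.
move=> del0 [dh E] h0 H; apply/ler_addgt0Pl => e e0.
have df : differentiable h 0 by apply/derivable1_diffP.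
have /nbhs_ballP[d1 d10 Hd] := differentiable_epsE df e0.
pose s := Num.min (d1 / 2) (del / 2).
have s0 : 0 < s by rewrite lt_min !divr_gt0.
have sd : s < del by rewrite gt_min [del / 2 < _]ltr_pdivrMr // ltr_pMr // ltr1n orbT.
have sd1 : s < d1 by rewrite gt_min ltr_pdivrMr // ltr_pMr // ltr1n.
have := Hd s; rewrite /= -ball_normE /= sub0r normrN gtr0_norm // => /(_ sd1).
have -> : 'd h 0 s = s * d by rewrite -E deriveE // -[s in LHS]mulr1 linearZ.
rewrite addr0 h0 subr0 ler_norml => /andP[_ h2].
have := H s s0 sd; rewrite -(ler_pM2l s0 k) mulrDr; move: (s * k) (s * d) (h s) h2 => x y z h2 h3.
by rewrite [s * e]mulrC; lra.
Qed.

(** * The exponential map on a ball of definite radius *)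

Section ExponentialEstimates.
Context {R : realType} {m : nat}.
Variable G : 'rV[R]_m -> 'M[R]_m.
Hypothesis sG : forall i j, smooth setT (fun p => G p i j).
Hypothesis symG : forall p, (G p)^T = G p.
Hypothesis perG : periodic G.
Variable c : R.
Hypothesis c0 : 0 < c.
Hypothesis cG : forall p w, c * dotp w w <= quadf (G p) w.
Variables A B : R.
Hypotheses (A0 : 0 <= A) (B0 : 0 <= B).
Hypothesis HA : forall p mu w, `|quadf (dmetric G p mu) w| <= A * normq (G p) mu * quadf (G p) w.
Hypothesis HB : forall p mu nu w,
  `|quadf (d2metric G p mu nu) w| <= B * (normq (G p) mu * normq (G p) nu) * quadf (G p) w.

Let pos p := metric_posdef c0 cG p.

Variable p0 : 'rV[R]_m.
Local Notation N0 := (normq (G p0)).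
Local Notation X := (geodesic_field G).

Lemma energy_constant z (t : R) : solution X z -> 0 <= t ->
  normq (G (lsubmx (z t))) (rsubmx (z t)) = normq (G (lsubmx (z 0))) (rsubmx (z 0)).
Proof.
move=> sz t0; rewrite /normq; congr Num.sqrt.
apply: (@derive0_eq R (fun s => energy G (z s)) 0 t t0) => u _.
rewrite -(energy_conserved sG symG c0 cG (z u)); apply: is_derive_comp1 (sz u).
by have [d _] := (smS _ _ _).1 (energy_smooth sG 1%N); exact: d.
Qed.

(** A geodesic has constant speed, so by [metric_along] the metric changes by a bounded factor along
    it and the speed bound transfers to the norm at [p0]. The bound 1/8 on [A * r] keeps a
    displacement of [2 * r] within [near_base]. *)
Lemma geodesic_bounds z (r : R) : solution X z -> lsubmx (z 0) = p0 ->
  N0 (rsubmx (z 0)) <= r -> A * r <= 8^-1 ->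
  forall t : R, 0 <= t <= 1 ->
  [/\ near_base G A p0 (lsubmx (z t)), N0 (rsubmx (z t)) <= 2 * r,
      N0 (lsubmx (z t) - p0) <= 2 * r &
      N0 (geodesic_acc G (lsubmx (z t)) (rsubmx (z t))) <= 3 * A * r ^+ 2].
Proof.
move=> sz zp zr Ar.
have en (t : R) : 0 <= t <= 1 -> normq (G (lsubmx (z t))) (rsubmx (z t)) <= r.
  by move=> /andP[t0 _]; rewrite (energy_constant sz t0) zp.
have cmp (t : R) : 0 <= t <= 1 -> comparable_metrics G p0 (lsubmx (z t)).
  move=> t01; apply: (comparable_quadf c0 cG) => w; rewrite -zp.
  apply: (metric_along sG c0 cG A0 HA (s := r) (g := fun s => lsubmx (z s)) (g' := fun s => rsubmx (z s)) w) t01 => [s _|s|]; first exact: solution_velocity sz s.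
    exact: en.
  by move: (A * r) Ar => y; lra.
have v2 (t : R) : 0 <= t <= 1 -> N0 (rsubmx (z t)) <= 2 * r.
  move=> t01; have [_ h] := cmp t t01 (rsubmx (z t)); apply: le_trans h _.
  by rewrite ler_wpM2l // en.
have r0 : 0 <= r by apply: le_trans zr; exact: normq_ge0.
have disp (t : R) : 0 <= t <= 1 -> N0 (lsubmx (z t) - p0) <= 2 * r.
  move=> /andP[t0 t1]; apply: le_trans (_ : 2 * r * t <= _); last by rewrite ler_piMr // mulr_ge0.
  have H := normq_displacement symG c0 cG (p := p0) (x := fun s => lsubmx (z s)) (x' := fun s => rsubmx (z s)) (k := 2 * r) t0.
  rewrite zp in H; apply: H => u /andP[u0 ut]; first exact: solution_velocity sz u.
  by apply: v2; rewrite u0 (le_trans ut).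
move=> t t01; split; [|exact: v2|exact: disp|].
  rewrite /near_base; apply: le_trans (ler_wpM2l A0 (disp t t01)) _; rewrite mulrCA.
  by move: (A * r) Ar => y; lra.
exact: (acc_bound sG symG c0 cG A0 HA (en t t01) (cmp t t01)).
Qed.

Lemma bound_attained (f : R -> R) : (forall t : R, {for t, continuous f}) ->
  exists2 e : R, 0 <= e <= 1 & forall t : R, 0 <= t <= 1 -> f t <= f e.
Proof.
move=> cf; have [|e eI He] := @EVT_max R f 0 1 ler01.
  by apply: continuous_within_itv => t _; exact: cf.
by exists e => [|t t01]; [move: eI; rewrite in_itv|apply: He; rewrite in_itv].
Qed.

Variable r : R.
(** These make each of the two coefficients in [acc_variation] at most 1/6; [1152 = 6 * 192]. *)
Hypotheses (r0 : 0 <= r) (Ar : 1152 * (A * r) <= 1) (Br : 6 * ((384 * B + 96 * A ^+ 2) * r ^+ 2) <= 1).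

(* If [M] is the maximal relative speed of the two geodesics, their relative
   acceleration is at most [M / 3], so [M <= M / 3 + N0 (w1 - w2)]. *)
Lemma exp_map_expansion w1 w2 : N0 w1 <= r -> N0 w2 <= r ->
  N0 (exp_map G p0 w1 - exp_map G p0 w2 - (w1 - w2)) <= 2^-1 * N0 (w1 - w2).
Proof.
move=> h1 h2; have [_ ex _] := geodesic_field_complete sG symG perG c0 cG.
have [z1 z10 s1] := ex (row_mx p0 w1); have [z2 z20 s2] := ex (row_mx p0 w2).
have e1 := exp_mapE sG symG perG c0 cG s1; have e2 := exp_mapE sG symG perG c0 cG s2.
have l1 : lsubmx (z1 0) = p0 by rewrite z10 row_mxKl.
have l2 : lsubmx (z2 0) = p0 by rewrite z20 row_mxKl.
have r1 : rsubmx (z1 0) = w1 by rewrite z10 row_mxKr.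
have r2 : rsubmx (z2 0) = w2 by rewrite z20 row_mxKr.
rewrite l1 r1 in e1; rewrite l2 r2 in e2; rewrite e1 e2.
have Ar8 : A * r <= 8^-1 by move: (A * r) Ar => y; lra.
have b1 := geodesic_bounds s1 l1; rewrite r1 in b1; move/(_ r h1 Ar8): b1 => b1.
have b2 := geodesic_bounds s2 l2; rewrite r2 in b2; move/(_ r h2 Ar8): b2 => b2.
pose y t := lsubmx (z1 t) - lsubmx (z2 t); pose y' t := rsubmx (z1 t) - rsubmx (z2 t).
pose y'' t := geodesic_acc G (lsubmx (z1 t)) (rsubmx (z1 t)) - geodesic_acc G (lsubmx (z2 t)) (rsubmx (z2 t)).
have dy (t : R) : is_derive t (1 : R) y (y' t).
  exact: (is_deriveB (solution_velocity s1 t) (solution_velocity s2 t)).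
have dy' (t : R) : is_derive t (1 : R) y' (y'' t).
  exact: (is_deriveB (solution_acc s1 t) (solution_acc s2 t)).
have y0 : y 0 = 0 by rewrite /y l1 l2 subrr.
have y'0 : y' 0 = w1 - w2 by rewrite /y' r1 r2.
have cN (t : R) : {for t, continuous (fun s => quadf (G p0) (y' s))}.
  exact: is_derive_continuous (is_derive_bf (is_derive_cstV (G p0) t) (dy' t) (dy' t)).
have [e e01 He] := bound_attained cN; pose M := N0 (y' e).
have M0 : 0 <= M by exact: normq_ge0.
have yM (t : R) : 0 <= t <= 1 -> N0 (y' t) <= M.
  by move=> t01; rewrite /M /normq ler_wsqrtr // He.
have yM1 (t : R) : 0 <= t <= 1 -> N0 (y t) <= M.
  move=> /andP[t0 t1]; apply: le_trans (_ : M * t <= _); last by rewrite ler_piMr.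
  have H := normq_displacement symG c0 cG (p := p0) (x := y) (x' := y') (k := M) t0.
  rewrite y0 subr0 in H; apply: H => u /andP[u0 ut].
  by apply: yM; rewrite u0 (le_trans ut).
have acc (t : R) : 0 <= t <= 1 -> N0 (y'' t) <= 3^-1 * M.
  move=> t01; have [n1 v1 _ _] := b1 t t01; have [n2 v2 _ a2] := b2 t t01.
  apply: le_trans (acc_variation sG symG c0 cG A0 B0 HA HB n1 n2 v1 v2 a2) _.
  have k1 := yM t t01; have k2 := yM1 t t01; rewrite -/(y t) -/(y' t).
  have k3 := normq_ge0 (G p0) (y' t); have k4 := normq_ge0 (G p0) (y t).
  have c1 : 192 * A * r <= 6^-1 by rewrite -mulrA; move: (A * r) Ar => x; lra.
  have c2 : (384 * B + 96 * A ^+ 2) * r ^+ 2 <= 6^-1 by move: (_ * r ^+ 2) Br => x; lra.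
  apply: le_trans (_ : 6^-1 * M + 6^-1 * M <= _); last by lra.
  apply: lerD; apply: le_trans (ler_wpM2r _ _) (ler_wpM2l _ _); first [exact: k3|exact: k4|exact: c1|exact: c2|exact: k1|exact: k2|by rewrite invr_ge0 ler0n].
have dev (t : R) : 0 <= t <= 1 -> N0 (y' t - (w1 - w2)) <= 3^-1 * M.
  move=> /andP[t0 t1]; rewrite -y'0; apply: le_trans (_ : 3^-1 * M * t <= _); last by rewrite ler_piMr // mulr_ge0 // invr_ge0.
  apply: (normq_displacement symG c0 cG (p := p0) (x := y') (x' := y'') t0) => u /andP[u0 ut].
  by apply: acc; rewrite u0 (le_trans ut).
have Mle : M <= 3^-1 * M + N0 (w1 - w2).
  apply: le_trans (lerD (dev e e01) (lexx (N0 (w1 - w2)))).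
  by apply: le_trans (normqD (symG p0) (pos p0) _ _); rewrite subrK.
(* [Mle] gives [M <= 3/2 * N0 (w1 - w2)], so a third of [M] is the claimed bound. *)
apply: le_trans (_ : 3^-1 * M <= _); last by move: (N0 (w1 - w2)) Mle => x; lra.
have -> : lsubmx (z1 1) - lsubmx (z2 1) - (w1 - w2) = (fun t => y t - t *: (w1 - w2)) 1 - (fun t => y t - t *: (w1 - w2)) 0.
  by rewrite /= y0 scale0r scale1r subr0 subr0.
rewrite -[leRHS]mulr1; apply: (normq_displacement symG c0 cG (p := p0) (x := fun t => y t - t *: (w1 - w2)) (x' := fun t => y' t - (w1 - w2)) ler01) => u u01.
  apply: (is_deriveB (dy u)); have := is_derive_affine 0 (w1 - w2) u.
  by congr (is_derive _ _ _ _); apply/funext => s; rewrite add0r.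
exact: dev.
Qed.

Lemma exp_map_displacement w : N0 w <= r -> N0 (exp_map G p0 w - p0) <= 2 * r.
Proof.
move=> wr; have [_ ex _] := geodesic_field_complete sG symG perG c0 cG.
have [z z0 s] := ex (row_mx p0 w).
have e := exp_mapE sG symG perG c0 cG s; rewrite z0 row_mxKl row_mxKr in e; rewrite e.
have l0 : lsubmx (z 0) = p0 by rewrite z0 row_mxKl.
have r00 : N0 (rsubmx (z 0)) <= r by rewrite z0 row_mxKr.
have Ar8 : A * r <= 8^-1 by move: (A * r) Ar => y; lra.
by have [|_ _ ->//] := geodesic_bounds s l0 r00 Ar8 (t := 1); rewrite ler01 lexx.
Qed.

(** The expansion estimate in the form of strong monotonicity, from which both injectivity and the
    immersion property follow. *)
Lemma exp_map_lower w1 w2 : N0 w1 <= r -> N0 w2 <= r ->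
  2^-1 * quadf (G p0) (w1 - w2) <= bf (G p0) (exp_map G p0 w1 - exp_map G p0 w2) (w1 - w2).
Proof.
move=> h1 h2; have := exp_map_expansion h1 h2.
set d := w1 - w2; set E := exp_map G p0 w1 - exp_map G p0 w2 => H.
have := bf_le (symG p0) (pos p0) (E - d) d; rewrite bfBl -quadfE -(normq_sqr (pos p0)).
rewrite ler_norml => /andP[H1 _]; have := ler_wpM2r (normq_ge0 (G p0) d) H.
have E2 : 2^-1 * N0 d * N0 d = 2^-1 * N0 d ^+ 2 by ring.
by rewrite E2; move: (N0 d ^+ 2) (N0 (E - d) * N0 d) (bf _ _ _) H1 => a b e; lra.
Qed.

Lemma exp_map_inj w1 w2 : N0 w1 <= r -> N0 w2 <= r -> exp_map G p0 w1 = exp_map G p0 w2 -> w1 = w2.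
Proof.
move=> h1 h2 E; have := exp_map_lower h1 h2; rewrite E subrr bf0l => H.
apply/eqP/negPn/negP; rewrite -subr_eq0 => /(pos p0); lra.
Qed.

(** Strong monotonicity between [w] and [w + s *: z], divided by [s ^+ 2], bounds from below the
    derivative of the pairing with [z]; the strict inequality on [w] leaves room for small [s]. *)
Lemma exp_map_immersion w z : N0 w < r -> 'D_z (exp_map G p0) w = 0 -> z = 0.
Proof.
move=> wr Dz; apply/eqP/negPn/negP => z0.
have q0 := pos p0 z0; have nz := normq_gt0 (pos p0) z0.
have df : differentiable (exp_map G p0) w.
  by have [d _] := (smS _ _ _).1 (exp_map_smooth sG symG perG c0 cG p0 1%N); exact: d.
pose h s := bf (G p0) (exp_map G p0 (w + s *: z) - exp_map G p0 w) z.
have dh : is_derive (0 : R) (1 : R) h 0.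
  have d1 : is_derive (0 : R) (1 : R) (fun s : R => exp_map G p0 (w + s *: z) - exp_map G p0 w) (0 - 0).
    apply: (@is_deriveB _ _ _ _ (cst (exp_map G p0 w))).
    rewrite -Dz; have := @is_derive_line _ _ _ (exp_map G p0) w z 0.
    by rewrite scale0r addr0; apply; exact: diff_derivable.
  have := is_derive_bf (is_derive_cstV (G p0) 0) d1 (is_derive_cstV z 0).
  by rewrite bf0r subr0 bf0l /bf mulmx0 mul0mx mxE !addr0.
have h0 : h 0 = 0 by rewrite /h scale0r addr0 subrr bf0l.
have k0 : 0 < (r - N0 w) / N0 z by rewrite divr_gt0 // subr_gt0.
have q0' : 0 < 2^-1 * quadf (G p0) z by rewrite mulr_gt0 // invr_gt0.
have : 2^-1 * quadf (G p0) z <= 0; last by rewrite leNgt q0'.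
apply: (is_derive_lower k0 dh h0) => s s0 sk.
have ws : N0 (w + s *: z) <= r.
  apply: le_trans (normqD (symG p0) (pos p0) _ _) _; rewrite normqZ gtr0_norm //.
  by move: sk; rewrite ltr_pdivlMr // => /ltW; lra.
have := exp_map_lower ws (ltW wr); rewrite addrAC subrr add0r quadfZ bfZr -/(h s).
by rewrite mulrCA expr2 -mulrA ler_pM2l // mulrCA.
Qed.

End ExponentialEstimates.

(** * Passage to the torus *)

Lemma lattice_eq_small (R : realType) m (x y : 'rV[R]_m) : lattice_eq x y -> `|x - y| < 1 -> x = y.
Proof.
move=> L xy; apply/rowP => i; have /intrP[k kE] := L i.
have := le_lt_trans (norm_coord_le (x - y) i) xy; rewrite !mxE kE.
rewrite -intr_norm -[1]/(1%:~R) ltr_int => k1.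
have k0 : k = 0 by apply/eqP; rewrite -absz_eq0; move: k1; rewrite -abszE ltz_nat ltnS leqn0.
by apply/eqP; rewrite -subr_eq0 kE k0.
Qed.

Lemma lattice_eq_sym (R : realType) m (x y : 'rV[R]_m) : lattice_eq x y -> lattice_eq y x.
Proof. by move=> L i; rewrite -opprB rpredN; exact: L. Qed.

Lemma lattice_eq_trans (R : realType) m (x y z : 'rV[R]_m) : lattice_eq x y -> lattice_eq y z -> lattice_eq x z.
Proof.
move=> L1 L2 i; rewrite (_ : _ - _ = (x 0 i - y 0 i) + (y 0 i - z 0 i)); last by ring.
exact: rpredD (L1 i) (L2 i).
Qed.

Lemma smooth_on_smooth (R : realType) (V W : normedModType R) (U : set V) (f : V -> W) :
  open U -> smooth U f -> smooth_on U f.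
Proof. by move=> oU sf; exists U; split=> // k; exact: sm_Ck. Qed.

Lemma torus_diffeo_of_injective (R : realType) m (f : 'rV[R]_m -> 'rV[R]_m) (U : set 'rV[R]_m) :
  open U -> smooth setT f ->
  (forall w1 w2, U w1 -> U w2 -> lattice_eq (f w1) (f w2) -> w1 = w2) ->
  (forall w z, U w -> 'D_z f w = 0 -> z = 0) ->
  torus_diffeo_onto_image U f.
Proof.
move=> oU sf injL derf.
have inj w1 w2 : U w1 -> U w2 -> f w1 = f w2 -> w1 = w2.
  by move=> U1 U2 E; apply: injL => // i; rewrite E subrr.
have oI : open (f @` U) := open_image sf oU inj derf.
pose ginv y := get [set w | U w /\ f w = y].
have ginvf w : U w -> ginv (f w) = w.
  move=> Uw; have [] := @getPex _ [set w' | U w' /\ f w' = f w]; first by exists w.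
  by rewrite -/(ginv (f w)) => U1 E; exact: inj.
have sginv := inverse_smooth sf oU inj derf ginvf.
pose g q := get [set w | U w /\ lattice_eq q (f w)].
have gE w q : U w -> lattice_eq q (f w) -> g q = w.
  move=> Uw L; have [] := @getPex _ [set w' | U w' /\ lattice_eq q (f w')]; first by exists w.
  rewrite -/(g q) => U1 E; apply: injL => //.
  exact: lattice_eq_trans (lattice_eq_sym E) L.
pose S (k q : 'rV[R]_m) := (f @` U) (q - k).
have oS k : open (S k).
  have cs : continuous (fun q : 'rV[R]_m => q - k).
    by move=> q; apply: continuousB; [exact: cvg_id|exact: cst_continuous].
  exact: (open_comp (fun q _ => cs q) oI).
have SL (k q w : 'rV[R]_m) : (forall i, k 0 i \is a Num.int) -> f w = q - k -> lattice_eq q (f w).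
  move=> kint E i; rewrite E !mxE opprD opprK addrA subrr add0r; exact: kint.
pose V := [set q | exists2 w, U w & lattice_eq q (f w)].
have VS (q : 'rV[R]_m) : V q -> exists k : 'rV[R]_m, [/\ (forall i, k 0 i \is a Num.int), S k q & S k `<=` V].
  move=> [w Uw L]; have kint i : (q - f w) 0 i \is a Num.int by rewrite !mxE; exact: L.
  exists (q - f w); split=> //.
    by rewrite /S opprB addrC subrK; exists w.
  by move=> q' [w' Uw' E]; exists w' => //; exact: SL E.
have oV : open V.
  rewrite openE => q /VS[k [_ Sq SV]]; apply: filterS SV _.
  exact: open_nbhs_nbhs.
split; [exact: oV|by exists setT; split=> [||k]; [exact: openT|exact: subsetT|exact: sm_Ck]|].
exists g; last by move=> w q; exact: gE.
apply: smooth_on_smooth => // n; apply: sm_local => q /VS[k [kint Sq SV]].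
exists (S k) => //; apply: (sm_ext (oS k) (f := fun q => ginv (q - k))) => [q' [w Uw E]|].
  by rewrite -E ginvf // (gE w) //; exact: SL E.
apply: (sm_comp_rV (oS k) oI (fun q H => H) (sginv n)).
by apply: (smB (oS k)); [exact: sm_id (oS k)|exact: sm_cst].
Qed.

(** * Lower bound on the injectivity radius *)

Section InjectivityRadius.
Context {R : realType} {m : nat}.
Variable G : 'rV[R]_m -> 'M[R]_m.
Hypothesis sG : forall i j, smooth setT (fun p => G p i j).
Hypothesis symG : forall p, (G p)^T = G p.
Hypothesis perG : periodic G.
Variable c : R.
Hypothesis c0 : 0 < c.
Hypothesis cG : forall p w, c * dotp w w <= quadf (G p) w.
Variables A B : R.
Hypotheses (A0 : 0 <= A) (B0 : 0 <= B).
Hypothesis HA : forall p mu w, `|quadf (dmetric G p mu) w| <= A * normq (G p) mu * quadf (G p) w.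
Hypothesis HB : forall p mu nu w,
  `|quadf (d2metric G p mu nu) w| <= B * (normq (G p) mu * normq (G p) nu) * quadf (G p) w.

(** A displacement of length at most [2 * r] in the metric has sup norm at most 1/3 when
    [36 * r ^+ 2 <= c]. Two endpoints are then less than 1 apart, so they coincide once they differ
    by a lattice vector. *)
Lemma injectivity_radius_ge p0 (r : R) : 0 < r -> 1152 * (A * r) <= 1 ->
  6 * ((384 * B + 96 * A ^+ 2) * r ^+ 2) <= 1 -> 36 * r ^+ 2 <= c ->
  (r%:E <= injectivity_radius G p0)%E.
Proof.
move=> r0 Ar Br cr; apply: ereal_sup_ubound; exists r => //; split=> //.
have ur w : tangent_ball G p0 r w -> normq (G p0) w < r.
  rewrite /tangent_ball /= => H; rewrite -[r]gtr0_norm // -sqrtr_sqr.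
  by rewrite ltr_sqrt // exprn_gt0.
apply: torus_diffeo_of_injective.
- have cq : continuous (quadf (G p0)).
    move=> w; apply: (@sm_continuous R 'rV[R]_m R 0%N setT (quadf (G p0)) w) => //.
    apply: (@sm_eq _ _ _ _ _ (fun z : 'rV[R]_m => \sum_i \sum_j G p0 i j * (z 0 i * z 0 j))).
      by move=> z; rewrite quadfE bfE.
    apply: (sm_sum openT) => i _; apply: (sm_sum openT) => j _.
    apply: (smM openT); first exact: sm_cst.
    by apply: (smM openT); exact: sm_coord.
  exact: (open_comp (f := quadf (G p0)) (D := [set x : R | x < r ^+ 2]) (fun w _ => cq w) (@open_lt R (r ^+ 2))).
- exact: (exp_map_smooth sG symG perG c0 cG p0).
- move=> w1 w2 /ur/ltW u1 /ur/ltW u2 L.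
  have disp w : normq (G p0) w <= r -> `|exp_map G p0 w - p0| <= 3^-1.
    move=> wr; have r2 : 0 <= 2 * r by rewrite mulr_ge0 // ltW.
    have := exp_map_displacement sG symG perG c0 cG A0 HA Ar wr.
    rewrite -(@ler_sqr R) ?nnegrE ?normq_ge0 // (normq_sqr (metric_posdef c0 cG p0)) => H.
    have := le_trans (metric_ge c0 cG p0 _) H; rewrite exprMn => H2.
    rewrite -(@ler_sqr R) ?nnegrE ?invr_ge0 // -(ler_pM2l c0); apply: le_trans H2 _.
    rewrite (_ : 2 ^+ 2 = 4); last by ring.
    rewrite (_ : 3^-1 ^+ 2 = 9^-1); last by field.
    by move: (r ^+ 2) cr => x; lra.
  apply: (exp_map_inj sG symG perG c0 cG A0 B0 HA HB Ar Br u1 u2).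
  apply: lattice_eq_small => //; apply: le_lt_trans (_ : 3^-1 + 3^-1 < 1); last by lra.
  rewrite (_ : _ - _ = (exp_map G p0 w1 - p0) - (exp_map G p0 w2 - p0)); last first.
    by apply/rowP => i; rewrite !mxE; ring.
  by apply: le_trans (ler_normB _ _) _; apply: lerD; exact: disp.
- move=> w z /ur wr; exact: (exp_map_immersion sG symG perG c0 cG A0 B0 HA HB Ar Br wr).
Qed.

End InjectivityRadius.

(** * Legendre transform *)

Lemma derive_coord (R : realType) m N (F : 'rV[R]_m -> 'rV[R]_N) x z j : differentiable F x ->
  ('D_z F x) 0 j = 'D_z (fun y => F y 0 j) x.
Proof.
move=> dF; have d : derivable F x z by exact: diff_derivable.
by rewrite derive_mx // mxE.
Qed.

Lemma dotpE (R : realType) m (w z : 'rV[R]_m) : dotp w z = bf 1%:M w z.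
Proof. by rewrite /bf mulmx1 mxE; apply: eq_bigr => i _; rewrite mxE. Qed.

Lemma derive_dotp_grad (R : realType) m (f : 'rV[R]_m -> R) x z : differentiable f x ->
  'D_z f x = dotp z (grad f x).
Proof. by move=> df; rewrite derive_sum_coord //; apply: eq_bigr => i _; rewrite mxE. Qed.

Lemma bf0m (R : realType) m (w z : 'rV[R]_m) : bf 0 w z = 0.
Proof. by rewrite /bf mulmx0 mul0mx mxE. Qed.

Lemma derive_line0 (R : realType) (V W : normedModType R) (F : V -> W) x z :
  'D_z F x = 'D_1 (fun s : R => F (x + s *: z)) 0.
Proof.
have E : (fun h : R => h^-1 *: ((F \o shift x) (h *: z) - F x)) =
  (fun h : R => h^-1 *: (((fun s : R => F (x + s *: z)) \o shift 0) (h *: 1) - F (x + 0 *: z))).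
  by apply/funext => h /=; rewrite addr0 scale0r addr0 [h *: 1]mulr1 [x + _]addrC.
by rewrite /derive E.
Qed.

Section LegendreTransform.
Context {R : realType} {m : nat}.
Variable v : 'rV[R]_m -> R.
Hypothesis sv : smooth setT v.
Hypothesis pv : forall xi, posdefmx (hess v xi).
Hypothesis coercive : forall x : 'rV[R]_m, exists r : R, forall xi, r < `|xi| -> v 0 <= v xi - dotp x xi.

Local Notation E := 'rV[R]_m.

Lemma potential_differentiable xi : differentiable v xi.
Proof. by have [d _] := (smS _ _ _).1 (sv 1%N); exact: d. Qed.

Lemma grad_smooth : smooth setT (grad v).
Proof.
move=> k; apply/(sm_mxP openT) => i0 i; have [_ D] := (smS _ _ _).1 (sv k.+1).
by apply: sm_eq (D (delta_mx 0 i)) => x; rewrite mxE.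
Qed.

Lemma grad_differentiable xi : differentiable (grad v) xi.
Proof. by have [d _] := (smS _ _ _).1 (grad_smooth 1%N); exact: d. Qed.

Lemma hess_sym xi : (hess v xi)^T = hess v xi.
Proof. by apply/matrixP => i j; rewrite !mxE; apply: (schwarz _ _ openT I (sv 2%N)). Qed.

Lemma jac_grad xi : jac (grad v) xi = hess v xi.
Proof.
apply/matrixP => i j; rewrite !mxE derive_coord; last exact: grad_differentiable.
by rewrite (_ : (fun y => _) = partial j v) //; apply/funext => y; rewrite mxE.
Qed.

Lemma derive_grad z xi : 'D_z (grad v) xi = z *m hess v xi.
Proof. by rewrite (derive_jac grad_smooth) jac_grad. Qed.

Lemma grad_immersion xi z : setT xi -> 'D_z (grad v) xi = 0 -> z = 0.
Proof.
move=> _; rewrite derive_grad => H; apply/eqP/negPn/negP => /(pv xi).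
by rewrite quadfE /bf H mul0mx mxE ltxx.
Qed.

Lemma is_derive_grad_line xi z (t : R) :
  is_derive t (1 : R) (fun s : R => grad v (xi + s *: z)) (z *m hess v (xi + t *: z)).
Proof.
rewrite -derive_grad; apply: is_derive_line; apply: diff_derivable; exact: grad_differentiable.
Qed.

(** The gradient of a strictly convex function is strictly monotone along the segment joining the
    two points. *)
Lemma grad_inj a b : setT a -> setT b -> grad v a = grad v b -> a = b.
Proof.
move=> _ _ ab; set z := a - b.
have [|s _] := @MVT01 _ (fun s => bf 1%:M (grad v (b + s *: z)) z)
   (fun s => quadf (hess v (b + s *: z)) z) 0 1 ler01.
  move=> s _; have := is_derive_bf (is_derive_cstV 1%:M s) (is_derive_grad_line b z s) (is_derive_cstV z s).
  by rewrite bf0r bf0m addr0 add0r /bf mulmx1.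
rewrite scale1r scale0r addr0 /z (addrC b) subrK ab subrr subr0 mulr1 => H.
apply/eqP; rewrite -subr_eq0; apply/negPn/negP => /(pv (b + s *: (a - b))).
by rewrite -H ltxx.
Qed.

(** A minimiser of [v xi - dotp x xi] exists by coercivity, and its gradient is [x]; criticality is
    tested in the direction [grad v w - x]. *)
Lemma grad_surj x : exists xi, grad v xi = x.
Proof.
have [r0 Hr0] := coercive x; pose r := `|r0|.
have rr : 0 <= r by exact: normr_ge0.
pose K := [set w : E | forall i, `[- r, r]%classic (w ord0 i)].
have KP w : K w <-> `|w| <= r.
  split=> [Kw|wr i]; last by rewrite /= in_itv /= -ler_norml (le_trans (norm_coord_le w i)).
  by apply: norm_rV_le => // i; rewrite ler_norml; have := Kw i; rewrite /= in_itv /=.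
have cK : compact K by apply: (@rV_compact R m (fun=> `[- r, r]%classic)) => i; exact: segment_compact.
have K0 : K 0 by apply/KP; rewrite normr0.
pose g (xi : E) := v xi - dotp x xi.
have cg : continuous g.
  move=> w; apply: (@sm_continuous _ _ _ 0%N setT g w) => //.
  apply: (smB openT (sv 0%N)); apply: (sm_sum openT) => i _.
  by apply: (smM openT); [exact: sm_cst|exact: sm_coord].
have [w _ Hw] := @EVT_min_rV R m g K (ex_intro _ 0 K0) cK (continuous_subspaceT cg).
have gmin y : g w <= g y.
  case: (leP `|y| r) => yr; first by apply: Hw; rewrite inE; apply/KP.
  apply: le_trans (Hw 0 _) _; first by rewrite inE.
  have -> : g 0 = v 0 by rewrite /g dotpE bf0r subr0.
  by apply: Hr0; apply: le_lt_trans yr; exact: ler_norm.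
exists w; apply/eqP; rewrite -subr_eq0; set z := grad v w - x.
have D (t : R) : is_derive t (1 : R) (fun s => g (w + s *: z)) (dotp z (grad v (w + t *: z)) - dotp x z).
  have D1 : is_derive t (1 : R) (fun s : R => v (w + s *: z)) (dotp z (grad v (w + t *: z))).
    rewrite -derive_dotp_grad; last exact: potential_differentiable.
    by apply: is_derive_line; apply: diff_derivable; exact: potential_differentiable.
  apply: (is_deriveB D1).
  rewrite (_ : (fun s => _) = (fun s => bf 1%:M x (w + s *: z))); last by apply/funext => s; rewrite dotpE.
  have := is_derive_bf (is_derive_cstV 1%:M t) (is_derive_cstV x t) (is_derive_affine w z t).
  by rewrite bf0l bf0m !add0r -dotpE.
have := @derive1_at_min R (fun s => g (w + s *: z)) (-1) 1 0.
have ii : (0 : R) \in `]-1, 1[%R by rewrite in_itv /= oppr_lt0 ltr01.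
move=> /(_ _ _ ii) [].
- by lra.
- by move=> t _; case: (D t).
- by move=> t _; rewrite scale0r addr0; exact: gmin.
move=> _; case: (D 0) => _ ->; rewrite scale0r addr0 => H.
have : dotp z z = 0 by rewrite -[RHS]H {2}/z !dotpE bfBr (bfC x) // trmx1.
move=> /eqP; rewrite psumr_eq0 => [/allP H0|i _]; last by rewrite -expr2 sqr_ge0.
by apply/eqP/rowP => i; have := H0 i (mem_index_enum _); rewrite /= mulf_eq0 orbb => /eqP ->; rewrite [RHS]mxE.
Qed.

Definition legendre_point (x : E) : E := get [set xi | grad v xi = x].

Lemma grad_legendre_point x : grad v (legendre_point x) = x.
Proof. by have [xi E] := grad_surj x; exact: (@getPex _ [set xi | grad v xi = x] (ex_intro _ xi E)). Qed.

Lemma legendre_point_grad xi : legendre_point (grad v xi) = xi.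
Proof. by apply: grad_inj => //; exact: grad_legendre_point. Qed.

Lemma legendre_point_smooth : smooth setT legendre_point.
Proof.
have -> : setT = grad v @` setT.
  by apply/seteqP; split=> x // _; exists (legendre_point x) => //; exact: grad_legendre_point.
exact: (inverse_smooth grad_smooth openT grad_inj grad_immersion (fun xi _ => legendre_point_grad xi)).
Qed.

Lemma legendre_point_differentiable x : differentiable legendre_point x.
Proof. by have [d _] := (smS _ _ _).1 (legendre_point_smooth 1%N); exact: d. Qed.

Lemma derive_legendre_point z x :
  'D_z legendre_point x = z *m invmx (hess v (legendre_point x)).
Proof.
rewrite -jac_grad -{1}(grad_legendre_point x).
by have [_ ->] := inverse_differentiable grad_smooth openT grad_inj grad_immersion
  (fun xi _ => legendre_point_grad xi) (I : setT (legendre_point x)).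
Qed.

Lemma is_derive_legendre_point_line x z (t : R) :
  is_derive t (1 : R) (fun s : R => legendre_point (x + s *: z))
    (z *m invmx (hess v (legendre_point (x + t *: z)))).
Proof.
rewrite -derive_legendre_point; apply: is_derive_line; apply: diff_derivable.
exact: legendre_point_differentiable.
Qed.

(** The motion [y] of the base point contributes nothing: its two terms cancel because the gradient
    of [v] there is [x]. *)
Lemma derive_legendre z x : 'D_z (legendre v) x = dotp z (legendre_point x).
Proof.
have -> : legendre v = (fun x => dotp x (legendre_point x) - v (legendre_point x)) by [].
have D1 := is_derive_legendre_point_line x z 0; rewrite scale0r addr0 in D1.
set y := z *m _ in D1.
have D2 : is_derive (0 : R) (1 : R) (fun s : R => v (legendre_point (x + s *: z))) (dotp y x).
  have dv : differentiable v (legendre_point (x + 0 *: z)) by exact: potential_differentiable.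
  have := is_derive_comp1 dv D1.
  rewrite derive_dotp_grad; last exact: potential_differentiable.
  by rewrite grad_legendre_point scale0r addr0.
have D3 := is_derive_bf (is_derive_cstV 1%:M 0) (is_derive_affine x z 0) D1.
rewrite scale0r addr0 bf0m add0r in D3.
have [_ <-] : is_derive (0 : R) (1 : R) (fun s : R => dotp (x + s *: z) (legendre_point (x + s *: z)) - v (legendre_point (x + s *: z))) (dotp z (legendre_point x)).
  rewrite (_ : dotp z _ = dotp z (legendre_point x) + dotp x y - dotp y x); last first.
    by rewrite !dotpE (bfC x) ?trmx1 // addrK.
  rewrite (_ : (fun s : R => _) = (fun s : R => bf 1%:M (x + s *: z) (legendre_point (x + s *: z)) - v (legendre_point (x + s *: z)))).
    by apply: (is_deriveB _ D2); rewrite !dotpE.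
  by apply/funext => s; rewrite dotpE.
exact: derive_line0.
Qed.

Lemma hess_legendre x : hess (legendre v) x = invmx (hess v (legendre_point x)).
Proof.
apply/matrixP => i j; rewrite [LHS]mxE /partial.
rewrite (_ : 'D_(delta_mx 0 j) (legendre v) = (fun y => legendre_point y 0 j)); last first.
  apply/funext => y; rewrite derive_legendre /dotp (bigD1 j) //= mxE !eqxx mul1r big1 ?addr0 // => k kj.
  by rewrite mxE (negPf kj) andbF mul0r.
rewrite -derive_coord; last exact: legendre_point_differentiable.
by rewrite derive_legendre_point -rowE mxE.
Qed.

Lemma inv_hess_deriv_legendre i j k l x : inv_hess_deriv (legendre v) i j k l x =
  partial k (partial l (fun y => hess v (legendre_point y) i j)) x.
Proof.
rewrite /inv_hess_deriv; congr (partial k (partial l _) x); apply/funext => y.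
by rewrite hess_legendre invmxK.
Qed.

End LegendreTransform.

(** * Curvature of Hessian metrics *)

Lemma sum_tens_index (R : realType) m n (F : 'I_(m * n) -> R) :
  \sum_p F p = \sum_i \sum_j F (mxtens_index (i, j)).
Proof.
rewrite pair_big /= (reindex (@mxtens_index m n)) /=; first by apply: eq_bigr => -[i j].
by exists (@mxtens_unindex m n) => x _; [exact: mxtens_indexK|exact: mxtens_unindexK].
Qed.

(** The tensor is viewed as a matrix on pairs of indices. [F] is [S] with its second pair of indices
    raised by the inverse of [K], and the sum of products is the trace of the square of the
    corresponding matrix. *)
Lemma curvature_form_index_le (R : realType) n (K : 'M[R]_n) (S : 'I_n -> 'I_n -> 'I_n -> 'I_n -> R) (w z : 'rV[R]_n) :
  K^T = K -> posdefmx K -> (forall i j a b, S i j a b = S a b i j) ->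
  let F i j k l := \sum_a \sum_b S i j a b * (invmx K k a * invmx K l b) in
  \sum_i \sum_j \sum_k \sum_l F i j k l * F k l i j <= 1 ->
  `|\sum_i \sum_j \sum_a \sum_b w 0 i * w 0 j * S i j a b * (z 0 a * z 0 b)| <= quadf K w * quadf K z.
Proof.
move=> sK pK sS F HF.
pose SM : 'M[R]_(n * n) := \matrix_(p, q) S (mxtens_unindex p).1 (mxtens_unindex p).2
  (mxtens_unindex q).1 (mxtens_unindex q).2.
have SE i j a b : SM (mxtens_index (i, j)) (mxtens_index (a, b)) = S i j a b.
  by rewrite mxE !mxtens_indexK.
have uS a b : invmx K a b = invmx K b a by rewrite -[in LHS](invmx_sym sK) mxE.
have FE i j k l : (SM *m (invmx K *t invmx K)) (mxtens_index (i, j)) (mxtens_index (k, l)) = F i j k l.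
  rewrite mxE sum_tens_index; apply: eq_bigr => a _; apply: eq_bigr => b _.
  by rewrite SE tensmxE (uS a) (uS b).
have sSM : SM^T = SM by apply/matrixP => p q; rewrite !mxE sS.
have := @curvature_form_le R n K SM w z sK pK sSM.
rewrite {1}/mxtrace sum_tens_index.
rewrite (_ : \sum_i \sum_j (SM *m _ *m _) _ _ = \sum_i \sum_j \sum_k \sum_l F i j k l * F k l i j); last first.
  apply: eq_bigr => i _; apply: eq_bigr => j _; rewrite mxE sum_tens_index.
  by apply: eq_bigr => k _; apply: eq_bigr => l _; rewrite !FE.
move=> /(_ HF); congr (`|_| <= _).
rewrite mxE sum_tens_index exchange_big /=.
under eq_bigr do under eq_bigr do rewrite mxE sum_tens_index mulr_suml.
under eq_bigr do under eq_bigr do under eq_bigr do rewrite mulr_suml.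
have sw (A : 'I_n -> 'I_n -> 'I_n -> 'I_n -> R) :
  \sum_b \sum_a \sum_i \sum_j A a b i j = \sum_i \sum_j \sum_a \sum_b A a b i j.
  rewrite exchange_big /= (eq_bigr (fun a => \sum_i \sum_j \sum_b A a b i j)); last first.
    move=> a _; rewrite exchange_big /=; apply: eq_bigr => i _; exact: exchange_big.
  rewrite exchange_big /=; apply: eq_bigr => i _; exact: exchange_big.
rewrite sw; apply: eq_bigr => i _; apply: eq_bigr => j _; apply: eq_bigr => a _; apply: eq_bigr => b _.
by rewrite SE [_^T _ _]mxE !tensmxE; ring.
Qed.

Lemma is_derive_mulmx (R : realType) a b d (M : R -> 'M[R]_(a, b)) (N : R -> 'M[R]_(b, d)) (t : R) M' N' :
  is_derive t (1 : R) M M' -> is_derive t (1 : R) N N' ->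
  is_derive t (1 : R) (fun s => M s *m N s) (M' *m N t + M t *m N').
Proof.
move=> /is_derive_mxP dM /is_derive_mxP dN; apply/is_derive_mxP => i j.
rewrite (_ : (fun s => _) = \sum_k (fun s => M s i k * N s k j)); last first.
  by apply/funext => s; rewrite mxE fct_sumE.
rewrite !mxE -big_split /=; apply: is_derive_sum => k.
apply: is_derive_eq (@is_deriveM R R _ _ t 1 _ _ (dM i k) (dN k j)) _.
rewrite /GRing.scale /=; ring.
Qed.

Lemma mxBE (R : realType) a b (M N : 'M[R]_(a, b)) i j : (M - N) i j = M i j - N i j.
Proof. by rewrite !mxE. Qed.

Lemma mxZE (R : realType) a b c (M : 'M[R]_(a, b)) i j : (c *: M) i j = c * M i j.
Proof. by rewrite !mxE. Qed.

Lemma triple_swap (R : comPzRingType) (a b c a' b' c' : R) : a = a' -> b = b' -> c = c' ->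
  a * b * c = c' * b' * a'.
Proof. by move=> -> -> ->; rewrite mulrC (mulrC a') mulrA. Qed.

(** * Derivatives along curves given by a constant covector *)

Section MetricDerivatives.
Context {R : realType} {m : nat}.
Variable G : 'rV[R]_m -> 'M[R]_m.
Hypothesis sG : forall i j, smooth setT (fun p => G p i j).
Hypothesis uG : forall p, G p \in unitmx.

(** Differentiation of the product of the metric and its inverse, which is constant. *)
Lemma is_derive_inv_metric (g : R -> 'rV[R]_m) (t : R) g' : is_derive t (1 : R) g g' ->
  is_derive t (1 : R) (fun s => invmx (G (g s)))
    (- (invmx (G (g t)) *m dmetric G (g t) g' *m invmx (G (g t)))).
Proof.
move=> dg.
pose D : 'M[R]_m := \matrix_(i, j) 'D_g' (fun p => invmx (G p) i j) (g t).
have dI : is_derive t (1 : R) (fun s => invmx (G (g s))) D.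
  apply/is_derive_mxP => i j; rewrite mxE; apply: is_derive_comp1 dg.
  have s1 := sm_invmx openT (fun i j => sG i j 1%N) (fun p _ => uG p) i j.
  by have [d _] := (smS _ _ _).1 s1; exact: d.
have H := is_derive_mulmx (is_derive_metric sG dg) dI.
have : dmetric G (g t) g' *m invmx (G (g t)) + G (g t) *m D = 0.
  apply: is_derive_unique H _; rewrite (_ : (fun s => _) = (fun=> 1%:M)); first exact: is_derive_cstV.
  by apply/funext => s; rewrite mulmxV.
move=> /eqP; rewrite addr_eq0 => /eqP E.
suff <- : D = - (invmx (G (g t)) *m dmetric G (g t) g' *m invmx (G (g t))) by [].
by rewrite -mulmxA E mulmxN opprK mulKmx.
Qed.

Lemma dmetric_sum p mu : dmetric G p mu = \sum_e mu 0 e *: dmetric G p (delta_mx 0 e).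
Proof.
apply/matrixP => i j; rewrite mxE derive_sum_coord; last exact: metric_differentiable.
by rewrite summxE; apply: eq_bigr => e _; rewrite !mxE.
Qed.

Lemma derive_metric_differentiable mu i j p : differentiable ('D_mu (fun q => G q i j)) p.
Proof.
by have [_ D] := (smS _ _ _).1 (sG i j 2%N); have [d _] := (smS _ _ _).1 (D mu); exact: d.
Qed.

Lemma d2metric_sum p mu nu : d2metric G p mu nu = \sum_e mu 0 e *: d2metric G p (delta_mx 0 e) nu.
Proof.
apply/matrixP => i j; rewrite mxE summxE.
have -> : 'D_mu (fun q => G q i j) = (fun q => \sum_e mu 0 e *: 'D_(delta_mx 0 e) (fun q => G q i j) q).
  by apply/funext => q; rewrite derive_sum_coord //; exact: metric_differentiable.
rewrite (_ : (fun q => _) = \sum_e mu 0 e *: 'D_(delta_mx 0 e) (fun q => G q i j)); last first.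
  by apply/funext => q; rewrite fct_sumE.
have dd e : derivable ('D_(delta_mx 0 e) (fun q => G q i j)) p nu.
  by apply: diff_derivable; exact: derive_metric_differentiable.
rewrite derive_sum => [|e]; last exact: derivableZ.
by apply: eq_bigr => e _; rewrite deriveZ // !mxE.
Qed.

Lemma d2metric_sumr p mu nu : d2metric G p mu nu = \sum_e nu 0 e *: d2metric G p mu (delta_mx 0 e).
Proof.
apply/matrixP => i j; rewrite mxE derive_sum_coord; last exact: derive_metric_differentiable.
by rewrite summxE; apply: eq_bigr => e _; rewrite !mxE.
Qed.

Lemma is_derive_dmetric2 (g z : R -> 'rV[R]_m) (t : R) g' z' :
  is_derive t (1 : R) g g' -> is_derive t (1 : R) z z' ->
  is_derive t (1 : R) (fun s => dmetric G (g s) (z s))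
    (d2metric G (g t) (z t) g' + dmetric G (g t) z').
Proof.
move=> dg /is_derive_mxP dz.
rewrite d2metric_sum [dmetric G (g t) z']dmetric_sum -big_split /=.
rewrite (_ : (fun s => _) = \sum_e (fun s => z s 0 e *: dmetric G (g s) (delta_mx 0 e))); last first.
  by apply/funext => s; rewrite fct_sumE [LHS]dmetric_sum.
apply: is_derive_sum => e; apply/is_derive_mxP => i j.
have /is_derive_mxP/(_ i j) dD := is_derive_dmetric sG (delta_mx 0 e) dg.
rewrite (_ : (fun s => _) = (fun s => z s 0 e * dmetric G (g s) (delta_mx 0 e) i j)); last first.
  by apply/funext => s; rewrite mxE.
apply: is_derive_eq (@is_deriveM R R _ _ t 1 _ _ (dz 0 e) dD) _.
have E (a : R) (M : 'M[R]_m) : (a *: M) i j = a * M i j by rewrite mxE.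
by rewrite [RHS]mxE !E /GRing.scale /=; ring.
Qed.

Lemma dmetric_diffE xi w i j : dmetric G xi w i j = 'd (fun q => G q i j) xi w.
Proof. by rewrite mxE deriveE //; exact: metric_differentiable. Qed.

Lemma dmetricN xi w : dmetric G xi (- w) = - dmetric G xi w.
Proof. by apply/matrixP => i j; rewrite [RHS]mxE !dmetric_diffE linearN. Qed.

(* Second derivative of [G (g s)] along a curve with [g' = nu *m invmx (G g)]:
   the second term comes from differentiating the velocity. *)
Definition curvature_mx (xi z y : 'rV[R]_m) : 'M[R]_m :=
  d2metric G xi z y - dmetric G xi (z *m dmetric G xi y *m invmx (G xi)).

Lemma curvature_mxE xi z y i j : curvature_mx xi z y i j =
  d2metric G xi z y i j - dmetric G xi (z *m dmetric G xi y *m invmx (G xi)) i j.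
Proof. exact: mxBE. Qed.

Lemma is_derive_covector (g : R -> 'rV[R]_m) (t : R) (nu mu : 'rV[R]_m) :
  is_derive t (1 : R) g (nu *m invmx (G (g t))) ->
  is_derive t (1 : R) (fun s : R => mu *m invmx (G (g s)))
    (- (mu *m invmx (G (g t)) *m dmetric G (g t) (nu *m invmx (G (g t))) *m invmx (G (g t)))).
Proof.
move=> D; have := is_derive_mulmx (is_derive_cstV mu t) (is_derive_inv_metric D).
by rewrite mul0mx add0r mulmxN !mulmxA.
Qed.

Lemma is_derive_dmetric_covector (g : R -> 'rV[R]_m) (t : R) (nu mu : 'rV[R]_m) :
  is_derive t (1 : R) g (nu *m invmx (G (g t))) ->
  is_derive t (1 : R) (fun s : R => dmetric G (g s) (mu *m invmx (G (g s))))
    (curvature_mx (g t) (mu *m invmx (G (g t))) (nu *m invmx (G (g t)))).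
Proof.
move=> D; have := is_derive_dmetric2 D (is_derive_covector mu D).
by rewrite dmetricN.
Qed.

Local Opaque dmetric d2metric curvature_mx.

Lemma curvature_mx_sum xi z y i j : curvature_mx xi z y i j =
  \sum_a \sum_b curvature_mx xi (delta_mx 0 b) (delta_mx 0 a) i j * (y 0 a * z 0 b).
Proof.
rewrite [LHS]curvature_mxE dmetric_diffE.
have E : z *m dmetric G xi y *m invmx (G xi) =
   \sum_a \sum_b (y 0 a * z 0 b) *: (delta_mx 0 b *m dmetric G xi (delta_mx 0 a) *m invmx (G xi)).
  rewrite (dmetric_sum xi y) mulmx_sumr mulmx_suml; apply: eq_bigr => a _.
  rewrite -scalemxAr -scalemxAl {1}(row_sum_delta z) !mulmx_suml scaler_sumr; apply: eq_bigr => b _.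
  by rewrite -!scalemxAl scalerA.
rewrite E d2metric_sumr summxE linear_sum -sumrB; apply: eq_bigr => a _.
rewrite mxZE d2metric_sum summxE linear_sum mulr_sumr -sumrB; apply: eq_bigr => b _.
rewrite mxZE linearZ /= -dmetric_diffE curvature_mxE /GRing.scale /=.
by move: (d2metric _ _ _ _ _ _) (dmetric _ _ _ _ _) => p q; ring.
Qed.

Lemma curvature_mx_coord xi i j a b : curvature_mx xi (delta_mx 0 b) (delta_mx 0 a) i j =
  d2metric G xi (delta_mx 0 b) (delta_mx 0 a) i j -
  \sum_e \sum_d dmetric G xi (delta_mx 0 a) b d * invmx (G xi) d e * dmetric G xi (delta_mx 0 e) i j.
Proof.
rewrite [LHS]curvature_mxE; congr (_ - _).
rewrite [dmetric G xi (delta_mx 0 b *m _ *m _)]dmetric_sum summxE.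
apply: eq_bigr => e _; rewrite mxZE -rowE [(row b _ *m _) _ _]mxE mulr_suml.
by apply: eq_bigr => d _; rewrite [row _ _ _ _]mxE.
Qed.

Hypothesis symG : forall p, (G p)^T = G p.
Hypothesis sym3 : forall p a b d, dmetric G p (delta_mx 0 a) b d = dmetric G p (delta_mx 0 d) a b.
Hypothesis sym4 : forall p i j a b, d2metric G p (delta_mx 0 b) (delta_mx 0 a) i j =
  d2metric G p (delta_mx 0 j) (delta_mx 0 i) a b.

(** The symmetries [sym3] and [sym4] are those of the derivatives of a potential. Pair symmetry of
    the curvature makes its matrix in an orthonormal frame symmetric, so that the trace of the
    square is a sum of squares. *)
Lemma curvature_mx_pair_sym xi i j a b :
  curvature_mx xi (delta_mx 0 b) (delta_mx 0 a) i j = curvature_mx xi (delta_mx 0 j) (delta_mx 0 i) a b.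
Proof.
apply: (eq_trans (curvature_mx_coord xi i j a b)).
apply: (eq_trans _ (esym (curvature_mx_coord xi a b i j))).
congr (_ - _); first exact: sym4.
rewrite exchange_big /=; apply: eq_bigr => d _; apply: eq_bigr => e _.
have uS : invmx (G xi) d e = invmx (G xi) e d by rewrite -[in LHS](invmx_sym (symG xi)) mxE.
exact: triple_swap (sym3 xi a b d) uS (esym (sym3 xi i j e)).
Qed.

Hypothesis posG : forall p, posdefmx (G p).

(** Since [curvature_mx] is bilinear in its two directions, evaluating it on rows of the inverse
    metric amounts to raising two indices, which is the form required by
    [curvature_form_index_le]. *)
Lemma curvature_mx_bound xi w z :
  (let F i j k l := curvature_mx xi (delta_mx 0 l *m invmx (G xi)) (delta_mx 0 k *m invmx (G xi)) i j in
   \sum_i \sum_j \sum_k \sum_l F i j k l * F k l i j <= 1) ->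
  `|quadf (curvature_mx xi z z) w| <= quadf (G xi) w * quadf (G xi) z.
Proof.
move=> /= H; pose S i j a b := curvature_mx xi (delta_mx 0 b) (delta_mx 0 a) i j.
have := @curvature_form_index_le R m (G xi) S w z (symG xi) (posG xi) (curvature_mx_pair_sym xi).
have FE i j k l : \sum_a \sum_b S i j a b * (invmx (G xi) k a * invmx (G xi) l b) =
   curvature_mx xi (delta_mx 0 l *m invmx (G xi)) (delta_mx 0 k *m invmx (G xi)) i j.
  rewrite [RHS]curvature_mx_sum; apply: eq_bigr => a _; apply: eq_bigr => b _.
  by rewrite -!rowE ![row _ _ _ _]mxE.
rewrite /= (_ : \sum_i \sum_j \sum_k \sum_l _ = \sum_i \sum_j \sum_k \sum_l
   curvature_mx xi (delta_mx 0 l *m invmx (G xi)) (delta_mx 0 k *m invmx (G xi)) i j *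
   curvature_mx xi (delta_mx 0 j *m invmx (G xi)) (delta_mx 0 i *m invmx (G xi)) k l); last first.
  by do 4 (apply: eq_bigr => ? _); rewrite !FE.
move=> /(_ H); suff -> : \sum_i \sum_j \sum_a \sum_b w 0 i * w 0 j * S i j a b * (z 0 a * z 0 b) =
  quadf (curvature_mx xi z z) w by [].
rewrite quadfE bfE; apply: eq_bigr => i _; apply: eq_bigr => j _.
rewrite [curvature_mx xi z z i j]curvature_mx_sum mulr_suml; apply: eq_bigr => a _.
rewrite mulr_suml; apply: eq_bigr => b _; rewrite -/(S i j a b).
by move: (S i j a b) => ?; ring.
Qed.

End MetricDerivatives.

Lemma derive_of_line (R : realType) (V W : normedModType R) (F : V -> W) x z d :
  is_derive (0 : R) (1 : R) (fun s : R => F (x + s *: z)) d -> 'D_z F x = d.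
Proof. by move=> [_ <-]; exact: derive_line0. Qed.

Lemma partialC (R : realType) m (f : 'rV[R]_m -> R) i j : smooth setT f ->
  partial i (partial j f) = partial j (partial i f).
Proof. by move=> sf; apply/funext => x; apply: (schwarz _ _ openT I (sf 2%N)). Qed.

Lemma partial_smooth (R : realType) m (f : 'rV[R]_m -> R) i : smooth setT f -> smooth setT (partial i f).
Proof. by move=> sf k; have [_ D] := (smS _ _ _).1 (sf k.+1); exact: D. Qed.

(** * The curvature of a Hessian metric in terms of its potential *)

Section Curvature.
Context {R : realType} {m : nat}.
Variable v : 'rV[R]_m -> R.
Hypothesis sv : smooth setT v.
Hypothesis pv : forall xi, posdefmx (hess v xi).
Hypothesis coercive : forall x : 'rV[R]_m, exists r : R, forall xi, r < `|xi| -> v 0 <= v xi - dotp x xi.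

Local Notation K := (hess v).
Local Notation psi := (legendre_point v).

Let symK := hess_sym sv.

Lemma hess_coordE i j : (fun q => K q i j) = partial i (partial j v).
Proof. by apply/funext => q; rewrite mxE. Qed.

Lemma hess_smooth i j : smooth setT (fun q => K q i j).
Proof. by rewrite hess_coordE; do 2 apply: partial_smooth. Qed.

Lemma hess_unitmx xi : K xi \in unitmx.
Proof. exact: posdef_unitmx (pv xi). Qed.

Lemma dmetric_hess p a b d : dmetric K p (delta_mx 0 a) b d = partial a (partial b (partial d v)) p.
Proof. by rewrite mxE hess_coordE. Qed.

Lemma d2metric_hess p a b i j : d2metric K p (delta_mx 0 b) (delta_mx 0 a) i j =
  partial a (partial b (partial i (partial j v))) p.
Proof. by rewrite mxE hess_coordE. Qed.

Lemma dmetric_hess_sym p a b d : dmetric K p (delta_mx 0 a) b d = dmetric K p (delta_mx 0 d) a b.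
Proof.
apply: etrans (dmetric_hess p a b d) _; apply: etrans _ (esym (dmetric_hess p d a b)).
by rewrite (partialC b d sv) (partialC a d (partial_smooth b sv)).
Qed.

Lemma d2metric_hess_sym p i j a b : d2metric K p (delta_mx 0 b) (delta_mx 0 a) i j =
  d2metric K p (delta_mx 0 j) (delta_mx 0 i) a b.
Proof.
have s1 := fun j => partial_smooth j sv; have s2 i j := partial_smooth i (s1 j).
apply: etrans (d2metric_hess p a b i j) _; apply: etrans _ (esym (d2metric_hess p i j a b)).
by rewrite (partialC b i (s1 j)) (partialC a i (s2 b j)) (partialC b j sv) (partialC a j (s1 b)).
Qed.

(** The inverse Hessian of the Legendre transform is [K] composed with [psi], so its derivatives in
    [x] are derivatives of [K] along curves of velocity [nu *m invmx K]. *)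
Lemma inv_hess_derivE i j k l x : inv_hess_deriv (legendre v) i j k l x =
  curvature_mx K (psi x) (delta_mx 0 l *m invmx (K (psi x))) (delta_mx 0 k *m invmx (K (psi x))) i j.
Proof.
have D (y nu : 'rV[R]_m) := is_derive_legendre_point_line sv pv coercive y nu 0.
rewrite (inv_hess_deriv_legendre sv pv coercive).
rewrite (_ : partial l (fun y => K (psi y) i j) =
  (fun y => dmetric K (psi y) (delta_mx 0 l *m invmx (K (psi y))) i j)); last first.
  apply/funext => y; apply: derive_of_line.
  by have /is_derive_mxP/(_ i j) := is_derive_metric hess_smooth (D y (delta_mx 0 l)); rewrite scale0r addr0.
apply: derive_of_line.
have /is_derive_mxP/(_ i j) := is_derive_dmetric_covector hess_smooth hess_unitmx (delta_mx 0 l) (D x (delta_mx 0 k)).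
by rewrite scale0r addr0.
Qed.

Hypothesis Rm_le1 : forall x, Rm_sqr (legendre v) x <= 1.

Lemma curvature_bound xi w z : `|quadf (curvature_mx K xi z z) w| <= quadf (K xi) w * quadf (K xi) z.
Proof.
apply: (curvature_mx_bound hess_smooth symK dmetric_hess_sym d2metric_hess_sym pv) => /=.
have px : psi (grad v xi) = xi by apply: (legendre_point_grad sv pv coercive).
have := Rm_le1 (grad v xi); rewrite /Rm_sqr.
suff -> : \sum_i \sum_j \sum_k \sum_l inv_hess_deriv (legendre v) i j k l (grad v xi) *
    inv_hess_deriv (legendre v) k l i j (grad v xi) = \sum_i \sum_j \sum_k \sum_l
   curvature_mx K xi (delta_mx 0 l *m invmx (K xi)) (delta_mx 0 k *m invmx (K xi)) i j *
   curvature_mx K xi (delta_mx 0 j *m invmx (K xi)) (delta_mx 0 i *m invmx (K xi)) k l by [].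
by do 4 (apply: eq_bigr => ? _); rewrite !inv_hess_derivE px.
Qed.

End Curvature.

(** * Comparison along lines *)

Section ScalarEstimates.
Context {R : realType}.

(** A positive [d] would make [p'] positive just after 0, and [p] would exceed its maximum there. *)
Lemma max_second_derive (p p' : R -> R) (d : R) :
  (forall t : R, is_derive t (1 : R) p (p' t)) -> is_derive (0 : R) (1 : R) p' d ->
  (forall s, p s <= p 0) -> d <= 0.
Proof.
move=> dp dp' pmax.
have p'0 : p' 0 = 0.
  have ii : (0 : R) \in `]-1, 1[%R by rewrite in_itv /= oppr_lt0 ltr01.
  have := @derive1_at_min R (fun s => - p s) (-1) 1 0 _ _ ii; case.
  - by lra.
  - by move=> t _; apply: derivableN; case: (dp t).
  - by move=> t _; rewrite lerN2.
  move=> _; have [_ ->] := is_deriveN (dp 0) => /eqP; rewrite oppr_eq0 => /eqP //.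
rewrite leNgt; apply/negP => d0.
have [dp1 E1] := dp'; have df : differentiable p' 0 by apply/derivable1_diffP.
have d20 : 0 < d / 2 by rewrite divr_gt0.
have /nbhs_ballP[e e0 He] := differentiable_epsE df d20.
have pos s : 0 < s -> s < e -> 0 < p' s.
  move=> s0 se; have := He s; rewrite /= -ball_normE /= sub0r normrN gtr0_norm // => /(_ se).
  have -> : 'd p' 0 s = s * d by rewrite -E1 deriveE // -[s in LHS]mulr1 linearZ.
  rewrite addr0 p'0 subr0 ler_norml => /andP[h1 _].
  have : 0 < s * d by rewrite mulr_gt0.
  by rewrite (_ : d / 2 * s = s * d / 2) in h1; [move: (s * d) h1 => x h1; lra|field].
have e2 : 0 < e / 2 by rewrite divr_gt0.
have ee : e / 2 < e by rewrite ltr_pdivrMr // ltr_pMr // ltr1n.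
have [|c cI E] := @MVT R p p' 0 (e / 2) e2 (fun x _ => dp x).
  by apply: continuous_within_itv => t _; exact: is_derive_continuous (dp t).
move: cI; rewrite in_itv /= => /andP[c0 ce].
have : 0 < p' c * (e / 2 - 0) by rewrite subr0 mulr_gt0 // pos // (lt_trans ce).
by rewrite -E subr_gt0 ltNge pmax.
Qed.

Lemma quadratic_upper_bound_ge0 (q q' q'' : R -> R) :
  (forall t : R, is_derive t (1 : R) q (q' t)) ->
  (forall t : R, is_derive t (1 : R) q' (q'' t)) -> (forall t, q'' t <= 1) ->
  forall s, 0 <= s -> q s <= q 0 + q' 0 * s + s ^+ 2 / 2.
Proof.
move=> dq dq' q1 s s0.
have q's (u : R) : 0 <= u -> q' u <= q' 0 + u.
  move=> u0; have [c _ E] := @MVT01 R q' q'' 0 u u0 (fun t _ => dq' t).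
  have : q'' c * u <= 1 * u by rewrite ler_wpM2r.
  by move: E; rewrite subr0 mul1r; move: (q'' c * u) => x; lra.
pose r t := q 0 + q' 0 * t + t ^+ 2 / 2 - q t.
have dr (t : R) : is_derive t (1 : R) r (q' 0 + t - q' t).
  apply: (is_deriveB _ (dq t)).
  have d1 : is_derive t (1 : R) (fun t : R => q 0 + q' 0 * t + t ^+ 2 / 2) (0 + q' 0 * 1 + (2%:R * t ^+ 1 * 1) / 2).
    by apply: is_derive_eq; rewrite /GRing.scale /=; ring.
  by apply: is_derive_eq d1 _; field.
have := @ge0_derive_le R r (fun t => q' 0 + t - q' t) 0 s s0 (fun t _ => dr t).
have r0 : r 0 = 0 by rewrite /r; field.
rewrite r0 /r => H; have : 0 <= q 0 + q' 0 * s + s ^+ 2 / 2 - q s.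
  by apply: H => t /andP[t0 _]; rewrite subr_ge0 q's.
by rewrite subr_ge0.
Qed.

Lemma quadratic_upper_bound (q q' q'' : R -> R) :
  (forall t : R, is_derive t (1 : R) q (q' t)) ->
  (forall t : R, is_derive t (1 : R) q' (q'' t)) -> (forall t, q'' t <= 1) ->
  forall s, q s <= q 0 + q' 0 * s + s ^+ 2 / 2.
Proof.
move=> dq dq' q1 s; case: (leP 0 s) => s0; first exact: quadratic_upper_bound_ge0 dq dq' q1 s s0.
have d1 (t : R) : is_derive t (1 : R) (fun u => q (- u)) (- q' (- t)) by apply: is_derive_opp_arg.
have d2 (t : R) : is_derive t (1 : R) (fun u => - q' (- u)) (q'' (- t)).
  rewrite -[q'' _]opprK; apply: is_deriveN; exact: is_derive_opp_arg.
have := @quadratic_upper_bound_ge0 _ _ _ d1 d2 (fun t => q1 (- t)) (- s).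
by rewrite oppr0 opprK sqrrN mulrNN; apply; rewrite oppr_ge0 ltW.
Qed.

(* The Taylor bound at [s = - q' 0] and positivity give [(q' 0)^2 <= 2 q 0]. *)
Lemma sqrt_growth (q q' q'' : R -> R) :
  (forall t : R, is_derive t (1 : R) q (q' t)) ->
  (forall t : R, is_derive t (1 : R) q' (q'' t)) -> (forall t, q'' t <= 1) ->
  (forall t, 0 < q t) ->
  forall s, q s <= (Num.sqrt (q 0) + `|s|) ^+ 2.
Proof.
move=> dq dq' q1 q0 s; have U := quadratic_upper_bound dq dq' q1.
set a := Num.sqrt (q 0); have a0 : 0 <= a by exact: sqrtr_ge0.
have aE : q 0 = a ^+ 2 by rewrite sqr_sqrtr // ltW.
have q'a : `|q' 0| <= 2 * a.
  rewrite -(@ler_sqr R) ?nnegrE ?mulr_ge0 // real_normK ?num_real // exprMn -aE.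
  have := lt_le_trans (q0 _) (U (- q' 0)); rewrite mulrN -expr2 sqrrN.
  by have := q0 0; rewrite (_ : 2 ^+ 2 = 4 :> R); [move: (q' 0 ^+ 2) => x; lra|ring].
apply: le_trans (U s) _.
rewrite sqrrD -aE real_normK ?num_real //.
have : q' 0 * s <= 2 * a * `|s|.
  by apply: le_trans (ler_norm _) _; rewrite normrM ler_wpM2r.
have : 0 <= s ^+ 2 by rewrite sqr_ge0.
rewrite (_ : a * `|s| *+ 2 = 2 * a * `|s|); last by ring.
by move: (2 * a * _) (q' 0 * s) (s ^+ 2) => x y z; lra.
Qed.

(* [phi t = (d - t) + (A / 3) (d - t)^3] satisfies [phi'' >= A phi], so the
   Wronskian [f' phi - f phi'] decreases from 0 to [d]. *)
Lemma derive_lower_bound (f f' f'' : R -> R) (A d : R) : 0 < d -> A * d ^+ 2 = 1 ->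
  (forall t : R, 0 <= t <= d -> is_derive t (1 : R) f (f' t)) ->
  (forall t : R, 0 <= t <= d -> is_derive t (1 : R) f' (f'' t)) ->
  (forall t, 0 <= t <= d -> 0 <= f t) ->
  (forall t, 0 <= t <= d -> f'' t <= A * f t) ->
  - (3 / 2 * (f 0 / d)) <= f' 0.
Proof.
move=> d0 Ad df df' fpos fA.
have A0 : 0 <= A.
  have : 0 < A * d ^+ 2 by rewrite Ad.
  by rewrite pmulr_lgt0 ?exprn_gt0 // => /ltW.
pose phi (t : R) := (d - t) + A / 3 * (d - t) ^+ 3.
pose phi' (t : R) := - 1 - A * (d - t) ^+ 2.
pose phi'' (t : R) := 2 * A * (d - t).
have dphi (t : R) : is_derive t (1 : R) phi (phi' t).
  have D : is_derive t (1 : R) (fun t : R => d - t) (0 - 1) by apply: is_deriveB.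
  have D3 : is_derive t (1 : R) (fun t : R => (d - t) ^+ 3) (3%:R * (d - t) ^+ 2 * (0 - 1)).
    rewrite (_ : (fun t : R => (d - t) ^+ 3) = (fun t => (d - t) * ((d - t) * (d - t)))); last first.
      by apply/funext => u; ring.
    apply: is_derive_eq (@is_deriveM R R _ _ t 1 _ _ D (@is_deriveM R R _ _ t 1 _ _ D D)) _.
    by rewrite fctE /GRing.scale /=; ring.
  apply: is_derive_eq (is_deriveD D (is_deriveZ (A / 3) D3)) _.
  by rewrite /phi' /GRing.scale /=; field.
have dphi' (t : R) : is_derive t (1 : R) phi' (phi'' t).
  have D : is_derive t (1 : R) (fun t : R => d - t) (0 - 1) by apply: is_deriveB.
  have D2 : is_derive t (1 : R) (fun t : R => (d - t) ^+ 2) (2%:R * (d - t) ^+ 1 * (0 - 1)).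
    apply: is_derive_eq (@is_deriveM R R _ _ t 1 _ _ D D) _.
    by rewrite /GRing.scale /=; ring.
  apply: is_derive_eq (is_deriveB (is_derive_cst (- 1 : R) t (1 : R)) (is_deriveZ A D2)) _.
  by rewrite /phi'' /GRing.scale /=; ring.
pose W (t : R) := f' t * phi t - f t * phi' t.
pose W' (t : R) := f'' t * phi t - f t * phi'' t.
have dW (t : R) : 0 <= t <= d -> is_derive t (1 : R) W (W' t).
  move=> td.
  have D1 := @is_deriveM R R f' phi t 1 _ _ (df' t td) (dphi t).
  have D2 := @is_deriveM R R f phi' t 1 _ _ (df t td) (dphi' t).
  apply: is_derive_eq (is_deriveB D1 D2) _; rewrite /W' /GRing.scale /=; ring.
have W'le (t : R) : 0 <= t <= d -> W' t <= 0.
  move=> td; have /andP[t0 t1] := td; rewrite subr_le0.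
  have s0 : 0 <= d - t by rewrite subr_ge0.
  have sd : A * (d - t) ^+ 2 <= 1.
    rewrite -Ad ler_wpM2l // ler_sqr ?nnegrE ?(ltW d0) //.
    by rewrite gerBl.
  have p0 : 0 <= phi t by rewrite addr_ge0 // mulr_ge0 ?divr_ge0 ?exprn_ge0.
  apply: le_trans (ler_wpM2r p0 (fA t td)) _.
  rewrite (mulrC A) -mulrA; apply: ler_wpM2l; first exact: fpos.
  have -> : A * phi t = A * (d - t) * (1 + 3^-1 * (A * (d - t) ^+ 2)) by rewrite /phi; field.
  have -> : phi'' t = A * (d - t) * 2 by rewrite /phi''; ring.
  apply: ler_wpM2l; first exact: mulr_ge0.
  by move: (A * (d - t) ^+ 2) sd => x; lra.
have := @le0_derive_ge R W W' 0 d (ltW d0) dW W'le.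
have -> : W d = f d by rewrite /W /phi /phi' subrr expr0n /= mulr0; ring.
have -> : W 0 = 4 / 3 * (d * f' 0) + 2 * f 0.
  rewrite /W /phi /phi' subr0 Ad (_ : A / 3 * d ^+ 3 = A * d ^+ 2 * d / 3); last by field.
  by rewrite Ad; field.
move=> H; have fd : 0 <= f d by apply: fpos; rewrite lexx ltW.
rewrite -(ler_pM2l d0) (_ : d * - _ = - (3 / 2 * f 0)); last by field; exact: lt0r_neq0.
by move: (d * f' 0) H => x; lra.
Qed.

(* [y t + (a + t)^-1] is nondecreasing, so [a^-1 - (a + l)^-1 <= 1]. *)
Lemma crossing_bound (y h : R -> R) (a l : R) : 0 < a -> 1 < l ->
  (forall t : R, 0 <= t <= l -> is_derive t (1 : R) y (h t)) ->
  (forall t : R, 0 <= t <= l -> (a + t) ^- 2 <= h t) ->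
  y l - y 0 = 1 -> 2^-1 <= a.
Proof.
move=> a0 l1 dy hb yl.
have l0 : 0 <= l by lra.
pose Phi t := y t + (a + t)^-1.
have at0 (t : R) : 0 <= t <= l -> 0 < a + t by move=> /andP[t0 _]; lra.
have dPhi (t : R) : 0 <= t <= l -> is_derive t (1 : R) Phi (h t - (a + t) ^- 2).
  move=> tl; have ne : a + t != 0 by rewrite gt_eqF // at0.
  have D : is_derive t (1 : R) (fun t : R => a + t) (0 + 1) by apply: is_deriveD.
  have DV : is_derive t (1 : R) (fun t : R => (a + t)^-1) (- (a + t) ^- 2 *: (0 + 1)) by apply: is_deriveV.
  apply: is_derive_eq (is_deriveD (dy t tl) DV) _.
  by rewrite /GRing.scale /=; ring.
have := @ge0_derive_le R Phi (fun t => h t - (a + t) ^- 2) 0 l l0 dPhi.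
rewrite /Phi addr0 => H.
have {}H : y 0 + a^-1 <= y l + (a + l)^-1 by apply: H => t /hb; rewrite subr_ge0.
have al : 0 < a + l by lra.
have : a^-1 - (a + l)^-1 <= 1 by lra.
rewrite (_ : a^-1 - _ = l / (a * (a + l))); last first.
  by field; rewrite !lt0r_neq0.
rewrite ler_pdivrMr ?mulr_gt0 // mul1r => H2.
rewrite leNgt; apply/negP => a2; nra.
Qed.

End ScalarEstimates.

Lemma norm_sub_le (R : realType) (b c p q : R) : `|b - c| <= p -> `|c| <= q -> `|b| <= p + q.
Proof. by rewrite !ler_norml => /andP[? ?] /andP[? ?]; lra. Qed.

Lemma quadf_oppm (R : realType) m (M : 'M[R]_m) w : quadf (- M) w = - quadf M w.
Proof. by rewrite !quadfE -scaleN1r bfZm mulN1r. Qed.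

Lemma quadf_subm (R : realType) m (M N : 'M[R]_m) w : quadf (M - N) w = quadf M w - quadf N w.
Proof. by rewrite !quadfE bfBm. Qed.

Lemma is_derive_quadf (R : realType) m (M : R -> 'M[R]_m) (t : R) M' w : is_derive t (1 : R) M M' ->
  is_derive t (1 : R) (fun s => quadf (M s) w) (quadf M' w).
Proof.
move=> D; have := is_derive_bf D (is_derive_cstV w t) (is_derive_cstV w t).
by rewrite bf0l bf0r !addr0.
Qed.

Lemma dotp_mulmx (R : realType) m (M : 'M[R]_m) y z : dotp (y *m M) z = bf M y z.
Proof. by rewrite dotpE /bf mulmx1. Qed.

Lemma bf_covector (R : realType) m (M : 'M[R]_m) y z : M \in unitmx ->
  bf M (y *m invmx M) z = dotp y z.
Proof. by move=> uM; rewrite dotpE /bf mulmxKV // mulmx1. Qed.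

Lemma quadf_curvature (R : realType) m (G : 'rV[R]_m -> 'M[R]_m) xi z y w :
  quadf (curvature_mx G xi z y) w = quadf (d2metric G xi z y) w -
    quadf (dmetric G xi (z *m dmetric G xi y *m invmx (G xi))) w.
Proof. exact: quadf_subm. Qed.

Lemma invr_le_of_quarter (R : realType) (a q : R) : 0 < a -> a ^+ 2 / 4 <= q -> q^-1 <= 4 / a ^+ 2.
Proof.
move=> a0 aq; have a4 : 0 < a ^+ 2 / 4 by rewrite divr_gt0 // exprn_gt0.
by rewrite -[4 / a ^+ 2]invf_div lef_pV2 // posrE //; exact: lt_le_trans aq.
Qed.

(** * Third and fourth derivatives of the potential *)

Section LineEstimates.
Context {R : realType} {m : nat}.
Variable v : 'rV[R]_m -> R.
Hypothesis sv : smooth setT v.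
Hypothesis pv : forall xi, posdefmx (hess v xi).
Hypothesis coercive : forall x : 'rV[R]_m, exists r : R, forall xi, r < `|xi| -> v 0 <= v xi - dotp x xi.
Hypothesis Rm_le1 : forall x, Rm_sqr (legendre v) x <= 1.

Local Notation K := (hess v).
Local Notation psi := (legendre_point v).
Let symK := hess_sym sv.
Let sK := hess_smooth sv.
Let uK := hess_unitmx pv.

(* Inverse squared length, in the metric [K], of the velocity of the curve
   [s |-> psi (x + s *: nu)]. *)
Definition inverse_speed (nu x : 'rV[R]_m) : R := (quadf (invmx (K (psi x))) nu)^-1.

Local Opaque hess bf dmetric d2metric curvature_mx.

Lemma speed_gt0 nu x : nu != 0 -> 0 < quadf (invmx (K (psi x))) nu.
Proof. exact: (posdef_invmx (symK _) (pv _)). Qed.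

Lemma inverse_speed_gt0 nu x : nu != 0 -> 0 < inverse_speed nu x.
Proof. by move=> n0; rewrite invr_gt0 speed_gt0. Qed.

Lemma inverse_speed_smooth nu : nu != 0 -> smooth setT (inverse_speed nu).
Proof.
move=> n0 k; apply: (smV openT) => [x _|]; first by rewrite gt_eqF // speed_gt0.
apply: (@sm_eq _ _ _ _ _ (fun x : 'rV[R]_m => \sum_i \sum_j invmx (K (psi x)) i j * (nu 0 i * nu 0 j))).
  by move=> x; rewrite quadfE bfE.
apply: (sm_sum openT) => i _; apply: (sm_sum openT) => j _; apply: (smM openT); last exact: sm_cst.
apply: (@sm_comp _ _ _ openT k _ setT (fun xi => invmx (K xi) i j) psi openT) => //.
  by apply: (sm_invmx openT) => [a b|xi _]; [exact: sK|exact: uK].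
exact: (legendre_point_smooth sv pv coercive).
Qed.

Lemma quadf_covector xi nu : quadf (K xi) (nu *m invmx (K xi)) = quadf (invmx (K xi)) nu.
Proof. by rewrite (quadf_invmx (symK xi) (pv xi)). Qed.

Section Line.
Variables x nu : 'rV[R]_m.
Let y (s : R) := psi (x + s *: nu).
Let z (s : R) := nu *m invmx (K (y s)).

Lemma is_derive_test w (t : R) : is_derive t (1 : R) (fun s => quadf (K (y s)) w)
  (quadf (dmetric K (y t) (z t)) w).
Proof.
exact: (is_derive_quadf w (is_derive_metric sK (is_derive_legendre_point_line sv pv coercive x nu t))).
Qed.

Lemma is_derive2_test w (t : R) : is_derive t (1 : R) (fun s => quadf (dmetric K (y s) (z s)) w)
  (quadf (curvature_mx K (y t) (z t) (z t)) w).
Proof.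
exact: (is_derive_quadf w (is_derive_dmetric_covector sK uK nu (is_derive_legendre_point_line sv pv coercive x nu t))).
Qed.

Lemma test_second_bound w t : `|quadf (curvature_mx K (y t) (z t) (z t)) w| <=
  quadf (K (y t)) w * (inverse_speed nu (x + t *: nu))^-1.
Proof.
have := curvature_bound sv pv coercive Rm_le1 (y t) w (z t).
by rewrite quadf_covector /inverse_speed invrK.
Qed.

End Line.

(* The functions [s |-> quadf (K (y s)) w] with [w] normalised by
   [dotp w nu = 1] lie above the inverse speed, and the one with [w] parallel
   to the velocity touches it. *)
Lemma inverse_speed_second x nu : nu != 0 ->
  'D_nu ('D_nu (inverse_speed nu)) x <= 1.
Proof.
move=> n0; set q := inverse_speed nu.
have sq := inverse_speed_smooth n0.
have dq (y : 'rV[R]_m) : derivable q y nu.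
  by have [d _] := (smS _ _ _).1 (sq 1%N); apply: diff_derivable; exact: d.
have dq2 (y : 'rV[R]_m) : derivable ('D_nu q) y nu.
  have [_ D] := (smS _ _ _).1 (sq 2%N); have [d _] := (smS _ _ _).1 (D nu).
  by apply: diff_derivable; exact: d.
have h0 := speed_gt0 x n0; set h := quadf _ _ in h0.
pose w := h^-1 *: (nu *m invmx (K (psi x))).
have wq : quadf (K (psi x)) w = h^-1.
  by rewrite quadfZ quadf_covector -/h expr2 -mulrA mulVf ?mulr1 // gt_eqF.
have wn : dotp w nu = 1.
  by rewrite dotpE bfZl -dotpE dotp_mulmx -quadfE -/h mulVf // gt_eqF.
have touch s : q (x + s *: nu) <= quadf (K (psi (x + s *: nu))) w.
  have := dotp_le (symK (psi (x + s *: nu))) (pv _) w nu; rewrite wn expr1n.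
  by rewrite /q /inverse_speed -ler_pdivrMr ?speed_gt0 // div1r.
have q0 : q x = h^-1 by [].
pose p s := q (x + s *: nu) - quadf (K (psi (x + s *: nu))) w.
have P1 (t : R) := is_deriveB (is_derive_line (dq (x + t *: nu))) (is_derive_test x nu w t).
have P2 := is_deriveB (is_derive_line (dq2 (x + 0 *: nu))) (is_derive2_test x nu w 0).
have p0 : p 0 = 0.
  have -> : p 0 = q x - quadf (K (psi x)) w.
    by have E0 : x + 0 *: nu = x; [rewrite scale0r addr0|rewrite /p E0].
  rewrite wq; exact: subrr.
have P3 s : p s <= p 0 by rewrite p0 /p subr_le0; exact: touch.
have := max_second_derive P1 P2 P3.
rewrite scale0r addr0 subr_le0 => H; apply: le_trans H _; apply: le_trans (ler_norm _) _.
have := test_second_bound x nu w 0; rewrite scale0r addr0 wq -/q q0 invrK mulVf //.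
by rewrite gt_eqF.
Qed.

Lemma inverse_speed_growth x nu s : nu != 0 ->
  inverse_speed nu (x + s *: nu) <= (Num.sqrt (inverse_speed nu x) + `|s|) ^+ 2.
Proof.
move=> n0; set q := inverse_speed nu.
have sq := inverse_speed_smooth n0.
have dq (y : 'rV[R]_m) : derivable q y nu.
  by have [d _] := (smS _ _ _).1 (sq 1%N); apply: diff_derivable; exact: d.
have dq2 (y : 'rV[R]_m) : derivable ('D_nu q) y nu.
  have [_ D] := (smS _ _ _).1 (sq 2%N); have [d _] := (smS _ _ _).1 (D nu).
  by apply: diff_derivable; exact: d.
have := @sqrt_growth R (fun s => q (x + s *: nu)) (fun s => 'D_nu q (x + s *: nu))
  (fun s => 'D_nu ('D_nu q) (x + s *: nu)) (fun t => is_derive_line (dq _)) (fun t => is_derive_line (dq2 _))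
  (fun t => inverse_speed_second _ n0) (fun t => inverse_speed_gt0 _ n0) s.
by rewrite scale0r addr0.
Qed.

(** The line whose covector is [mu *m K xi] passes through [xi] with velocity [mu], and [a] is the
    inverse length of [mu]. Up to [s = a / 2] the inverse speed is at least [a ^+ 2 / 4], so
    [f'' <= 4 / a ^+ 2 * f], and [derive_lower_bound] with [d = a / 2] yields the constant 3. *)
Lemma dmetric_hess_lower xi mu w :
  - (3 * normq (K xi) mu * quadf (K xi) w) <= quadf (dmetric K xi mu) w.
Proof.
have [->|mu0] := eqVneq mu 0.
  rewrite normq0 mulr0 mul0r oppr0 (_ : dmetric K xi 0 = 0) ?quadfE ?bf0m //.
  by apply/matrixP => i j; rewrite (dmetric_diffE sK) linear0 mxE.
set nu := mu *m K xi; set x := grad v xi.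
have px : psi x = xi by exact: (legendre_point_grad sv pv coercive).
have numu : nu *m invmx (K xi) = mu by rewrite mulmxK // uK.
have n0 : nu != 0 by apply: contra mu0 => /eqP E; rewrite -numu E mul0mx.
pose q0 := inverse_speed nu x; have q00 : 0 < q0 by exact: inverse_speed_gt0.
pose a := Num.sqrt q0; have a0 : 0 < a by rewrite sqrtr_gt0.
have aq : a ^+ 2 = q0 by rewrite sqr_sqrtr // ltW.
have Nmu : normq (K xi) mu = a^-1.
  have e : q0 = (quadf (K xi) mu)^-1 by rewrite /q0 /inverse_speed px -quadf_covector numu.
  by rewrite /a e sqrtrV ?invrK // posdef_ge0.
(* The growth estimate is read backwards, from the point at [s] to the one at 0, which turns an
   upper bound into a lower one. *)
have q_ge s : `|s| <= a / 2 -> a ^+ 2 / 4 <= inverse_speed nu (x + s *: nu).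
  move=> sa; have := inverse_speed_growth (x + s *: nu) (- s) n0.
  rewrite scaleNr addrK -/q0 normrN -aq.
  have := inverse_speed_gt0 (x + s *: nu) n0; move: (inverse_speed nu _) => Q qs.
  rewrite ler_sqr ?nnegrE ?(ltW a0) ?addr_ge0 ?sqrtr_ge0 // => H.
  have H2 : a / 2 <= Num.sqrt Q by lra.
  rewrite -[leRHS](sqr_sqrtr (ltW qs)) (_ : a ^+ 2 / 4 = (a / 2) ^+ 2); last by field.
  by rewrite ler_sqr ?nnegrE ?sqrtr_ge0 // divr_ge0 // ltW.
have a20 : 0 < a / 2 by rewrite divr_gt0.
have fp s : 0 <= quadf (K (psi (x + s *: nu))) w by exact: posdef_ge0.
pose f s := quadf (K (psi (x + s *: nu))) w.
pose f' s := quadf (dmetric K (psi (x + s *: nu)) (nu *m invmx (K (psi (x + s *: nu))))) w.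
have E0 : psi (x + 0 *: nu) = xi by rewrite scale0r addr0.
have e0 : f 0 = quadf (K xi) w by rewrite /f E0.
have e1 : f' 0 = quadf (dmetric K xi mu) w by rewrite /f' E0 numu.
have Aa : 4 / a ^+ 2 * (a / 2) ^+ 2 = 1 by field; exact: lt0r_neq0.
have H : (forall t : R, 0 <= t <= a / 2 ->
    quadf (curvature_mx K (psi (x + t *: nu)) (nu *m invmx (K (psi (x + t *: nu)))) (nu *m invmx (K (psi (x + t *: nu))))) w
      <= 4 / a ^+ 2 * f t) -> - (3 / 2 * (f 0 / (a / 2))) <= f' 0 :=
  derive_lower_bound a20 Aa (fun t _ => is_derive_test x nu w t)
    (fun t _ => is_derive2_test x nu w t) (fun t _ => fp t).
rewrite -e1 -e0 Nmu (_ : 3 * a^-1 * _ = 3 / 2 * (f 0 / (a / 2))); last by field; exact: lt0r_neq0.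
apply: H.
move=> t /andP[t0 ta]; apply: le_trans (ler_norm _) _; apply: le_trans (test_second_bound x nu w t) _.
apply: le_trans (_ : f t * (4 / a ^+ 2) <= _); last by rewrite mulrC.
apply: (ler_wpM2l (fp t)).
have at2 : a ^+ 2 / 4 <= inverse_speed nu (x + t *: nu) by apply: q_ge; rewrite ger0_norm.
exact: invr_le_of_quarter a0 at2.
Qed.

Lemma dmetric_hess_bound xi mu w :
  `|quadf (dmetric K xi mu) w| <= 3 * normq (K xi) mu * quadf (K xi) w.
Proof.
have H1 := dmetric_hess_lower xi mu w; have := dmetric_hess_lower xi (- mu) w.
rewrite (dmetricN sK) normqN quadf_oppm lerN2 => H2.
by rewrite ler_norml H1.
Qed.

(** The second derivative of [K] is the curvature matrix plus the first derivative along [g]. The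
    curvature contributes 1 and the other term 9, as [g] has length at most 3 times the squared
    length of [mu]. *)
Lemma d2metric_hess_quad xi w mu : `|quadf (d2metric K xi mu mu) w| <=
  10 * quadf (K xi) w * quadf (K xi) mu.
Proof.
set N := normq (K xi).
pose g := mu *m dmetric K xi mu *m invmx (K xi).
have Nmu : N mu ^+ 2 = quadf (K xi) mu by rewrite (normq_sqr (pv xi)).
(* The squared length of [g] is [bf (dmetric K xi mu) mu g], so the first-derivative bound estimates
   [g] by itself. *)
have gN : N g <= 3 * N mu ^+ 2.
  have k0 : 0 <= 3 * N mu by rewrite mulr_ge0 // normq_ge0.
  have := bf_le_of_quadf (symK xi) (pv xi) mu g (dmetric_sym symK xi mu) k0 (dmetric_hess_bound xi mu).
  have -> : bf (dmetric K xi mu) mu g = N g ^+ 2.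
    by rewrite (normq_sqr (pv xi)) quadfE {2}/g (bf_covector _ _ (uK xi)) dotp_mulmx.
  rewrite ger0_norm ?exprn_ge0 ?normq_ge0 // -/N => H.
  have := normq_ge0 (K xi) g; rewrite -/N le_eqVlt => /orP[/eqP <-|g0].
    by rewrite mulr_ge0 // exprn_ge0 // normq_ge0.
  by move: H; rewrite (_ : 3 * N mu * _ = 3 * N mu ^+ 2 * N g); [rewrite expr2 ler_pM2r|ring].
have := curvature_bound sv pv coercive Rm_le1 xi w mu.
rewrite quadf_curvature -/g => H1.
have H2 := dmetric_hess_bound xi g w.
have w0 : 0 <= quadf (K xi) w by exact: posdef_ge0.
have H3 : 3 * N g * quadf (K xi) w <= 9 * (quadf (K xi) w * quadf (K xi) mu).
  rewrite -Nmu (_ : 9 * _ = 3 * (3 * N mu ^+ 2) * quadf (K xi) w); last by ring.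
  by rewrite ler_wpM2r // ler_wpM2l.
apply: le_trans (norm_sub_le H1 (le_trans H2 H3)) _.
by rewrite le_eqVlt; apply/orP; left; apply/eqP; ring.
Qed.

(** For fixed [w] the expression is a symmetric bilinear form [S] in the two directions, and
    [bf_le_of_quadf] extends the bound off the diagonal with the same constant. *)
Lemma d2metric_hess_bound xi mu nu w : `|quadf (d2metric K xi mu nu) w| <=
  10 * (normq (K xi) mu * normq (K xi) nu) * quadf (K xi) w.
Proof.
pose S : 'M[R]_m := \matrix_(a, b) quadf (d2metric K xi (delta_mx 0 a) (delta_mx 0 b)) w.
have SE mu' nu' : bf S mu' nu' = quadf (d2metric K xi mu' nu') w.
  rewrite [RHS]quadfE (d2metric_sum sK) bfE.
  have bs (I : finType) (M : I -> 'M[R]_m) : bf (\sum_i M i) w w = \sum_i bf (M i) w w.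
    elim/big_rec2: _ => [|i y1 y2 _ <-]; [exact: bf0m|exact: bfDm].
  rewrite bs; apply: eq_bigr => a _; rewrite bfZm (d2metric_sumr sK) bs mulr_sumr.
  by apply: eq_bigr => b _; rewrite bfZm mxE -quadfE; ring.
have sS : S^T = S.
  have E a b : d2metric K xi (delta_mx 0 a) (delta_mx 0 b) = d2metric K xi (delta_mx 0 b) (delta_mx 0 a).
    apply/matrixP => i j.
    apply: etrans (d2metric_hess v xi b a i j) _.
    apply: etrans _ (esym (d2metric_hess v xi a b i j)).
    exact: (congr1 (fun F => F xi) (partialC b a (partial_smooth i (partial_smooth j sv)))).
  by apply/matrixP => a b; rewrite mxE [LHS]mxE [RHS]mxE E.
have w0 : 0 <= 10 * quadf (K xi) w by rewrite mulr_ge0 // posdef_ge0.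
have := bf_le_of_quadf (symK xi) (pv xi) mu nu sS w0.
rewrite SE => H; rewrite (_ : 10 * (_ * _) * _ = 10 * quadf (K xi) w * (normq (K xi) mu * normq (K xi) nu)); last by ring.
by apply: H => y; rewrite quadfE SE; exact: d2metric_hess_quad.
Qed.

End LineEstimates.

(** The triangle inequality bounds the length of [w] by [k] times the sum of the absolute values of
    its coordinates; Cauchy-Schwarz against the constant vector gives the factor [m]. *)
Lemma quadf_le_diag (R : realType) m (A : 'M[R]_m) (k : R) w : A^T = A -> posdefmx A -> 0 <= k ->
  (forall i, quadf A (delta_mx 0 i) <= k ^+ 2) -> quadf A w <= m%:R * k ^+ 2 * dotp w w.
Proof.
move=> sA pA k0 dA.
have Nk i : normq A (delta_mx 0 i) <= k.
  by rewrite -(@ler_sqr R) ?nnegrE ?normq_ge0 // (normq_sqr pA).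
have Nw : normq A w <= \sum_i `|w 0 i| * k.
  rewrite {1}(row_sum_delta w); elim/big_rec2: _ => [|i a b _ H]; first by rewrite normq0.
  apply: le_trans (normqD sA pA _ _) _; rewrite normqZ; apply: lerD => //.
  by rewrite ler_wpM2l.
have S0 : 0 <= \sum_i `|w 0 i| * k by apply: sumr_ge0 => i _; rewrite mulr_ge0.
rewrite -(normq_sqr pA); apply: le_trans (_ : (\sum_i `|w 0 i| * k) ^+ 2 <= _).
  by rewrite ler_sqr ?nnegrE ?normq_ge0.
rewrite -mulr_suml exprMn [leRHS]mulrAC ler_wpM2r ?exprn_ge0 //.
pose e : 'rV[R]_m := const_mx 1; pose w' : 'rV[R]_m := \row_i `|w 0 i|.
have sI : (1%:M : 'M[R]_m)^T = 1%:M by rewrite trmx1.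
have pI (u : 'rV[R]_m) : 0 <= quadf 1%:M u.
  by rewrite quadfE -dotpE; apply: sumr_ge0 => i _; rewrite -expr2 sqr_ge0.
have := bf_cauchy e w' sI pI; rewrite !quadfE -!dotpE.
have -> : dotp e w' = \sum_i `|w 0 i| by apply: eq_bigr => i _; rewrite !mxE mul1r.
have -> : dotp e e = m%:R.
  rewrite /dotp (eq_bigr (fun=> 1)) ?sumr_const ?card_ord // => i _; rewrite !mxE mulr1 //.
suff -> : dotp w' w' = dotp w w by [].
by apply: eq_bigr => i _; rewrite !mxE -expr2 real_normK ?num_real.
Qed.

Lemma dotp_le_quadf (R : realType) m (A : 'M[R]_m) (k : R) w : A^T = A -> posdefmx A -> 
  quadf (invmx A) w <= k * dotp w w -> dotp w w <= k * quadf A w.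
Proof.
move=> sA pA uk; have H := dotp_le sA pA w w.
have d0 : 0 <= dotp w w by apply: sumr_ge0 => i _; rewrite -expr2 sqr_ge0.
have A0 := posdef_ge0 pA w.
move: d0; rewrite le_eqVlt => /orP[/eqP E|dp].
  have E0 : w = 0.
    apply/rowP => i; apply/eqP; rewrite [X in _ == X]mxE -sqrf_eq0 expr2.
    move/eqP: E; rewrite eq_sym psumr_eq0 => [/allP /(_ i (mem_index_enum _)) //|j _].
    by rewrite -expr2 sqr_ge0.
  by rewrite -E E0 quadf0 mulr0.
rewrite -(ler_pM2r dp) -expr2; apply: le_trans H _.
by rewrite (mulrC k) -mulrA ler_wpM2l.
Qed.

Lemma ler_invr (R : realType) (a b : R) : 0 < a -> a <= b -> b^-1 <= a^-1.
Proof. by move=> a0 ab; rewrite lef_pV2 // posrE //; exact: lt_le_trans ab. Qed.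

(** * Uniform lower bound on the Hessian *)

Section HessianLowerBound.
Context {R : realType} {m : nat}.
Variable v : 'rV[R]_m -> R.
Hypothesis sv : smooth setT v.
Hypothesis pv : forall xi, posdefmx (hess v xi).
Hypothesis coercive : forall x : 'rV[R]_m, exists r : R, forall xi, r < `|xi| -> v 0 <= v xi - dotp x xi.
Hypothesis Rm_le1 : forall x, Rm_sqr (legendre v) x <= 1.
Variable lambda : R.
Hypothesis lambda_gt1 : 1 < lambda.
Hypothesis shift : forall x i, legendre_point v (x + lambda *: delta_mx 0 i) = legendre_point v x + delta_mx 0 i.

Local Notation K := (hess v).
Local Notation psi := (legendre_point v).

(** Along the [x]-line of direction [e] the [i]-th coordinate of [psi] has derivative [1 / q], and
    it increases by exactly 1 over the length [lambda]. Since [q] at [t] is at most [(a + t) ^+ 2],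
    a small [a] would make the increase too large; [crossing_bound] gives [1/2 <= a]. *)
Lemma inv_hess_diag_le x i : quadf (invmx (K (psi x))) (delta_mx 0 i) <= 2 ^+ 2.
Proof.
pose e : 'rV[R]_m := delta_mx 0 i.
have e0 : e != 0.
  apply/eqP => /rowP/(_ i); rewrite !mxE !eqxx /= => /eqP; rewrite oner_eq0 //.
have qpos t := inverse_speed_gt0 sv pv (x + t *: e) e0.
have q0 := inverse_speed_gt0 sv pv x e0.
pose a := Num.sqrt (inverse_speed v e x); have a0 : 0 < a by rewrite sqrtr_gt0.
have aq : a ^+ 2 = inverse_speed v e x by rewrite sqr_sqrtr // ltW.
have dy (t : R) : is_derive t (1 : R) (fun s => psi (x + s *: e) 0 i) (inverse_speed v e (x + t *: e))^-1.
  have /is_derive_mxP/(_ 0 i) := is_derive_legendre_point_line sv pv coercive x e t.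
  congr (is_derive _ _ _ _); rewrite /inverse_speed invrK quadfE -dotp_mulmx.
  rewrite /dotp (bigD1 i) //= [e 0 i]mxE !eqxx mulr1 big1 ?addr0 // => j ji.
  by rewrite [e 0 j]mxE (negPf ji) andbF mulr0.
have hb (t : R) : 0 <= t <= lambda -> (a + t) ^- 2 <= (inverse_speed v e (x + t *: e))^-1.
  move=> /andP[t0 _]; have := inverse_speed_growth sv pv coercive Rm_le1 x t e0.
  rewrite -/a (ger0_norm t0) => H.
  exact: ler_invr (qpos t) H.
have y1 : psi (x + lambda *: e) 0 i - psi (x + 0 *: e) 0 i = 1.
  have E : (psi x + e) 0 i = psi x 0 i + 1 by rewrite mxE [e 0 i]mxE !eqxx.
  by rewrite scale0r addr0 shift E addrAC subrr add0r.
have := crossing_bound a0 lambda_gt1 (fun t _ => dy t) hb y1 => a2.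
have q4 : (2 ^+ 2)^-1 <= inverse_speed v e x.
  by rewrite -aq -exprVn ler_sqr ?nnegrE ?(ltW a0) // invr_ge0.
rewrite -[quadf _ _]invrK -/(inverse_speed v e x) -[leRHS]invrK lef_pV2 // posrE // invr_gt0 exprn_gt0 //.
Qed.

Lemma hess_ge xi w : dotp w w <= m%:R * 4 * quadf (K xi) w.
Proof.
have px : psi (grad v xi) = xi by exact: (legendre_point_grad sv pv coercive).
apply: (dotp_le_quadf (hess_sym sv xi) (pv xi)).
rewrite (_ : 4 = 2 ^+ 2); last by ring.
apply: quadf_le_diag => //; [exact: invmx_sym (hess_sym sv xi)|exact: posdef_invmx (hess_sym sv xi) (pv xi)|].
by move=> i; rewrite -px; exact: inv_hess_diag_le.
Qed.

End HessianLowerBound.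

(** * Torus-invariant Kaehler metrics *)

Lemma mxDE (R : realType) a b (M N : 'M[R]_(a, b)) i j : (M + N) i j = M i j + N i j.
Proof. by rewrite !mxE. Qed.

Lemma derive_coordinate (R : realType) m (x z : 'rV[R]_m) j :
  'D_z (fun xi : 'rV[R]_m => xi 0 j) x = z 0 j.
Proof. by apply: derive_of_line; have /is_derive_mxP/(_ 0 j) := is_derive_affine x z 0. Qed.

Section ScaledPotential.
Context {R : realType} {n : nat}.
Variables (lambda : R) (phi : 'rV[R]_n -> R).
Hypothesis lambda_gt1 : 1 < lambda.
Hypothesis Hphi : calH phi.

Let lambda_gt0 : 0 < lambda := lt_trans ltr01 lambda_gt1.
Let perphi : periodic phi. Proof. by case: Hphi. Qed.

Definition scaled_potential : 'rV[R]_n -> R := fun xi => lambda * (dotp xi xi / 2 + phi xi).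
Local Notation v := scaled_potential.

Lemma smooth_on_setT (f : 'rV[R]_n -> R) : smooth_on setT f -> smooth setT f.
Proof.
move=> [U [oU UT Cf]] k; apply: (sm_sub UT); exact: Ck_sm oU (Cf k.+1).
Qed.

Lemma phi_smooth : smooth setT phi.
Proof. by case: Hphi => sphi _ _; exact: smooth_on_setT. Qed.

Lemma half_dotp_smooth : smooth setT (fun xi : 'rV[R]_n => dotp xi xi / 2).
Proof.
move=> k; apply: (smM openT); last exact: sm_cst.
by apply: (sm_sum openT) => i _; apply: (smM openT); exact: sm_coord.
Qed.

Lemma unscaled_smooth : smooth setT (fun xi => dotp xi xi / 2 + phi xi).
Proof. by move=> k; apply: (smD openT); [exact: half_dotp_smooth|exact: phi_smooth]. Qed.

Lemma scaled_potential_smooth : smooth setT v.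
Proof. by move=> k; apply: (smM openT); [exact: sm_cst|exact: unscaled_smooth]. Qed.

Lemma derive_half_dotp z x : 'D_z (fun xi : 'rV[R]_n => dotp xi xi / 2) x = dotp z x.
Proof.
apply: derive_of_line.
have D := is_derive_affine x z 0.
have := is_derive_bf (is_derive_cstV 1%:M 0) D D.
rewrite bf0m add0r scale0r addr0 (bfC x) ?trmx1 // => D2.
rewrite (_ : (fun s : R => _) = (fun s => 2^-1 * bf 1%:M (x + s *: z) (x + s *: z))); last first.
  by apply/funext => s; rewrite dotpE mulrC.
apply: is_derive_eq (@is_deriveZ R R R _ 2^-1 0 1 _ D2) _.
by rewrite dotpE /GRing.scale /=; field.
Qed.

Lemma grad_scaled_potential xi : grad v xi = lambda *: (xi + grad phi xi).
Proof.
apply/rowP => i; rewrite [LHS]mxE mxZE mxDE [grad phi xi 0 i]mxE /partial.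
have [d1 _] := (smS _ _ _).1 (half_dotp_smooth 1%N); have [d2 _] := (smS _ _ _).1 (phi_smooth 1%N).
have e1 : derivable (fun xi : 'rV[R]_n => dotp xi xi / 2) xi (delta_mx 0 i) by apply: diff_derivable; exact: d1.
have e2 : derivable phi xi (delta_mx 0 i) by apply: diff_derivable; exact: d2.
have e3 : derivable (fun xi : 'rV[R]_n => dotp xi xi / 2 + phi xi) xi (delta_mx 0 i) by exact: derivableD.
have -> : 'D_(delta_mx 0 i) v xi = lambda * 'D_(delta_mx 0 i) (fun xi : 'rV[R]_n => dotp xi xi / 2 + phi xi) xi.
  exact: (deriveZ lambda e3).
rewrite (deriveD e1 e2) derive_half_dotp; congr (_ * (_ + _)).
rewrite /dotp (bigD1 i) //= mxE !eqxx mul1r big1 ?addr0 // => k ki.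
by rewrite mxE (negPf ki) andbF mul0r.
Qed.

Lemma grad_scaled_potential_shift xi i : grad v (xi + delta_mx 0 i) = grad v xi + lambda *: delta_mx 0 i.
Proof.
rewrite !grad_scaled_potential -scalerDr; congr (_ *: _); rewrite addrAC; congr (_ + _ + _).
apply/rowP => j; rewrite !mxE; apply: derive_periodic perphi _ _ _ => k.
by rewrite !mxE addrAC subrr add0r natr_int.
Qed.

Lemma hess_scaled_potential_periodic : periodic (hess v).
Proof.
move=> p q pq; apply/matrixP => i j; rewrite [LHS]mxE [RHS]mxE.
have E : partial j v = (fun xi => lambda * (xi 0 j + partial j phi xi)).
  apply/funext => xi; have /rowP/(_ j) := grad_scaled_potential xi.
  by rewrite [LHS]mxE => ->; rewrite mxZE mxDE [grad phi xi 0 j]mxE.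
have d1 xi : derivable (fun xi : 'rV[R]_n => xi 0 j) xi (delta_mx 0 i).
  by apply: diff_derivable; exact: differentiable_coord.
have d2 xi : derivable (partial j phi) xi (delta_mx 0 i).
  have [d _] := (smS _ _ _).1 (partial_smooth j phi_smooth 1%N).
  by apply: diff_derivable; exact: d.
have E2 xi : partial i (partial j v) xi =
    lambda * ('D_(delta_mx 0 i) (fun xi : 'rV[R]_n => xi 0 j) xi + partial i (partial j phi) xi).
  have d3 : derivable (fun xi : 'rV[R]_n => xi 0 j + partial j phi xi) xi (delta_mx 0 i) by exact: derivableD.
  rewrite E /partial; apply: etrans (deriveZ lambda d3) _.
  by rewrite (deriveD (d1 xi) (d2 xi)).
rewrite !E2 !derive_coordinate.
suff -> : partial i (partial j phi) p = partial i (partial j phi) q by [].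
have P1 : periodic (partial j phi) by exact: derive_periodic.
have P2 : periodic (partial i (partial j phi)) by exact: derive_periodic.
exact: P2.
Qed.

Lemma hess_scaled_potential_posdef xi : posdefmx (hess v xi).
Proof.
have [_ _ pos] := Hphi.
have -> : hess v xi = lambda *: hess (fun y => dotp y y / 2 + phi y) xi.
  have s1 := unscaled_smooth.
  apply/matrixP => i j; rewrite [LHS]mxE [RHS]mxE [hess _ _ _ _]mxE.
  have d y : derivable (fun y => dotp y y / 2 + phi y) y (delta_mx 0 j).
    by have [d _] := (smS _ _ _).1 (s1 1%N); apply: diff_derivable; exact: d.
  have -> : partial j v = (fun y => lambda * partial j (fun y => dotp y y / 2 + phi y) y).
    by apply/funext => y; exact: (deriveZ lambda (d y)).
  apply: (deriveZ lambda); have [d' _] := (smS _ _ _).1 (partial_smooth j s1 1%N).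
  by apply: diff_derivable; exact: d'.
by move=> w w0; rewrite quadfE bfZm mulr_gt0 //; exact: pos.
Qed.

Lemma dotp_le_norm (x y : 'rV[R]_n) : dotp x y <= n%:R * `|x| * `|y|.
Proof.
apply: (@le_trans _ _ (\sum_(i < n) `|x| * `|y|)).
  apply: ler_sum => i _; apply: le_trans (ler_norm _) _.
  by rewrite normrM ler_pM ?norm_coord_le.
by rewrite sumr_const card_ord -mulrA mulr_natl.
Qed.

(** By periodicity [phi] is bounded below, and the quadratic term outgrows the linear form
    [dotp x xi]. *)
Lemma scaled_potential_coercive (x : 'rV[R]_n) :
  exists r : R, forall xi, r < `|xi| -> v 0 <= v xi - dotp x xi.
Proof.
have [C C0 HC] := continuous_bounded_ball 1 (fun y => sm_continuous (phi_smooth 0%N) (I : setT y)).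
have phiC xi : - C <= phi xi.
  have [q qq q1] := floor_representative xi; rewrite (perphi qq).
  by have := HC q q1; rewrite ler_norml => /andP[].
(* Once [s] exceeds [2 * Y + 2 * D + 1], half of [s ^+ 2] dominates the linear part [Y * s] and the
   constant part [D]. *)
pose Y := n%:R * `|x|; pose D := `|v 0| + lambda * C.
have Y0 : 0 <= Y by rewrite mulr_ge0.
have D0 : 0 <= D by rewrite addr_ge0 // mulr_ge0 // ltW.
exists (2 * Y + 2 * D + 1) => xi; move: (norm_sq_le_dotp xi) (dotp_le_norm x xi); rewrite -/Y.
set s := `|xi| => h1 h2 h3.
have s2 : Y * s + D <= s ^+ 2 / 2.
  have : (2 * Y + 2 * D + 1) * s <= s * s by rewrite ler_wpM2r ?normr_ge0 // ltW.
  have : D * 1 <= D * s by rewrite ler_wpM2l //; lra.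
  rewrite (_ : (2 * Y + 2 * D + 1) * s = 2 * (Y * s) + 2 * (D * s) + s); last by ring.
  rewrite expr2 mulr1; have : 0 <= s by exact: normr_ge0.
  by move: (s * s) (Y * s) (D * s) => a b d; lra.
have l1 : s ^+ 2 / 2 <= lambda * (dotp xi xi / 2).
  apply: le_trans (_ : 1 * (dotp xi xi / 2) <= _); first by rewrite mul1r ler_pM2r.
  have dd := le_trans (exprn_ge0 2 (normr_ge0 xi)) h1.
  by apply: ler_wpM2r; [rewrite divr_ge0|exact: ltW].
have l2 : lambda * - C <= lambda * phi xi by rewrite ler_wpM2l // ltW.
have v0 := ler_norm (v 0).
rewrite [v xi]/scaled_potential mulrDr.
move: s2 l1 l2 v0; rewrite /D mulrN.
move: (lambda * (dotp xi xi / 2)) (lambda * phi xi) (lambda * C) (s ^+ 2 / 2) (v 0) `|v 0| (Y * s) h2 => a b e f g k l h2; lra.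
Qed.

(** The quadratic part makes the gradient equivariant under lattice translations, up to the factor
    [lambda]; its inverse inherits this. *)
Lemma legendre_point_shift x i :
  legendre_point v (x + lambda *: delta_mx 0 i) = legendre_point v x + delta_mx 0 i.
Proof.
have sv := scaled_potential_smooth; have pv := hess_scaled_potential_posdef.
have cv := scaled_potential_coercive.
apply: (grad_inj sv pv) => //.
by rewrite grad_scaled_potential_shift !(grad_legendre_point sv cv).
Qed.

End ScaledPotential.

(** * From the Hessian metric to the Riemannian metric in both variables *)

Section BlockMetric.
Context {R : realType} {n : nat}.

Lemma quadf_block (M N : 'M[R]_n) (w : 'rV[R]_(n + n)) :
  quadf (block_mx M 0 0 N) w = quadf M (lsubmx w) + quadf N (rsubmx w).
Proof.
rewrite /quadf -{1 2}(hsubmxK w) mul_row_block !mulmx0 addr0 add0r tr_row_mx mul_row_col.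
exact: mxDE.
Qed.

Lemma dotp_split (w : 'rV[R]_(n + n)) : dotp w w = dotp (lsubmx w) (lsubmx w) + dotp (rsubmx w) (rsubmx w).
Proof. by rewrite /dotp big_split_ord /=; congr (_ + _); apply: eq_bigr => i _; rewrite !mxE. Qed.

Lemma derive_lsubmx (f : 'rV[R]_n -> R) (p mu : 'rV[R]_(n + n)) : differentiable f (lsubmx p) ->
  'D_mu (fun q : 'rV[R]_(n + n) => f (lsubmx q)) p = 'D_(lsubmx mu) f (lsubmx p).
Proof.
move=> df; apply: derive_of_line.
have E : lsubmx p + 0 *: lsubmx mu = lsubmx p by rewrite scale0r addr0.
have d : derivable f (lsubmx p + 0 *: lsubmx mu) (lsubmx mu) by rewrite E; exact: diff_derivable.
have := is_derive_line d; rewrite E.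
rewrite (_ : (fun s : R => f (lsubmx (p + s *: mu))) = (fun s => f (lsubmx p + s *: lsubmx mu))) //.
by apply/funext => s; rewrite !linearD /= linearZ.
Qed.

Variable K : 'rV[R]_n -> 'M[R]_n.
Hypothesis sK : forall i j, smooth setT (fun xi => K xi i j).

Definition double_metric (p : 'rV[R]_(n + n)) : 'M[R]_(n + n) :=
  block_mx (K (lsubmx p)) 0 0 (K (lsubmx p)).

(** The operator [D] is left abstract so that the first and second derivatives share one case
    analysis on blocks. *)
Lemma double_metric_coord (T : 'rV[R]_(n + n) -> 'M[R]_(n + n)) (A : 'rV[R]_(n + n) -> 'M[R]_n)
    (D : ('rV[R]_(n + n) -> R) -> 'rV[R]_(n + n) -> R) :
  (forall p i j, T p i j = D (fun q => double_metric q i j) p) ->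
  (forall p, D (fun=> 0) p = 0) ->
  (forall p i j, D (fun q => K (lsubmx q) i j) p = A p i j) ->
  forall p, T p = block_mx (A p) 0 0 (A p).
Proof.
move=> TD D0 DA p; apply/matrixP => i j; rewrite TD.
have E (g : 'rV[R]_(n + n) -> R) : (forall q, double_metric q i j = g q) -> D (fun q => double_metric q i j) p = D g p.
  by move=> H; congr (D _ p); apply/funext.
case: (splitP i) => a ia; case: (splitP j) => b jb.
- rewrite (_ : i = lshift n a) in E *; last by apply/val_inj.
  rewrite (_ : j = lshift n b) in E *; last by apply/val_inj.
  by rewrite (E (fun q => K (lsubmx q) a b)) ?DA ?block_mxEul // => q; rewrite block_mxEul.
- rewrite (_ : i = lshift n a) in E *; last by apply/val_inj.
  rewrite (_ : j = rshift n b) in E *; last by apply/val_inj.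
  by rewrite (E (fun=> 0)) ?D0 ?block_mxEur ?mxE // => q; rewrite block_mxEur mxE.
- rewrite (_ : i = rshift n a) in E *; last by apply/val_inj.
  rewrite (_ : j = lshift n b) in E *; last by apply/val_inj.
  by rewrite (E (fun=> 0)) ?D0 ?block_mxEdl ?mxE // => q; rewrite block_mxEdl mxE.
- rewrite (_ : i = rshift n a) in E *; last by apply/val_inj.
  rewrite (_ : j = rshift n b) in E *; last by apply/val_inj.
  by rewrite (E (fun q => K (lsubmx q) a b)) ?DA ?block_mxEdr // => q; rewrite block_mxEdr.
Qed.

Lemma dmetric_double p mu : dmetric double_metric p mu =
  block_mx (dmetric K (lsubmx p) (lsubmx mu)) 0 0 (dmetric K (lsubmx p) (lsubmx mu)).
Proof.
apply: (@double_metric_coord (fun p => dmetric double_metric p mu)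
  (fun p => dmetric K (lsubmx p) (lsubmx mu)) (fun f => 'D_mu f)) => [q i j|q|q i j].
- by rewrite mxE.
- exact: derive_cst.
- apply: etrans (derive_lsubmx (f := fun xi => K xi i j) mu _) _; last by rewrite mxE.
  exact: metric_differentiable.
Qed.

Lemma d2metric_double p mu nu : d2metric double_metric p mu nu =
  block_mx (d2metric K (lsubmx p) (lsubmx mu) (lsubmx nu)) 0 0
           (d2metric K (lsubmx p) (lsubmx mu) (lsubmx nu)).
Proof.
apply: (@double_metric_coord (fun p => d2metric double_metric p mu nu)
  (fun p => d2metric K (lsubmx p) (lsubmx mu) (lsubmx nu)) (fun f => 'D_nu ('D_mu f))) => [q i j|q|q i j].
- by rewrite mxE.
- by rewrite (_ : 'D_mu _ = (fun=> 0)) ?derive_cst //; apply/funext => x; exact: derive_cst.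
- have -> : 'D_mu (fun q => K (lsubmx q) i j) = (fun q => 'D_(lsubmx mu) (fun xi => K xi i j) (lsubmx q)).
    apply/funext => x; apply: (derive_lsubmx (f := fun xi => K xi i j)).
    exact: metric_differentiable.
  apply: etrans (derive_lsubmx (f := 'D_(lsubmx mu) (fun xi => K xi i j)) nu _) _; last by rewrite mxE.
  exact: derive_metric_differentiable.
Qed.

Lemma double_metric_smooth i j : smooth setT (fun p => double_metric p i j).
Proof.
have S a b : smooth setT (fun p : 'rV[R]_(n + n) => K (lsubmx p) a b).
  move=> k; apply: (sm_comp openT openT (fun _ _ => I) (sK a b k)).
  by apply: (sm_lsubmx openT); exact: sm_id openT.
have E g : (forall q, g q = double_metric q i j) -> smooth setT g -> smooth setT (fun p => double_metric p i j).
  by move=> H sg k; apply: sm_eq (sg k) => q; rewrite H.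
have Z : smooth setT (fun _ : 'rV[R]_(n + n) => 0 : R) by move=> k; exact: sm_cst.
case: (splitP i) => a ia; case: (splitP j) => b jb.
- apply: E (S a b) => q; rewrite (_ : i = lshift n a); last exact/val_inj.
  by rewrite (_ : j = lshift n b) ?block_mxEul //; exact/val_inj.
- apply: E Z => q; rewrite (_ : i = lshift n a); last exact/val_inj.
  by rewrite (_ : j = rshift n b) ?block_mxEur ?mxE //; exact/val_inj.
- apply: E Z => q; rewrite (_ : i = rshift n a); last exact/val_inj.
  by rewrite (_ : j = lshift n b) ?block_mxEdl ?mxE //; exact/val_inj.
- apply: E (S a b) => q; rewrite (_ : i = rshift n a); last exact/val_inj.
  by rewrite (_ : j = rshift n b) ?block_mxEdr //; exact/val_inj.
Qed.

Hypothesis symK : forall xi, (K xi)^T = K xi.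
Hypothesis pK : forall xi, posdefmx (K xi).

Lemma double_metric_sym p : (double_metric p)^T = double_metric p.
Proof. by rewrite /double_metric tr_block_mx !trmx0 symK. Qed.

Lemma double_metric_periodic : periodic K -> periodic double_metric.
Proof.
move=> perK p q pq; rewrite /double_metric (perK (lsubmx p) (lsubmx q)) // => i.
by rewrite !mxE; exact: pq.
Qed.

(** The metric depends on [xi] alone, so its derivatives see only the [xi]-component of a direction;
    this converts their bounds to the full norm. *)
Lemma normq_double_ge p mu : normq (K (lsubmx p)) (lsubmx mu) <= normq (double_metric p) mu.
Proof.
by rewrite /normq; apply: ler_wsqrtr; rewrite quadf_block lerDl; exact: posdef_ge0 (pK _) _.
Qed.

Lemma quadf_double_ge0 p w : 0 <= quadf (double_metric p) w.
Proof. by rewrite quadf_block addr_ge0 // posdef_ge0. Qed.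

Lemma quadf_double_bound (T : 'M[R]_n) (k k' : R) p w : 0 <= k -> k <= k' ->
  (forall z, `|quadf T z| <= k * quadf (K (lsubmx p)) z) ->
  `|quadf (block_mx T 0 0 T) w| <= k' * quadf (double_metric p) w.
Proof.
move=> k0 kk' H; apply: le_trans (ler_wpM2r (quadf_double_ge0 p w) kk').
rewrite !quadf_block mulrDr; apply: le_trans (ler_normD _ _) _.
by apply: lerD; exact: H.
Qed.

End BlockMetric.

(** * Choice of the radius and conclusion *)

Lemma small_radius_exists (R : realType) (N : R) : 1 <= N ->
  exists r : R, [/\ 0 < r, 1152 * (3 * r) <= 1,
    6 * ((384 * 10 + 96 * 3 ^+ 2) * r ^+ 2) <= 1 & 36 * r ^+ 2 <= (N * 4)^-1].
Proof.
move=> N1; have N0 := lt_le_trans ltr01 N1.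
have y0 : 0 < N^-1 by rewrite invr_gt0.
have y1 : N^-1 <= 1 by rewrite invf_le1.
rewrite invfM; move: N^-1 y0 y1 => y y0 y1.
(* The radius is [y / 4096]; as [y <= 1], this makes [4096 * r ^+ 2 <= r], and the remaining
   inequalities become linear. *)
have [r ry] : exists r : R, 64 * (64 * r) = y.
  by exists (64^-1 * (64^-1 * y)); field.
have r0 : 0 < r by move: y0; rewrite -ry !pmulr_rgt0.
have rr : 64 * (64 * r ^+ 2) <= r.
  have : 64 * (64 * r) * r <= 1 * r by rewrite ler_pM2r // ry.
  by rewrite mul1r expr2 !mulrA.
by exists r; move: (r ^+ 2) rr => r2 rr; split; [exact: r0|lra|lra|lra].
Qed.

(** The constants 3, 10 and [(n%:R * 4)^-1] of the three estimates on the Hessian are independent of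
    [lambda] and [phi], and they carry over to the metric in [xi] and [eta]. *)
Lemma injectivity_radius_scaled (R : realType) n (lambda : R) (phi : 'rV[R]_n -> R) x r : (0 < n)%N ->
  0 < r -> 1152 * (3 * r) <= 1 -> 6 * ((384 * 10 + 96 * 3 ^+ 2) * r ^+ 2) <= 1 ->
  36 * r ^+ 2 <= (n%:R * 4)^-1 ->
  1 < lambda -> calH phi ->
  (forall y, Rm_sqr (legendre (scaled_potential lambda phi)) y <= 1) ->
  (r%:E <= injectivity_radius (riem_metric (scaled_potential lambda phi)) x)%E.
Proof.
move=> n0 r0 r1 r2 r3 l1 Hphi Rm1; set v := scaled_potential lambda phi in Rm1 *.
have sv : smooth setT v := scaled_potential_smooth lambda Hphi.
have pv := hess_scaled_potential_posdef l1 Hphi.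
have cv := scaled_potential_coercive l1 Hphi.
have symK := hess_sym sv; have sK := hess_smooth sv.
have ge := hess_ge sv pv cv Rm1 l1 (legendre_point_shift l1 Hphi).
have nR : 1 <= (n%:R : R) by rewrite ler1n.
have n4 : 0 < (n%:R : R) * 4 by rewrite mulr_gt0 // (lt_le_trans _ nR).
pose c : R := (n%:R * 4)^-1; have c0 : 0 < c by rewrite invr_gt0.
have dge xi w : c * dotp w w <= quadf (hess v xi) w by rewrite ler_pdivrMl.
have cG p w : c * dotp w w <= quadf (double_metric (hess v) p) w.
  by rewrite dotp_split mulrDr quadf_block; apply: lerD; exact: dge.
have HA p mu w : `|quadf (dmetric (double_metric (hess v)) p mu) w| <=
    3 * normq (double_metric (hess v) p) mu * quadf (double_metric (hess v) p) w.
  rewrite (dmetric_double sK).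
  apply: (quadf_double_bound pv (k := 3 * normq (hess v (lsubmx p)) (lsubmx mu))) => [||z].
  - by rewrite mulr_ge0 // normq_ge0.
  - by rewrite ler_wpM2l // normq_double_ge.
  - exact: dmetric_hess_bound.
have HB p mu nu w : `|quadf (d2metric (double_metric (hess v)) p mu nu) w| <=
    10 * (normq (double_metric (hess v) p) mu * normq (double_metric (hess v) p) nu) *
    quadf (double_metric (hess v) p) w.
  rewrite (d2metric_double sK).
  apply: (quadf_double_bound pv (k := 10 * (normq (hess v (lsubmx p)) (lsubmx mu) * normq (hess v (lsubmx p)) (lsubmx nu)))) => [||z].
  - by rewrite !mulr_ge0 // normq_ge0.
  - by rewrite ler_wpM2l // ler_pM ?normq_ge0 // normq_double_ge.
  - exact: d2metric_hess_bound.
have A0 : 0 <= (3 : R) := ler0n R 3.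
have B0 : 0 <= (10 : R) := ler0n R 10.
exact: (injectivity_radius_ge (double_metric_smooth sK) (double_metric_sym symK)
  (double_metric_periodic (hess_scaled_potential_periodic lambda Hphi)) c0 cG A0 B0 HA HB x r0 r1 r2 r3).
Qed.

Theorem theorem1p1 (R : realType) (n : nat) (n_ge1 : (1 <= n)%N)
    (M C : R) (M_gt0 : 0 < M) (C_gt0 : 0 < C) :
  exists2 C1 : R, 0 < C1 &
    forall (lambda : R) (v : R -> 'rV[R]_n -> R),
      1 < lambda ->
      calabi_flow lambda (-1) 0 v ->
      (forall t (p : 'rV[R]_(n + n)), -1 <= t <= 0 -> Rm_norm (v t) p <= 1) ->
      (torus_integral
           (fun p => Rm_norm (v 0) p ^+ n * volume_density (v 0) p)%R
         < C%:E)%E ->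
      M_condition M (cube lambda) (legendre (v 0)) ->
      forall x : 'rV[R]_(n + n),
        Rm_norm (v 0) x = 1 ->
        (C1%:E <= injectivity_radius (riem_metric (v 0%R)) x)%E.
Proof.
have n1 : 1 <= (n%:R : R) by rewrite ler1n.
have [r [r0 r1 r2 r3]] := small_radius_exists n1; exists r => //.
move=> lambda v l1 [_ Hv _] Rm1 _ _ x _.
have I0 : -1 <= (0 : R) <= 0 by rewrite lexx andbT; lra.
have [phi Hphi vE] := Hv 0 I0; have {}Rm1 p := Rm1 0 p I0.
rewrite vE; apply: (injectivity_radius_scaled x n_ge1 r0 r1 r2 r3 l1 Hphi) => y.
(* The curvature norm is assumed bounded at points of the torus; surjectivity of the gradient makes
   this a bound at every [y] in the Legendre coordinate. *)
have [xi xiE] := grad_surj (scaled_potential_smooth lambda Hphi) (scaled_potential_coercive l1 Hphi) y.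
have := Rm1 (row_mx xi 0); rewrite vE /Rm_norm row_mxKl -/(scaled_potential lambda phi) xiE.
by rewrite -[X in _ <= X]sqrtr1 ler_sqrt.
Qed.
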